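(* Let $c>0$ and let $v:\mathbb{R}\to\mathbb{R}$ be a bounded continuous solution of the steady bidirectional Whitham equation $$K_B*v=v(c-v)(c-v/2)$$ with $v\le (1-\tfrac{1}{\sqrt3})c$ on $\mathbb{R}$, such that $v$ is even, $v(0)=(1-\tfrac{1}{\sqrt3})c$, and $v$ is smooth and decreasing on a nonempty interval $(0,\nu)$. Let $\varphi=cv-v^2/2$. Then $$v(x)=\Bigl(1-\frac{1}{\sqrt3}\Bigr)c-\Bigl(\frac{1}{\sqrt3\,\pi c}+o(1)\Bigr)x\log(1/x),\qquad \varphi(x)=\frac{c^2}{3}-\Bigl(\frac{1}{3\pi}+o(1)\Bigr)x\log(1/x)$$ as $x\searrow0$. Moreover, $$v'(x)=-\Bigl(\frac{1}{\sqrt3\,\pi c}+o(1)\Bigr)\log(1/x),\qquad \varphi'(x)=-\Bigl(\frac{1}{3\pi}+o(1)\Bigr)\log(1/x)$$ as $x\searrow0$.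
   Context: The kernel $K_B\in L^1(\mathbb{R})$ is defined by its Fourier transform $\hat K_B(\xi)=\int_{\mathbb{R}}K_B(x)e^{-ix\xi}\,dx=\tanh(\xi)/\xi$; explicitly $K_B(x)=\frac1\pi\log\bigl(\coth(\pi|x|/4)\bigr)$. The relation $\varphi=cv-v^2/2$ comes from the second equation $-cv+\varphi+v^2/2=0$ of the steady Whitham-Boussinesq system. ''Decreasing'' means strictly decreasing. *)

(* Defs.v *)
From HB Require Import structures.
From mathcomp Require Import all_boot all_order all_algebra.
From mathcomp Require Import all_classical all_reals all_analysis.

Set Implicit Arguments.
Unset Strict Implicit.
Unset Printing Implicit Defensive.

Import Order.TTheory GRing.Theory Num.Theory.
Import numFieldNormedType.Exports.

Local Open Scope classical_set_scope.
Local Open Scope ring_scope.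

Definition coth {R : realType} (x : R) : R :=
  (expR x + expR (- x)) / (expR x - expR (- x)).

Definition tanh {R : realType} (x : R) : R :=
  (expR x - expR (- x)) / (expR x + expR (- x)).

Definition K_B {R : realType} (x : R) : R :=
  pi^-1 * ln (coth (pi * `|x| / 4)).

Definition convolution {R : realType} (f g : R -> R) (x : R) : R :=
  \int[@lebesgue_measure R]_y (f (x - y) * g y).

Definition smooth_on {R : realType} (D : set R) (f : R -> R) : Prop :=
  forall (n : nat) (x : R), D x -> derivable (derive1n n f) x 1.

(* Main.v *)
Require Import Defs.
From HB Require Import structures.
From mathcomp Require Import all_boot all_order all_algebra.
From mathcomp Require Import all_classical all_reals all_analysis.
From mathcomp Require Import measurable_realfun.
From mathcomp Require Import ring lra.

(** Let a = (1 - 1 / sqrt 3) c be the height of the crest, b = sqrt 3 c and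
    w = a - v, an even nonnegative function that vanishes at 0 and increases on
    (0, nu).  The height a is a critical point of u (c - u) (c - u / 2), so the
    equation becomes quadratic at the crest: Phi (w x) = const - (K_B * v) (x)
    with Phi t = (b / 2) t^2 + t^3 / 2 ([Phi_complement]).  Subtracting it at
    x - h from itself at x + h and folding the line with the parity of v and of
    the kernel gives, for every constant alpha,

      Phi (w (x + h)) - Phi (w (x - h)) = int_0^oo T y * (w y - alpha) dy,
      T y = K (y - x - h) - K (y - x + h) - K (y + x - h) + K (y + x + h),

    as T has integral zero ([convolution_mixed_difference], [posl_mixedK],
    [crest_of_solution]).  T is a mixed second difference, hence equals
    4 x h K'' at a nearby point ([K_B_mixed_difference]); since K'' z behaves as
    1 / (pi z^2) near zero and decays exponentially, T is close to
    4 x h / (pi y^2) when y is large against x + h and small against 1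
    ([mixedK_mid], [mixedK_tail]).  Next to the logarithmic singularities of the
    kernel only integral bounds are used ([spike], [L1_spike]).

    Size of w.  For h = x = X / 2 and alpha = 0 the identity reads, to leading
    order, (b / 2) w(X)^2 = (X^2 / pi) * int_X^d w(y) / y^2 dy.  If w is at most
    B y log(1/y), the right-hand side is at most (B / (2 pi)) (X log(1/X))^2 up
    to lower order terms ([Phi_upper]).  With A = 1 / (b pi) and B' = (A + B) / 2,

      (b / 2) B'^2 - B / (2 pi) = (b / 2) ((B - A) / 2)^2 > 0,

    so the constant B improves to B' ([below_log_step]), and iteration brings it
    as close to A as desired.  A first constant B is found by applying the
    inequality at the point of [X, d] where w(y) / (y log(1/y)) is largest
    ([crest_below_log]).  The lower bound is symmetric ([Phi_lower],
    [crest_above_log], [above_log_step]).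

    Slope.  Dividing by 2 h with alpha = w x and letting h tend to zero turns
    the left-hand side into Phi' (w x) w' x, about b A x log(1/x) w' x, while
    the range x << y << 1 contributes (A / pi) x log(1/x)^2; the quotient of the
    two is A log(1/x).  Near y = x the kernel difference has the sign of y - x,
    and so has w y - w x, which is harmless for the lower bound
    ([slope_lower]).  For the upper bound one needs w to be Lipschitz near x
    with a constant M, and the error is O(M x) ([slope_upper]).  That M may be
    taken of order log(1/x) follows by applying the same estimate at the point s
    of [x/2, 3x/2] where (x / 2 - |s - x|) w' s is largest ([dw_bounded]): the
    weight makes w' at most twice w' s on an interval around s, and the error
    term is absorbed by the left-hand side. *)

Set Implicit Arguments.
Unset Strict Implicit.
Unset Printing Implicit Defensive.

Import Order.TTheory GRing.Theory Num.Theory.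
Import numFieldNormedType.Exports.

Local Open Scope classical_set_scope.
Local Open Scope ring_scope.

(** * Integrable functions on the line *)

Section LineIntegral.
Context {R : realType}.
Notation mu := (@lebesgue_measure R).
Implicit Types f g : R -> R.

Definition L1 f := mu.-integrable [set: R] (EFin \o f).
Definition lint f : R := \int[mu]_x f x.

Lemma L1_measurable f : L1 f -> measurable_fun setT f.
Proof. by move=> /measurable_int /measurable_EFinP. Qed.

Lemma L1_le f g : measurable_fun setT f -> (forall x, `|f x| <= g x) ->
  L1 g -> L1 f.
Proof.
move=> mf fg; apply: le_integrable => //; first exact/measurable_EFinP.
by move=> x _ /=; rewrite lee_fin (le_trans (fg x))// ler_norm.
Qed.

Lemma L1D f g : L1 f -> L1 g -> L1 (fun x => f x + g x).
Proof. by move=> i j; exact: (integrableD measurableT i j). Qed.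

Lemma L1B f g : L1 f -> L1 g -> L1 (fun x => f x - g x).
Proof. by move=> i j; exact: (integrableB measurableT i j). Qed.

Lemma L1Z k f : L1 f -> L1 (fun x => k * f x).
Proof. by move=> i; exact: (integrableZl measurableT k i). Qed.

Lemma lintD f g : L1 f -> L1 g -> lint (fun x => f x + g x) = lint f + lint g.
Proof. by move=> ? ?; exact: RintegralD. Qed.

Lemma lintB f g : L1 f -> L1 g -> lint (fun x => f x - g x) = lint f - lint g.
Proof. by move=> ? ?; exact: RintegralB. Qed.

Lemma lintZ k f : L1 f -> lint (fun x => k * f x) = k * lint f.
Proof. by move=> ?; exact: RintegralZl. Qed.

(** The inequalities between kernels fail at their singularities, where the kernel takes the
    value 0 instead of infinity; these are finitely many points. *)
Lemma le_lint_off (s : seq R) f g : L1 f -> L1 g ->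
  (forall x, x \notin s -> f x <= g x) -> lint f <= lint g.
Proof.
move=> if_ ig fg; rewrite /lint /Rintegral.
have ms : measurable ([set` s] : set R).
  apply: countable_measurable; last exact: (finite_set_countable (finite_seq s)).
  by move=> x; exact: measurable_set1.
have s0 : mu [set` s] = 0%E.
  exact: (countable_lebesgue_measure0 (finite_set_countable (finite_seq s))).
rewrite (@negligible_integral _ _ _ mu setT [set` s] (EFin \o f) ms measurableT if_ s0).
rewrite (@negligible_integral _ _ _ mu setT [set` s] (EFin \o g) ms measurableT ig s0).
have mD : measurable ([set: R] `\` [set` s]) by exact: measurableD.
apply: le_Rintegral => //; [exact: integrableS if_|exact: integrableS ig|].
by move=> x [_ /= /negP]; exact: fg.
Qed.

(** Translations and the reflection both preserve the measure. Integrals of nonnegative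
    functions are transported first, which gives the integrability of the composite. *)
Lemma L1_pushforward (phi : measurableTypeR R -> measurableTypeR R) f :
  measurable_fun setT phi ->
  (forall A, measurable A -> mu (phi @^-1` A) = mu A) ->
  L1 f -> L1 (f \o phi) /\ lint (f \o phi) = lint f.
Proof.
move=> mphi muphi iF.
have mf := L1_measurable iF.
have iE g : measurable_fun setT g -> (forall x, 0 <= g x) ->
    (\int[mu]_x (g (phi x))%:E = \int[mu]_x (g x)%:E)%E.
  move=> mg g0; rewrite [RHS](_ : _ = \int[pushforward mu phi]_x (g x)%:E)%E.
    rewrite ge0_integral_pushforward//; first exact/measurable_EFinP.
    by move=> y _; rewrite lee_fin.
  by apply: eq_measure_integral => //= A mA _; rewrite /pushforward muphi.
have iFp : L1 (f \o phi).
  apply/integrableP; split.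
    by apply/measurable_EFinP; exact: measurableT_comp.
  have /integrableP[_] := iF.
  rewrite (_ : (\int[mu]_x `|(EFin \o f) x| = \int[mu]_x (`|f x|)%:E)%E)//.
  by rewrite -(iE (fun x => `|f x|))//; exact: measurableT_comp.
split => //; rewrite /lint /Rintegral; congr fine.
rewrite [RHS](_ : _ = \int[pushforward mu phi]_x (f x)%:E)%E; last first.
  by apply: eq_measure_integral => //= A mA _; rewrite /pushforward muphi.
by rewrite integral_pushforward//; exact/measurable_EFinP.
Qed.

Lemma lebesgue_measure_shift (t : R) (A : set R) : measurable A ->
  mu ((fun x => x + t) @^-1` A) = mu A.
Proof.
move=> mA.
have mt : measurable_fun setT ((fun x : R => x + t) : R -> measurableTypeR R).
  by apply: measurable_funD.
pose nu := pushforward mu ((fun x : R => x + t) : R -> measurableTypeR R).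
apply/esym; rewrite -[RHS]/(nu A).
apply: (@lebesgue_measure_unique _ nu) => //= _ [[a b]] _ <-.
rewrite /nu /pushforward (_ : _ @^-1` _ = `](a - t), (b - t)]%classic).
  by rewrite !lebesgue_measure_itv/= !lte_fin ltrD2r -!EFinD; congr (if _ then _%:E else _); ring.
by apply/seteqP; split=> x /=; rewrite !in_itv/= ltrBlDr lerBrDr.
Qed.

Lemma L1_shift t f : L1 f -> L1 (fun x => f (x + t)).
Proof.
move=> /(@L1_pushforward (fun x => x + t)) []//; first exact: measurable_funD.
by move=> A mA; exact: lebesgue_measure_shift.
Qed.

Lemma lint_shift t f : L1 f -> lint (fun x => f (x + t)) = lint f.
Proof.
move=> /(@L1_pushforward (fun x => x + t)) []//; first exact: measurable_funD.
by move=> A mA; exact: lebesgue_measure_shift.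
Qed.

Lemma L1_opp f : L1 f -> L1 (fun x => f (- x)).
Proof.
move=> /(@L1_pushforward (fun x => - x)) []//.
  by apply: continuous_measurable_fun; exact: opp_continuous.
by move=> A mA; rewrite -[RHS](lebesgue_measureN mA).
Qed.

Lemma lint_opp f : L1 f -> lint (fun x => f (- x)) = lint f.
Proof.
move=> /(@L1_pushforward (fun x => - x)) []//.
  by apply: continuous_measurable_fun; exact: opp_continuous.
by move=> A mA; rewrite -[RHS](lebesgue_measureN mA).
Qed.

Lemma L1_itv (f : R -> R) (a b : R) : {within `[a, b], continuous f} ->
  L1 (fun x => f x * \1_(`[a, b] : set R) x).
Proof.
move=> cf.
have : mu.-integrable `[a, b] (EFin \o f).
  by apply: continuous_compact_integrable => //; exact: segment_compact.
move/integrable_mkcond => /(_ (measurable_itv _)); apply: eq_integrable => //.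
move=> x _; rewrite restrict_EFin /= /patch indicE.
by case: ifPn => _; rewrite ?mulr1 ?mulr0.
Qed.

Lemma lint_itv (f F : R -> R) (a b : R) : a <= b ->
  (forall x, x \in `[a, b]%R -> is_derive x 1 F (f x)) ->
  {within `[a, b], continuous f} ->
  lint (fun x => f x * \1_(`[a, b] : set R) x) = F b - F a.
Proof.
move=> ab dF cf.
have -> : lint (fun x => f x * \1_(`[a, b] : set R) x) = \int[mu]_(x in `[a, b]) f x.
  rewrite Rintegral_mkcond; apply: eq_Rintegral => x _.
  by rewrite /patch indicE; case: ifPn => _; rewrite ?mulr1 ?mulr0.
move: ab; rewrite le_eqVlt => /predU1P[<-|ab].
  by rewrite set_itv1 Rintegral_set1 subrr.
rewrite /Rintegral (@continuous_FTC2 _ f F)//.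
  have dF1 x : x \in `[a, b]%R -> {for x, continuous F}.
    move=> /dF dFx; apply/differentiable_continuous/derivable1_diffP.
    exact: ex_derive.
  split.
  - move=> x xab; have dFx := dF _ (subset_itv_oo_cc xab); exact: ex_derive.
  - by apply: cvg_at_right_filter; apply: dF1; rewrite in_itv/= lexx ltW.
  - by apply: cvg_at_left_filter; apply: dF1; rewrite in_itv/= lexx ltW.
move=> x xab; have dFx := dF _ (subset_itv_oo_cc xab).
by rewrite derive1E derive_val.
Qed.

End LineIntegral.

(** * Derivatives of real functions *)

Section Calculus.
Context {R : realType}.
Implicit Types (f g : R -> R) (x : R).

Lemma derD f g x a b : is_derive x 1 f a -> is_derive x 1 g b ->
  is_derive x 1 (fun t => f t + g t) (a + b).
Proof. by move=> ? ?; exact: is_deriveD. Qed.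

Lemma derB f g x a b : is_derive x 1 f a -> is_derive x 1 g b ->
  is_derive x 1 (fun t => f t - g t) (a - b).
Proof. by move=> ? ?; exact: is_deriveB. Qed.

Lemma derM f g x a b : is_derive x 1 f a -> is_derive x 1 g b ->
  is_derive x 1 (fun t => f t * g t) (f x * b + g x * a).
Proof. by move=> ? ?; exact: is_deriveM. Qed.

Lemma derZ k f x a : is_derive x 1 f a -> is_derive x 1 (fun t => k * f t) (k * a).
Proof. by move=> ?; exact: is_deriveZ. Qed.

Lemma der_comp f g x a b : is_derive (g x) 1 f a -> is_derive x 1 g b ->
  is_derive x 1 (fun t => f (g t)) (a * b).
Proof. by move=> ? ?; exact: is_derive1_comp. Qed.

Lemma derV f x a : f x != 0 -> is_derive x 1 f a ->
  is_derive x 1 (fun t => (f t)^-1) (- a / f x ^+ 2).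
Proof.
move=> f0 df; apply: (is_derive_eq (is_deriveV f0 df)).
by rewrite /GRing.scale /= mulNr mulrC mulNr.
Qed.

Lemma der_shift f x c a : is_derive (x + c) 1 f a ->
  is_derive x 1 (fun t => f (t + c)) a.
Proof.
move=> df.
have dg := @derD id (cst c) x 1 0 (is_derive_id x 1) (is_derive_cst c x 1).
by apply: (is_derive_eq (@der_comp f _ x a _ df dg)); rewrite addr0 mulr1.
Qed.

Lemma der_continuous f x a : is_derive x 1 f a -> {for x, continuous f}.
Proof.
move=> df; apply/differentiable_continuous/derivable1_diffP.
exact: ex_derive.
Qed.

Lemma mean_value f df (a b : R) : a < b ->
  (forall x, a <= x <= b -> is_derive x 1 f (df x)) ->
  exists2 c, a < c < b & f b - f a = df c * (b - a).
Proof.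
move=> ab fd; have [||c] := @MVT _ f df a b ab.
- by move=> x /subset_itv_oo_cc; rewrite /= in_itv/=; exact: fd.
- apply: continuous_in_subspaceT => x; rewrite inE/= in_itv/= => /fd.
  exact: der_continuous.
by rewrite in_itv/= => acb e; exists c.
Qed.

End Calculus.

(** * Two improper integrals *)

Section ModelIntegrals.
Context {R : realType}.
Notation mu := (@lebesgue_measure R).

(** Monotone convergence for integrands that are exhausted by compact intervals: at each
    point the sequence is eventually constant. *)
Lemma L1_monotone_limit (f_ : nat -> R -> R) (f : R -> R) (C : R) :
  (forall n, L1 (f_ n)) -> (forall n x, 0 <= f_ n x) ->
  (forall x, {homo f_^~ x : m n / (m <= n)%N >-> m <= n}) ->
  (forall x, exists N, forall n, (N <= n)%N -> f_ n x = f x) ->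
  (forall n, lint (f_ n) <= C) -> L1 f /\ lint f <= C.
Proof.
move=> if_ f0 fhomo flim fC.
have mf_ n : measurable_fun setT (EFin \o f_ n).
  by apply/measurable_EFinP; exact: L1_measurable.
have fE x : (f x)%:E = limn (fun n => (f_ n x)%:E).
  have [N Nf] := flim x; apply/esym/cvg_lim => //.
  apply: cvg_near_cst; exists N => // n /= /Nf ->//.
have f0' x : 0 <= f x.
  by have [N Nf] := flim x; rewrite -(Nf N).
have mf : measurable_fun setT (EFin \o f).
  rewrite (_ : _ \o _ = (fun x => limn_esup (fun n => (f_ n x)%:E))).
    exact: measurable_fun_limn_esup.
  apply/funext => x /=; rewrite fE; apply/esym/is_cvg_limn_esupE.
  apply: ereal_nondecreasing_is_cvgn => m n mn; rewrite lee_fin; exact: fhomo.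
have iC : (\int[mu]_x (f x)%:E <= C%:E)%E.
  under eq_integral do rewrite fE.
  rewrite (@monotone_convergence _ _ _ mu setT measurableT (fun n x => (f_ n x)%:E))//.
  - apply: lime_le.
      apply: ereal_nondecreasing_is_cvgn => m n mn.
      apply: ge0_le_integral => //; try exact: mf_.
        by move=> x _; rewrite lee_fin.
      by move=> x _; rewrite lee_fin; exact: fhomo.
    apply: nearW => n; rewrite -[leLHS]fineK ?lee_fin; first exact: fC.
    exact: (integrable_fin_num measurableT (if_ n)).
  - by move=> n x _; rewrite lee_fin.
  - by move=> x _ m n mn; rewrite lee_fin; exact: fhomo.
have L1f : L1 f.
  apply/integrableP; split => //.
  under eq_integral do rewrite /= ger0_norm//.
  by rewrite (le_lt_trans iC)// ltry.
split=> //; rewrite -lee_fin fineK//.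
exact: (integrable_fin_num measurableT L1f).
Qed.

Definition expo_tail (x : R) : R := expR (- x) * \1_(`[0, +oo[ : set R) x.

Lemma expo_tail_ge0 x : 0 <= expo_tail x.
Proof. by rewrite mulr_ge0 ?expR_ge0// indicE. Qed.

Lemma indic_itvccE (a b x : R) : \1_(`[a, b] : set R) x = ((a <= x <= b)%R : bool)%:R :> R.
Proof. by rewrite indicE mem_setE in_itv/=. Qed.

Lemma der_expRN (x : R) : is_derive x 1 (fun t => - expR (- t)) (expR (- x)).
Proof.
have d1 : is_derive x 1 (fun t : R => -1 * t) (-1 * 1).
  by apply: derZ; exact: is_derive_id.
have := derZ (-1) (@der_comp R expR (fun t => -1 * t) x _ _ (is_derive_expR _) d1).
rewrite (_ : (fun t => _) = (fun t => - expR (- t))); last first.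
  by apply/funext => t; rewrite !mulN1r.
by move=> h; apply: (is_derive_eq h); rewrite mulr1 !mulN1r mulrN1 opprK.
Qed.

Lemma L1_expo_tail : L1 expo_tail /\ lint expo_tail <= 1.
Proof.
have ce n : {within `[0, n%:R], continuous (fun x : R => expR (- x))}.
  apply: continuous_subspaceT => x; apply: (@continuous_comp _ _ _ -%R expR).
    exact: opp_continuous.
  exact: continuous_expR.
apply: (@L1_monotone_limit (fun n x => expR (- x) * \1_(`[0, n%:R] : set R) x)).
- by move=> n; exact: L1_itv.
- by move=> n x; rewrite mulr_ge0 ?expR_ge0// indicE.
- move=> x m n mn; rewrite ler_wpM2l ?expR_ge0// !indic_itvccE ler_nat.
  case: (0 <= x) => //=; case xm : (x <= m%:R) => //=.
  by rewrite (le_trans xm)// ler_nat.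
- move=> x; exists (Num.truncn `|x|).+1 => n nx.
  rewrite /expo_tail indic_itvccE indicE mem_setE in_itv/= andbT.
  congr (_ * (nat_of_bool _)%:R).
  case: (0 <= x) => //=; apply/idP; rewrite (le_trans (ler_norm x))//.
  by rewrite ltW// (lt_le_trans (truncnS_gt _))// ler_nat.
- move=> n; have := @lint_itv _ (fun t => expR (- t)) (fun t => - expR (- t)) 0 n%:R
    (ler0n _ n) (fun x _ => der_expRN x) (ce n).
  by move=> ->; rewrite oppr0 expR0 opprK gerDr oppr_le0 expR_ge0.
Qed.

(** The shape of the logarithmic singularity of the kernel, cut where it vanishes. *)
Definition log_spike (X t : R) : R := ln (X / t) * ((0 < t <= X)%R : bool)%:R.

Lemma log_spike_ge0 X t : 0 <= log_spike X t.
Proof.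
rewrite /log_spike; case: (boolP (0 < t <= X)) => /=; last by rewrite mulr0.
by case/andP => t0 tX; rewrite mulr1 ln_ge0// ler_pdivlMr// mul1r.
Qed.

(** A primitive of ln (X / t) is t ln (X / t) + t, which tends to 0 at the origin. *)
Lemma L1_log_spike (X : R) : 0 < X -> L1 (log_spike X) /\ lint (log_spike X) <= X.
Proof.
move=> X0.
have a0 n : 0 < X / n.+1%:R by rewrite divr_gt0.
have dl (x : R) : 0 < x -> is_derive x 1 (fun t => t * ln (X / t) + t) (ln (X / x)).
  move=> x0; have Xx0 : 0 < X / x by rewrite divr_gt0.
  have dV := derV (lt0r_neq0 x0) (is_derive_id x (1 : R)).
  have d1 := @der_comp R _ _ x _ _ (is_derive1_ln Xx0) (derZ X dV).
  apply: (is_derive_eq (derD (derM (is_derive_id x (1 : R)) d1) (is_derive_id x (1 : R)))).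
  field; rewrite !lt0r_neq0//.
have cl n : {within `[X / n.+1%:R, X], continuous (fun t => ln (X / t))}.
  apply: continuous_in_subspaceT => x; rewrite inE/= in_itv/= => /andP[nx xX].
  have x0 : 0 < x by exact: lt_le_trans nx.
  have Xx0 : 0 < X / x by rewrite divr_gt0.
  have dV := derV (lt0r_neq0 x0) (is_derive_id x (1 : R)).
  exact: der_continuous (@der_comp R _ _ x _ _ (is_derive1_ln Xx0) (derZ X dV)).
apply: (@L1_monotone_limit (fun n t => ln (X / t) * \1_(`[X / n.+1%:R, X] : set R) t)).
- by move=> n; exact: L1_itv.
- move=> n t; rewrite indic_itvccE; case: (boolP (X / n.+1%:R <= t <= X)) => /=; rewrite ?mulr0// => /andP[nt tX].
  have t0 : 0 < t by exact: lt_le_trans nt.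
  by rewrite mulr1 ln_ge0// ler_pdivlMr// mul1r.
- move=> t m n mn; rewrite !indic_itvccE.
  have [tX|] := boolP (t <= X); rewrite ?andbF// !andbT.
  have [mt|] := boolP (X / m.+1%:R <= t).
    rewrite (le_trans _ mt)// ler_pM2l// lef_pV2 ?posrE//.
    by rewrite ler_nat ltnS.
  case: (boolP (X / n.+1%:R <= t)) => //= nt _.
  have t0 : 0 < t by exact: lt_le_trans nt.
  by rewrite mulr0 mulr1 ln_ge0// ler_pdivlMr// mul1r.
- move=> t; have [t0|t0] := ltP 0 t; last first.
    exists 0%N => n _; rewrite /log_spike indic_itvccE ltNge t0/=.
    by rewrite [X / _ <= t]leNgt (le_lt_trans t0)// mulr0.
  exists (Num.truncn (X / t)) => n nX.
  rewrite /log_spike indic_itvccE t0; congr (_ * (nat_of_bool (_ && _))%:R).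
  rewrite ler_pdivrMr// -ler_pdivrMl// mulrC ltW//.
  by rewrite (lt_le_trans (truncnS_gt _))// ler_nat ltnS.
- move=> n; have nX : X / n.+1%:R <= X.
    by rewrite ler_pdivrMr// ler_peMr ?ler1n// ltW.
  have dF (x : R) : x \in `[X / n.+1%:R, X]%R ->
      is_derive x 1 (fun t => t * ln (X / t) + t) (ln (X / x)).
    by rewrite in_itv/= => /andP[nx _]; apply: dl; exact: lt_le_trans nx.
  rewrite (lint_itv nX dF (cl n)) divff ?lt0r_neq0// ln1 mulr0 add0r lerBlDr lerDl.
  apply: addr_ge0; last by rewrite ltW.
  apply: mulr_ge0; first by rewrite ltW.
  by rewrite ln_ge0// invf_div mulrCA divff ?lt0r_neq0// mulr1 ler1n.
Qed.

End ModelIntegrals.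

(** * The kernel near the origin and at infinity *)

Section Kernel.
Context {R : realType}.
Notation K := (@K_B R).

(** In terms of E = expo z the kernel is (1 / pi) ln ((E + 1) / (E - 1)), and its derivatives
    are rational in E. *)
Definition expo (z : R) : R := expR (pi / 2 * z).
(** This is - K_B' = 1 / (2 sinh (pi z / 2)). *)
Definition kernel_slope (z : R) : R := expo z / (expo z ^+ 2 - 1).
(** This is K_B'' = (pi / 4) cosh (pi z / 2) / sinh (pi z / 2) ^ 2. *)
Definition kernel_curv (z : R) : R :=
  pi / 2 * (expo z * (expo z ^+ 2 + 1)) / (expo z ^+ 2 - 1) ^+ 2.

Let pi0 : 0 < pi :> R := pi_gt0 R.

Lemma expo_gt1 (z : R) : 0 < z -> 1 < expo z.
Proof. by move=> z0; rewrite expR_gt1 mulr_gt0// divr_gt0. Qed.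

Lemma der_expo (z : R) : is_derive z 1 expo (pi / 2 * expo z).
Proof.
apply: (is_derive_eq (@der_comp _ expR (fun t => pi / 2 * t) z _ _
  (is_derive_expR _) (derZ (pi / 2) (is_derive_id z (1:R))))).
by rewrite mulr1 mulrC.
Qed.

Lemma K_B_even (z : R) : K (- z) = K z.
Proof. by rewrite /K_B normrN. Qed.

Lemma K_B_expo (z : R) : 0 < z -> K z = pi^-1 * (ln (expo z + 1) - ln (expo z - 1)).
Proof.
move=> z0; have E1 := expo_gt1 z0; rewrite /K_B gtr0_norm//.
have E0 : 0 < expo z by apply: lt_trans E1.
rewrite -ln_div ?posrE ?subr_gt0 ?addr_gt0//; congr (_ * ln _).
rewrite /coth expRN; set e := expR _.
have e0 : 0 < e by exact: expR_gt0.
have eE : expo z = e ^+ 2.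
  by rewrite /expo /e -expRM_natl; congr expR; field.
have e21 : e ^+ 2 - 1 != 0 by rewrite -eE subr_eq0 gt_eqF.
rewrite eE; field.
by rewrite e21 gt_eqF.
Qed.

Lemma der_K_B (z : R) : 0 < z -> is_derive z 1 K (- kernel_slope z).
Proof.
move=> z0; have E1 := expo_gt1 z0.
have E0 : 0 < expo z by apply: lt_trans E1.
have p1 : 0 < expo z + 1 by rewrite addr_gt0.
have p2 : 0 < expo z - 1 by rewrite subr_gt0.
have d1 := @der_comp _ _ (fun t => expo t + 1) z _ _ (is_derive1_ln p1)
  (derD (der_expo z) (is_derive_cst (1 : R) z (1 : R))).
have d2 := @der_comp _ _ (fun t => expo t - 1) z _ _ (is_derive1_ln p2)
  (derB (der_expo z) (is_derive_cst (1 : R) z (1 : R))).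
have d := derZ (pi^-1) (derB d1 d2).
apply: (@near_eq_is_derive _ _ _ (fun t => pi^-1 * (ln (expo t + 1) - ln (expo t - 1)))).
- by near=> t; rewrite K_B_expo//; near: t; exact: lt_nbhsr.
apply: (is_derive_eq d); rewrite /kernel_slope.
have p3 : 0 < expo z ^+ 2 - 1 by rewrite subr_gt0 exprn_egt1// ltW.
move: (expo z) (pi : R) pi0 p1 p2 p3 => E P P0 p1 p2 p3; field.
by rewrite !gt_eqF.
Unshelve. all: by end_near. Qed.

Lemma der_kernel_slope (z : R) : 0 < z -> is_derive z 1 kernel_slope (- kernel_curv z).
Proof.
move=> z0; have E1 := expo_gt1 z0.
have E21 : expo z * expo z - 1 != 0.
  by rewrite subr_eq0 gt_eqF// -expr2 exprn_egt1// ltW.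
have dE2 := derB (derM (der_expo z) (der_expo z)) (is_derive_cst (1 : R) z (1 : R)).
have dq := derM (der_expo z) (@derV _ (fun t => expo t * expo t - 1) _ _ E21 dE2).
apply: (is_derive_eq dq); rewrite /kernel_curv.
move: (expo z) (pi : R) E21 => E P E21.
by field; rewrite -expr2 in E21 *.
Qed.

(** The difference is 2 sinh p, whose derivative 2 cosh lies between 2 and its value at p.
    All quantitative information on the kernel comes from these two bounds. *)
Lemma sinh_bounds (p : R) : 0 < p ->
  2 * p <= expR p - expR (- p) <= p * (expR p + expR (- p)).
Proof.
move=> p0.
have dS (t : R) : is_derive t 1 (fun t => expR t - expR (- t)) (expR t + expR (- t)).
  by have := derD (is_derive_expR t) (der_expRN t).
have [c /andP[c0 cp]] := mean_value p0 (fun t _ => dS t).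
rewrite oppr0 expR0 subrr subr0 addr0 => ->.
have ec := expR_gt0 c; have ep := expR_gt0 p.
have cp' : expR c <= expR p by rewrite ler_expR ltW.
have c1 : 1 < expR c by rewrite expR_gt1.
rewrite !expRN; set u := expR c in ec cp' c1 *; set w := expR p in ep cp' *.
apply/andP; split.
  rewrite ler_pM2r// -subr_ge0 (_ : _ - _ = (u - 1) ^+ 2 / u); last first.
    by field; rewrite gt_eqF.
  by rewrite divr_ge0 ?sqr_ge0 ?ltW.
rewrite mulrC ler_pM2l// -subr_ge0.
rewrite (_ : _ - _ = (w - u) * (1 - (u * w)^-1)); last first.
  by field; rewrite !gt_eqF.
rewrite mulr_ge0 ?subr_ge0// invf_le1 ?mulr_gt0//.
by rewrite -[leLHS]mulr1 ler_pM ?ler01// ?(le_trans _ cp')// ltW.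
Qed.

Lemma kernel_curv_gt0 (z : R) : 0 < z -> 0 < kernel_curv z.
Proof.
move=> z0; have E1 := expo_gt1 z0.
have E0 : 0 < expo z by apply: lt_trans E1.
rewrite divr_gt0//; last by rewrite exprn_gt0// subr_gt0 exprn_egt1// ltW.
by rewrite mulr_gt0 ?divr_gt0// mulr_gt0// addr_gt0// exprn_gt0.
Qed.

(** With p = pi z / 2 one has pi z^2 K_B'' = p^2 cosh p / sinh p ^ 2, which by [sinh_bounds]
    lies between 1 / cosh p and cosh p. *)
Lemma kernel_curv_bounds (z : R) : 0 < z ->
  (expo z)^-1 / (pi * z ^+ 2) <= kernel_curv z <= expo z / (pi * z ^+ 2).
Proof.
move=> z0; have E1 := expo_gt1 z0.
have E0 : 0 < expo z by apply: lt_trans E1.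
have p0 : 0 < pi / 2 * z :> R by rewrite mulr_gt0// divr_gt0.
have E21 : expo z ^+ 2 - 1 != 0.
  by rewrite subr_eq0 gt_eqF// exprn_egt1// ltW.
have pz0 : 0 < pi * z ^+ 2 by rewrite mulr_gt0// exprn_gt0.
have := sinh_bounds p0; rewrite expRN -/(expo z).
set E := expo z in E0 E1 E21 *; set p := pi / 2 * z in p0 *.
set S := E - E^-1; set C := E + E^-1 => /andP[S1 S2].
have S0 : 0 < S by rewrite (lt_le_trans _ S1)// mulr_gt0.
have C0 : 0 < C by rewrite addr_gt0 ?invr_gt0.
have CE : C <= 2 * E.
  rewrite mulr_natl mulr2n lerD2l (le_trans _ (ltW E1))// invf_le1// ltW//.
have kE : kernel_curv z = (2 * p ^+ 2 * C / S ^+ 2) / (pi * z ^+ 2).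
  rewrite /kernel_curv -/E /S /C /p.
  move: (pi : R) pi0 => P P0; field.
  rewrite -expr2 in E21 *; by rewrite E21 !gt_eqF.
rewrite kE !ler_pM2r ?invr_gt0//; apply/andP; split.
  rewrite ler_pdivlMr ?exprn_gt0// ler_pdivrMl//.
  have : S ^+ 2 <= (p * C) ^+ 2.
    by rewrite ler_sqr// nnegrE ltW// mulr_gt0.
  move=> /le_trans; apply.
  rewrite (_ : (p * C) ^+ 2 = p ^+ 2 * C * C); last by ring.
  rewrite (_ : E * _ = p ^+ 2 * C * (2 * E)); last by ring.
  by rewrite ler_pM2l// mulr_gt0// exprn_gt0.
rewrite ler_pdivrMr ?exprn_gt0//.
have : (2 * p) ^+ 2 <= S ^+ 2.
  by rewrite ler_sqr// nnegrE ltW// mulr_gt0.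
move=> S3; apply: (@le_trans _ _ (E * (2 * p) ^+ 2)); last by rewrite ler_pM2l.
rewrite (_ : E * _ = 2 * p ^+ 2 * (2 * E)); last by ring.
by rewrite ler_pM2l// mulr_gt0// exprn_gt0.
Qed.

Lemma kernel_curv_near0 (eta : R) : 0 < eta -> exists2 rho : R, 0 < rho &
  forall z, 0 < z <= rho ->
    (1 - eta) / (pi * z ^+ 2) <= kernel_curv z <= (1 + eta) / (pi * z ^+ 2).
Proof.
move=> eta0; have e1 : 0 < ln (1 + eta) by rewrite ln_gt0// ltrDl.
exists (ln (1 + eta) / (pi / 2)); first by rewrite !divr_gt0.
move=> z /andP[z0]; rewrite ler_pdivlMr ?divr_gt0// mulrC => zr.
have Ez : expo z <= 1 + eta.
  by rewrite -[leRHS]lnK ?ler_expR// posrE addr_gt0.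
have E0 : 0 < expo z by exact: expR_gt0.
have pz0 : 0 < pi * z ^+ 2 by rewrite mulr_gt0// exprn_gt0.
have /andP[k1 k2] := kernel_curv_bounds z0.
apply/andP; split.
  apply: le_trans k1; rewrite ler_pM2r ?invr_gt0//.
  apply: (@le_trans _ _ (1 + eta)^-1); last by rewrite lef_pV2// posrE addr_gt0.
  rewrite -[leRHS]mul1r ler_pdivlMr ?addr_gt0// -subr_ge0.
  by rewrite (_ : _ - _ = eta ^+ 2) ?sqr_ge0//; ring.
by apply: (le_trans k2); rewrite ler_pM2r ?invr_gt0.
Qed.

Lemma expR_le_expo (z : R) : 0 <= z -> expR z <= expo z.
Proof.
by move=> z0; rewrite ler_expR ler_peMl// pihalf_ge1.
Qed.

(** The curvature decays as exp (- pi z / 2); as pi / 2 >= 1, the rate 1 is enough. *)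
Lemma kernel_curv_far (rho : R) : 0 < rho -> exists2 C : R, 0 < C &
  forall z, rho <= z -> kernel_curv z <= C * expR (- z).
Proof.
move=> rho0; have E1 := expo_gt1 rho0.
have E0 : 0 < expo rho by apply: lt_trans E1.
set a := 1 - (expo rho ^+ 2)^-1.
have a0 : 0 < a.
  by rewrite subr_gt0 invf_lt1 ?exprn_gt0// exprn_egt1// ltW.
exists (pi / a ^+ 2); first by rewrite divr_gt0// exprn_gt0.
move=> z rz; have z0 : 0 < z by exact: lt_le_trans rz.
have Ez : expo rho <= expo z by rewrite ler_expR ler_pM2l ?divr_gt0.
have Ez0 : 0 < expo z by exact: expR_gt0.
have E2 : a * expo z ^+ 2 <= expo z ^+ 2 - 1.
  rewrite mulrBl mul1r lerD2l lerN2 ler_pdivlMl ?exprn_gt0// mulr1.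
  by rewrite ler_sqr// nnegrE ltW.
have E20 : 0 < a * expo z ^+ 2 by rewrite mulr_gt0// exprn_gt0.
have E3 : expo z ^+ 2 + 1 <= 2 * expo z ^+ 2.
  by rewrite mulr_natl mulr2n lerD2l (le_trans (ltW E1))// (le_trans Ez)// expr2 ler_peMr// ?ltW// (lt_le_trans E1).
apply: (@le_trans _ _ (pi / 2 * (expo z * (2 * expo z ^+ 2)) / (a * expo z ^+ 2) ^+ 2)).
  rewrite /kernel_curv ler_pM//.
  - by rewrite !mulr_ge0 ?divr_ge0 ?ltW// addr_gt0// exprn_gt0.
  - by rewrite invr_ge0 sqr_ge0.
  - by rewrite ler_pM2l ?divr_gt0// ler_pM2l.
  - rewrite lef_pV2 ?posrE ?exprn_gt0//; last exact: lt_le_trans E2.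
    by rewrite ler_sqr// nnegrE ltW// (lt_le_trans E20).
rewrite (_ : _ / _ = pi / a ^+ 2 * (expo z)^-1); last first.
  by move: (pi : R) => P; field; rewrite !gt_eqF.
rewrite ler_pM2l ?divr_gt0 ?exprn_gt0// expRN lef_pV2 ?posrE ?expR_gt0//.
exact/expR_le_expo/ltW.
Qed.

Lemma kernel_slope_gt0 (z : R) : 0 < z -> 0 < kernel_slope z.
Proof.
move=> z0; have E1 := expo_gt1 z0.
by rewrite divr_gt0 ?expR_gt0// subr_gt0 exprn_egt1// ltW.
Qed.

Lemma kernel_slope_le (z : R) : 0 < z -> kernel_slope z <= (pi * z)^-1.
Proof.
move=> z0; have E1 := expo_gt1 z0.
have E0 : 0 < expo z by apply: lt_trans E1.
have p0 : 0 < pi / 2 * z :> R by rewrite mulr_gt0// divr_gt0.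
have E21 : expo z ^+ 2 - 1 != 0 by rewrite subr_eq0 gt_eqF// exprn_egt1// ltW.
have /andP[+ _] := sinh_bounds p0; rewrite expRN -/(expo z).
rewrite (_ : 2 * _ = pi * z); last by move: (pi : R) => P; field.
move=> S1; have pz : 0 < pi * z by rewrite mulr_gt0.
rewrite (_ : kernel_slope z = (expo z - (expo z)^-1)^-1); last first.
  by rewrite /kernel_slope; field; rewrite E21 gt_eqF.
by rewrite lef_pV2// posrE (lt_le_trans pz).
Qed.

Lemma K_B_mean_value (s t : R) : 0 < s -> s < t ->
  exists2 c, s < c < t & K s - K t = kernel_slope c * (t - s).
Proof.
move=> s0 st; have dK (x : R) : s <= x <= t -> is_derive x 1 K (- kernel_slope x).
  by move=> /andP[sx _]; apply: der_K_B; exact: lt_le_trans sx.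
have [c sct e] := mean_value st dK; exists c => //.
by rewrite -opprB e mulNr opprK.
Qed.

Lemma K_B_nonincr (s t : R) : 0 < s -> s <= t -> K t <= K s.
Proof.
move=> s0; rewrite le_eqVlt => /predU1P[->//|st].
have [c /andP[sc ct]] := K_B_mean_value s0 st.
rewrite -subr_ge0 => ->; rewrite mulr_ge0 ?subr_ge0 ?(ltW st)//.
exact/ltW/kernel_slope_gt0/(lt_trans s0).
Qed.

Lemma K_B_sub_le (s t : R) : 0 < s -> s <= t -> K s - K t <= (t - s) / (pi * s).
Proof.
move=> s0; rewrite le_eqVlt => /predU1P[->|st]; first by rewrite !subrr mul0r.
have [c /andP[sc ct] ->] := K_B_mean_value s0 st.
have c0 := lt_trans s0 sc.
rewrite mulrC ler_pM2l ?subr_gt0// (le_trans (kernel_slope_le c0))//.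
by rewrite lef_pV2 ?posrE ?mulr_gt0// ler_pM2l// ltW.
Qed.

(** By [kernel_slope_le] the sum of the kernel and of (1 / pi) ln is nondecreasing. *)
Lemma K_B_sub_log (s t : R) : 0 < s -> s <= t -> K s - K t <= pi^-1 * ln (t / s).
Proof.
move=> s0; rewrite le_eqVlt => /predU1P[<-|st].
  by rewrite subrr divff ?gt_eqF// ln1 mulr0.
have t0 := lt_trans s0 st.
have d (x : R) : s <= x <= t ->
    is_derive x 1 (fun y => K y + pi^-1 * ln y) (- kernel_slope x + pi^-1 * x^-1).
  move=> /andP[sx _]; have x0 : 0 < x by exact: lt_le_trans sx.
  by apply: derD; [exact: der_K_B|apply: derZ; exact: is_derive1_ln].
have [c /andP[sc ct]] := mean_value st d => e.
have c0 := lt_trans s0 sc.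
have : 0 <= (K t + pi^-1 * ln t) - (K s + pi^-1 * ln s).
  rewrite e mulr_ge0 ?subr_ge0 ?(ltW st)// addrC subr_ge0 -invfM.
  exact: kernel_slope_le.
by rewrite ln_div ?posrE//; lra.
Qed.

Lemma K_B0 : K 0 = 0.
Proof.
by rewrite /K_B /coth normr0 mulr0 mul0r oppr0 expR0 subrr invr0 mulr0 ln0 ?mulr0.
Qed.

Lemma K_B_norm (z : R) : K `|z| = K z.
Proof. by rewrite /K_B normr_id. Qed.

Lemma K_B_ge0 (z : R) : 0 <= K z.
Proof.
rewrite -K_B_norm; have [->|z0] := eqVneq z 0; first by rewrite normr0 K_B0.
have {}z0 : 0 < `|z| by rewrite normr_gt0.
have E1 := expo_gt1 z0; rewrite K_B_expo//; apply: mulr_ge0.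
  by rewrite invr_ge0 ltW.
by rewrite subr_ge0 ler_ln ?posrE; lra.
Qed.

(** The mean value theorem is applied twice, first in the variable shifted by h to
    K (s - x) - K (s + x), then in the variable shifted by x to the slope. *)
Lemma K_B_mixed_difference (x h y : R) : 0 < x -> 0 < h -> x + h < y ->
  exists2 c, y - x - h < c < y + x + h &
    K (y - x - h) - K (y - x + h) - K (y + x - h) + K (y + x + h)
    = 4 * x * h * kernel_curv c.
Proof.
move=> x0 h0 xhy.
have d (s : R) : y - h <= s <= y + h -> is_derive s 1 (fun s => K (s - x) - K (s + x))
    (- kernel_slope (s - x) - - kernel_slope (s + x)).
  move=> /andP[ys sy]; apply: derB; apply: der_shift; apply: der_K_B; lra.
have yh : y - h < y + h by lra.
have [s /andP[ys sy]] := mean_value yh d.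
rewrite (_ : y + h - (y - h) = 2 * h); last by ring.
rewrite (_ : y + h - x = y - x + h); last by ring.
rewrite (_ : y + h + x = y + x + h); last by ring.
rewrite (_ : y - h - x = y - x - h); last by ring.
rewrite (_ : y - h + x = y + x - h); last by ring.
move=> e1.
have d2 (t : R) : s - x <= t <= s + x -> is_derive t 1 kernel_slope (- kernel_curv t).
  move=> /andP[st _]; apply: der_kernel_slope; lra.
have sx : s - x < s + x by lra.
have [c /andP[sc cs] e2] := mean_value sx d2.
exists c; first by apply/andP; split; lra.
rewrite (_ : 4 * x * h * kernel_curv c = 2 * h * (kernel_curv c * (s + x - (s - x)))); last by ring.
have -> : kernel_curv c * (s + x - (s - x)) = kernel_slope (s - x) - kernel_slope (s + x).
  by rewrite -[RHS]opprB e2; ring.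
have -> : K (y - x - h) - K (y - x + h) - K (y + x - h) + K (y + x + h)
  = - (K (y - x + h) - K (y + x + h) - (K (y - x - h) - K (y + x - h))) by ring.
by rewrite e1; ring.
Qed.

Lemma measurable_K_B : measurable_fun setT K.
Proof.
rewrite (_ : K_B = fun z : R => pi^-1 * (ln (expo `|z| + 1) - ln (expo `|z| - 1))
    * \1_(~` [set 0] : set R) z); last first.
  apply/funext => z; rewrite indicE; have [->|z0] := eqVneq z 0.
    by rewrite K_B0 memNset ?mulr0//=; exact.
  rewrite mem_set; last by move=> /= /eqP; exact/negP.
  by rewrite mulr1 -[LHS]K_B_norm K_B_expo ?normr_gt0.
have mE : measurable_fun setT (fun z : R => expo `|z|).
  apply: (@measurableT_comp _ _ _ _ _ _ expo) => //.
  apply: continuous_measurable_fun => z; exact: der_continuous (der_expo z).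
apply: measurable_funM; last first.
  by apply: measurable_indic; apply: measurableC; exact: measurable_set1.
apply: measurable_funM => //; apply: measurable_funB;
  apply: measurableT_comp; try exact: measurable_ln.
  exact: measurable_funD.
exact: measurable_funB.
Qed.

(** The part of the kernel above the level K_B X isolates the singularity: it is supported
    in [- X, X] and its integral is only of order X. *)
Definition spike (X t : R) : R := Num.max (K t - K X) 0.

Lemma spike_ge0 (X t : R) : 0 <= spike X t.
Proof. by rewrite /spike le_max lexx orbT. Qed.

Lemma le_spike (X t : R) : K t - K X <= spike X t.
Proof. by rewrite /spike le_max lexx. Qed.

(** On each side of the origin the spike is at most (1 / pi) ln (X / t), by [K_B_sub_log];
    the bound follows from 2 / pi <= 1. *)
Lemma L1_spike (X : R) : 0 < X -> L1 (spike X) /\ lint (spike X) <= X.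
Proof.
move=> X0; have [il ll] := L1_log_spike X0.
have ilN := L1_opp il.
have ib := L1Z (pi^-1) (L1D il ilN).
have b t : spike X t <= pi^-1 * (log_spike X t + log_spike X (- t)).
  have b0 : 0 <= pi^-1 * (log_spike X t + log_spike X (- t)).
    by rewrite mulr_ge0 ?invr_ge0 ?(ltW pi0)// addr_ge0 ?log_spike_ge0.
  rewrite /spike ge_max b0 andbT -K_B_norm.
  have [t0|t0] := eqVneq t 0.
    by apply: le_trans b0; rewrite t0 normr0 K_B0 sub0r oppr_le0 K_B_ge0.
  have {}t0 : 0 < `|t| by rewrite normr_gt0.
  have [tX|Xt] := leP `|t| X; last first.
    by apply: le_trans b0; rewrite subr_le0 K_B_nonincr// ltW.
  apply: (le_trans (K_B_sub_log t0 tX)); rewrite ler_pM2l ?invr_gt0//.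
  have lt : ln (X / `|t|) = log_spike X `|t| by rewrite /log_spike t0 tX mulr1.
  rewrite lt; have [ta|ta] := leP 0 t.
    by rewrite ger0_norm// lerDl log_spike_ge0.
  by rewrite ltr0_norm// lerDr log_spike_ge0.
have iS : L1 (spike X).
  apply: (L1_le _ _ ib) => [|t]; last by rewrite ger0_norm ?spike_ge0.
  apply: measurable_maxr => //; apply: measurable_funB => //.
  exact: measurable_K_B.
split=> //; apply: (@le_trans _ _ (lint (fun t => pi^-1 * (log_spike X t + log_spike X (- t))))).
  by apply: (@le_lint_off _ [::]).
rewrite lintZ; last exact: L1D.
rewrite lintD// lint_opp// ler_pdivrMl//.
apply: (le_trans (lerD ll ll)); rewrite -mulr2n -mulr_natl ler_pM2r//.
exact: pi_ge2.
Qed.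

Lemma L1_expR_norm : L1 (fun t : R => expR (- `|t|)).
Proof.
have [ie _] := @L1_expo_tail R.
apply: (L1_le _ _ (L1D ie (L1_opp ie))).
  apply: measurableT_comp => //; apply: measurableT_comp => //.
move=> t; rewrite ger0_norm ?expR_ge0//.
have [t0|t0] := leP 0 t.
  rewrite ger0_norm// {1}/expo_tail indicE mem_set ?mulr1 ?lerDl ?expo_tail_ge0//=.
  by rewrite in_itv/= t0.
rewrite ltr0_norm// {2}/expo_tail indicE mem_set ?mulr1 ?lerDr ?expo_tail_ge0//=.
by rewrite in_itv/= oppr_ge0 ltW.
Qed.

(** The spike at level K_B 1 dominates the singularity; beyond 1 the kernel is at most
    (4 / pi) exp (- t). *)
Lemma L1_K_B : L1 K.
Proof.
have [iS _] := L1_spike (@ltr01 R).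
have i1 : L1 (fun x : R => 1 * \1_(`[-1, 1] : set R) x).
  by apply: (@L1_itv _ (fun=> 1)); apply: continuous_subspaceT => x; exact: cvg_cst.
have ib := L1D (L1D iS (L1Z (K 1) i1)) (L1Z (4 / pi) L1_expR_norm).
apply: (L1_le measurable_K_B _ ib) => t.
rewrite ger0_norm ?K_B_ge0// indic_itvccE mul1r -ler_norml.
have [t1|t1] := leP `|t| 1.
  rewrite mulr1 (@le_trans _ _ (spike 1 t + K 1))//.
    by rewrite -lerBlDr le_spike.
  by rewrite lerDl mulr_ge0 ?expR_ge0// divr_ge0 ?ltW.
rewrite mulr0 addr0 (@le_trans _ _ (4 / pi * expR (- `|t|)))//; last first.
  by rewrite lerDr spike_ge0.
have t0 : 0 < `|t| by exact: lt_trans t1.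
have e2 : 2 <= expo `|t|.
  rewrite (le_trans _ (expR_le_expo (ltW t0)))//.
  by rewrite (le_trans _ (expR_ge1Dx _))// -[leLHS]/(1 + 1) lerD2l ltW.
rewrite -K_B_norm K_B_expo// -ln_div ?posrE; [|lra..].
rewrite [(_ + _) / _](_ : _ = 1 + 2 / (expo `|t| - 1)); last by field; lra.
rewrite mulrAC mulrC ler_pM2r ?invr_gt0//.
apply: (@le_trans _ _ (2 / (expo `|t| - 1))).
  by apply: le_ln1Dx; rewrite (@lt_trans _ _ 0)// divr_gt0//; lra.
apply: (@le_trans _ _ (4 * (expo `|t|)^-1)).
  by rewrite ler_pdivrMr; [rewrite mulrAC ler_pdivlMr; lra|lra].
rewrite ler_pM2l// expRN lef_pV2 ?posrE ?expR_gt0//.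
exact/expR_le_expo/ltW.
Qed.

End Kernel.

(** * Integrals over the positive half-line *)

Section HalfLine.
Context {R : realType}.
Implicit Types f g : R -> R.

Lemma L1_ext f g : (forall y, f y = g y) -> L1 f -> L1 g.
Proof. by move=> /funext ->. Qed.

Lemma lint_ext f g : (forall y, f y = g y) -> lint f = lint g.
Proof. by move=> /funext ->. Qed.

Lemma L1M_bounded f g (M : R) : L1 f -> measurable_fun setT g ->
  (forall y, `|g y| <= M) -> L1 (fun y => f y * g y).
Proof.
move=> if_ mg gM; have ib := L1Z M (integrable_norm if_).
apply: (L1_le _ _ ib) => [|y].
  by apply: measurable_funM => //; exact: L1_measurable.
by rewrite normrM mulrC ler_wpM2r.
Qed.

(** The integral over the half-line is an integral over the line, so that translations and
    integrability keep a single form. *)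
Definition posl f : R := lint (fun y => f y * \1_(`]0, +oo[ : set R) y).

Lemma indic_posE (y : R) : \1_(`]0, +oo[ : set R) y = ((0 < y)%R : bool)%:R :> R.
Proof. by rewrite indicE mem_setE in_itv/= andbT. Qed.

Lemma L1_posl f : L1 f -> L1 (fun y => f y * \1_(`]0, +oo[ : set R) y).
Proof.
move=> /L1M_bounded; apply; first exact: measurable_indic.
by move=> y; rewrite indic_posE; case: (0 < y); rewrite ?normr1 ?normr0 ?lexx ?ler01.
Qed.

Lemma lint_even f : L1 f -> (forall y, f (- y) = f y) -> lint f = 2 * posl f.
Proof.
move=> if_ fe; have ip := L1_posl if_; have ipN := L1_opp ip.
have fE y : y \notin [:: 0] -> f y = f y * \1_(`]0, +oo[ : set R) y
    + f (- y) * \1_(`]0, +oo[ : set R) (- y).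
  rewrite inE fe !indic_posE oppr_gt0; case: ltgtP => //= _ _.
    by rewrite mulr0 mulr1 addr0.
  by rewrite mulr0 mulr1 add0r.
have e2 : lint f = lint (fun y => f y * \1_(`]0, +oo[ : set R) y
    + f (- y) * \1_(`]0, +oo[ : set R) (- y)).
  apply/eqP; rewrite eq_le; apply/andP; split.
    by apply: (le_lint_off if_ (L1D ip ipN)) => y /fE {1}->.
  by apply: (le_lint_off (L1D ip ipN) if_) => y /fE <-.
by rewrite e2 (lintD ip ipN) (lint_opp ip) mulr_natl mulr2n.
Qed.

Lemma le_posl_off (s : seq R) f g : L1 f -> L1 g ->
  (forall y, 0 < y -> y \notin s -> f y <= g y) -> posl f <= posl g.
Proof.
move=> if_ ig fg; apply: (@le_lint_off _ s); [exact: L1_posl..|].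
move=> y ys; rewrite indic_posE; have [y0|y0] := ltP 0 y.
  by rewrite !mulr1 fg.
by rewrite !mulr0.
Qed.

Lemma poslD f g : L1 f -> L1 g -> posl (fun y => f y + g y) = posl f + posl g.
Proof.
move=> if_ ig; rewrite /posl -lintD; [|exact: L1_posl..].
by apply: lint_ext => y; rewrite mulrDl.
Qed.

Lemma poslZ k f : L1 f -> posl (fun y => k * f y) = k * posl f.
Proof.
move=> if_; rewrite /posl -lintZ; last exact: L1_posl.
by apply: lint_ext => y; rewrite mulrA.
Qed.

Lemma posl_le_lint f : L1 f -> (forall y, 0 <= f y) -> posl f <= lint f.
Proof.
move=> if_ f0; apply: (@le_lint_off _ [::]) => //; first exact: L1_posl.
by move=> y _; rewrite indic_posE; case: (0 < y); rewrite ?mulr1 ?mulr0.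
Qed.

Lemma posl_supp f : (forall y, y <= 0 -> f y = 0) -> posl f = lint f.
Proof.
move=> f0; apply: lint_ext => y; rewrite indic_posE; have [y0|/f0 ->] := ltP 0 y.
  by rewrite mulr1.
by rewrite mul0r.
Qed.

(** The half-line is cut into a neighbourhood of the singularities, an intermediate range
    and a tail; each piece is controlled by a multiple of its own model function. *)
Lemma posl_le_comb (s : seq R) f g1 g2 g3 g4 (c1 c2 c3 c4 : R) :
  L1 f -> L1 g1 -> L1 g2 -> L1 g3 -> L1 g4 ->
  (forall y, 0 < y -> y \notin s ->
     f y <= c1 * g1 y + c2 * g2 y + c3 * g3 y + c4 * g4 y) ->
  posl f <= c1 * posl g1 + c2 * posl g2 + c3 * posl g3 + c4 * posl g4.
Proof.
move=> if_ i1 i2 i3 i4 fg.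
have j1 := L1Z c1 i1; have j2 := L1Z c2 i2; have j3 := L1Z c3 i3; have j4 := L1Z c4 i4.
have j12 := L1D j1 j2; have j123 := L1D j12 j3; have j := L1D j123 j4.
apply: (le_trans (le_posl_off if_ j fg)).
by rewrite !poslD// !poslZ.
Qed.

Lemma posl_ge_comb (s : seq R) f g1 g2 g3 g4 (c1 c2 c3 c4 : R) :
  L1 f -> L1 g1 -> L1 g2 -> L1 g3 -> L1 g4 ->
  (forall y, 0 < y -> y \notin s ->
     c1 * g1 y + c2 * g2 y + c3 * g3 y + c4 * g4 y <= f y) ->
  c1 * posl g1 + c2 * posl g2 + c3 * posl g3 + c4 * posl g4 <= posl f.
Proof.
move=> if_ i1 i2 i3 i4 fg.
have j1 := L1Z c1 i1; have j2 := L1Z c2 i2; have j3 := L1Z c3 i3; have j4 := L1Z c4 i4.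
have j12 := L1D j1 j2; have j123 := L1D j12 j3; have j := L1D j123 j4.
apply: (le_trans _ (le_posl_off j if_ fg)).
by rewrite !poslD// !poslZ.
Qed.

End HalfLine.

(** * Mixed second differences of the kernel *)

Section MixedKernel.
Context {R : realType}.
Notation K := (@K_B R).

Definition mixedK (x h y : R) : R :=
  K (y - x - h) - K (y - x + h) - K (y + x - h) + K (y + x + h).

Lemma mixedK_even (x h y : R) : mixedK x h (- y) = mixedK x h y.
Proof.
rewrite /mixedK.
rewrite -(K_B_even (- y - x - h)) -(K_B_even (- y - x + h)).
rewrite -(K_B_even (- y + x - h)) -(K_B_even (- y + x + h)).
rewrite (_ : - (- y - x - h) = y + x + h); last by ring.
rewrite (_ : - (- y - x + h) = y + x - h); last by ring.
rewrite (_ : - (- y + x - h) = y - x + h); last by ring.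
rewrite (_ : - (- y + x + h) = y - x - h); last by ring.
by ring.
Qed.

Lemma L1_K_shift (t : R) : L1 (fun y => K (y + t)).
Proof. exact: (L1_shift t L1_K_B). Qed.

Lemma L1_mixedK (x h : R) : L1 (mixedK x h).
Proof.
apply: (@L1_ext _ (fun y => K (y + (- x - h)) - K (y + (- x + h)) - K (y + (x - h)) + K (y + (x + h)))).
  by move=> y; rewrite /mixedK !addrA.
apply: L1D; [apply: L1B; [apply: L1B|]|]; exact: L1_K_shift.
Qed.

Lemma mixedK_ge0 (x h y : R) : 0 < x -> 0 < h -> x + h < y -> 0 <= mixedK x h y.
Proof.
move=> x0 h0 xhy; have [c /andP[c1 _] e] := K_B_mixed_difference x0 h0 xhy.
have c0 : 0 < c by apply: lt_trans c1; lra.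
by rewrite /mixedK e; apply: mulr_ge0; [rewrite !mulr_ge0// ltW|exact/ltW/kernel_curv_gt0].
Qed.

(** The parity of the kernel and of u folds the difference of the two convolutions, whose
    kernel is K (y - x - h) - K (y - x + h), onto the half-line. *)
Lemma convolution_mixed_difference (u : R -> R) (M x h : R) :
  measurable_fun setT u -> (forall y, `|u y| <= M) -> (forall y, u (- y) = u y) ->
  convolution K u (x + h) - convolution K u (x - h)
  = posl (fun y => mixedK x h y * u y).
Proof.
move=> mu_ uM ue.
have i1 := L1M_bounded (L1_K_shift (- x - h)) mu_ uM.
have i2 := L1M_bounded (L1_K_shift (- x + h)) mu_ uM.
have e1 : convolution K u (x + h) = lint (fun y => K (y + (- x - h)) * u y).
  apply: lint_ext => y; rewrite -K_B_even; congr (K _ * _); ring.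
have e2 : convolution K u (x - h) = lint (fun y => K (y + (- x + h)) * u y).
  apply: lint_ext => y; rewrite -K_B_even; congr (K _ * _); ring.
have if_ := L1B i1 i2; rewrite e1 e2 -(lintB i1 i2).
set f := (fun y => _) in if_ *.
have ifN := L1_opp if_.
have e3 : lint (fun y => mixedK x h y * u y) = 2 * lint f.
  rewrite mulr_natl mulr2n -{2}(lint_opp if_) -(lintD if_ ifN).
  apply: lint_ext => y; rewrite /f ue /mixedK.
  rewrite -(K_B_even (- y + (- x - h))) -(K_B_even (- y + (- x + h))).
  rewrite (_ : - (- y + (- x - h)) = y + x + h); last by ring.
  rewrite (_ : - (- y + (- x + h)) = y + x - h); last by ring.
  by rewrite !addrA; ring.
have e4 := lint_even (L1M_bounded (L1_mixedK x h) mu_ uM).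
apply: (@mulfI _ 2); first by [].
rewrite -e3; apply: e4 => y; by rewrite mixedK_even ue.
Qed.

(** This is the case u = 1 of [convolution_mixed_difference]: the convolution of the kernel
    with a constant is constant. It makes room for the free constant alpha of [crest_eq]. *)
Lemma posl_mixedK (x h : R) : posl (mixedK x h) = 0.
Proof.
have e := @convolution_mixed_difference (fun=> 1) 1 x h (measurable_cst _)
  _ (fun=> erefl).
rewrite (_ : mixedK x h = fun y => mixedK x h y * 1); last first.
  by apply/funext => y; rewrite mulr1.
rewrite -e; last by move=> _; rewrite normr1.
apply/eqP; rewrite subr_eq0; apply/eqP.
have c t : convolution K (fun=> 1) t = lint K.
  rewrite -(lint_shift (- t) L1_K_B); apply: lint_ext => y.
  by rewrite mulr1 -K_B_even opprB.
by rewrite !c.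
Qed.

End MixedKernel.

(** * Size of the mixed differences *)

Section ModelProfiles.
Context {R : realType}.

Definition log_over (a d y : R) : R := ln (1 / y) / y * \1_(`[a, d] : set R) y.
Definition inv_sqr (a d y : R) : R := (y ^+ 2)^-1 * \1_(`[a, d] : set R) y.

Lemma der_ln_inv (y : R) : 0 < y -> is_derive y 1 (fun t => ln (1 / t)) (- y^-1).
Proof.
move=> y0; have y1 : 0 < 1 / y by rewrite divr_gt0.
have dV := derV (lt0r_neq0 y0) (is_derive_id y (1 : R)).
have d1 : is_derive y 1 (fun t => 1 / t) (1 * (-1 / y ^+ 2)) := derZ 1 dV.
have d2 : is_derive y 1 (fun t => ln (1 / t)) ((1 / y)^-1 * (1 * (-1 / y ^+ 2))).
  exact: (@der_comp R (@ln R) (fun t => 1 / t) y _ _ (is_derive1_ln y1) d1).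
apply: (is_derive_eq d2).
by field; rewrite gt_eqF.
Qed.

Lemma ln_invE (y : R) : 0 < y -> ln (1 / y) = - ln y.
Proof. by move=> y0; rewrite div1r lnV. Qed.

Lemma L1_log_over (a d : R) : 0 < a -> L1 (log_over a d).
Proof.
move=> a0; apply: (@L1_itv _ (fun y => ln (1 / y) / y)).
apply: continuous_in_subspaceT => y; rewrite inE/= in_itv/= => /andP[ay _].
have y0 : 0 < y by exact: lt_le_trans ay.
exact: der_continuous (derM (der_ln_inv y0) (derV (lt0r_neq0 y0) (is_derive_id y (1 : R)))).
Qed.

Lemma posl_log_over (a d : R) : 0 < a -> a <= d ->
  posl (log_over a d) = (ln (1 / a) ^+ 2 - ln (1 / d) ^+ 2) / 2.
Proof.
move=> a0 ad; rewrite posl_supp; last first.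
  by move=> y y0; rewrite /log_over indic_itvccE leNgt (le_lt_trans y0 a0) mulr0.
have dF (y : R) : y \in `[a, d]%R ->
    is_derive y 1 (fun t => - (1 / 2) * (ln (1 / t) * ln (1 / t))) (ln (1 / y) / y).
  rewrite in_itv/= => /andP[ay _]; have y0 : 0 < y by exact: lt_le_trans ay.
  apply: (is_derive_eq (derZ (- (1 / 2)) (derM (der_ln_inv y0) (der_ln_inv y0)))).
  by field; rewrite gt_eqF.
have cf : {within `[a, d], continuous (fun y => ln (1 / y) / y)}.
  apply: continuous_in_subspaceT => y; rewrite inE/= in_itv/= => /andP[ay _].
  have y0 : 0 < y by exact: lt_le_trans ay.
  exact: der_continuous (derM (der_ln_inv y0) (derV (lt0r_neq0 y0) (is_derive_id y (1 : R)))).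
by rewrite (lint_itv ad dF cf); field.
Qed.

Lemma L1_inv_sqr (a d : R) : 0 < a -> L1 (inv_sqr a d).
Proof.
move=> a0; apply: (@L1_itv _ (fun y => (y ^+ 2)^-1)).
apply: continuous_in_subspaceT => y; rewrite inE/= in_itv/= => /andP[ay _].
have y0 : 0 < y by exact: lt_le_trans ay.
have y20 : y * y != 0 by rewrite mulf_neq0// gt_eqF.
have id' := is_derive_id y (1 : R).
exact: der_continuous (@derV _ (fun y => y * y) _ _ y20 (derM id' id')).
Qed.

Lemma posl_inv_sqr (a d : R) : 0 < a -> a <= d -> posl (inv_sqr a d) <= a^-1.
Proof.
move=> a0 ad; rewrite posl_supp; last first.
  by move=> y y0; rewrite /inv_sqr indic_itvccE leNgt (le_lt_trans y0 a0) mulr0.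
have dF (y : R) : y \in `[a, d]%R -> is_derive y 1 (fun t => - 1 * t^-1) (y ^+ 2)^-1.
  rewrite in_itv/= => /andP[ay _]; have y0 : 0 < y by exact: lt_le_trans ay.
  apply: (is_derive_eq (derZ (-1) (derV (lt0r_neq0 y0) (is_derive_id y (1 : R))))).
  by field; rewrite gt_eqF.
have cf : {within `[a, d], continuous (fun y : R => (y ^+ 2)^-1)}.
  apply: continuous_in_subspaceT => y; rewrite inE/= in_itv/= => /andP[ay _].
  have y0 : 0 < y by exact: lt_le_trans ay.
  have y20 : y * y != 0 by rewrite mulf_neq0// gt_eqF.
  have id' := is_derive_id y (1 : R).
  exact: der_continuous (@derV _ (fun y => y * y) _ _ y20 (derM id' id')).
rewrite (lint_itv ad dF cf) !mulN1r opprK gerDr oppr_le0 invr_ge0.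
by rewrite ltW// (lt_le_trans a0).
Qed.

Lemma posl_expo_tail : posl (@expo_tail R) <= 1.
Proof.
have [i1 l1] := @L1_expo_tail R; apply: le_trans l1.
by apply: posl_le_lint => // y; exact: expo_tail_ge0.
Qed.

Lemma expo_tailE (y : R) : 0 < y -> expo_tail y = expR (- y).
Proof.
by move=> y0; rewrite /expo_tail indicE mem_set ?mulr1//= in_itv/= andbT ltW.
Qed.

Lemma L1_spike_shift (X t : R) : 0 < X -> L1 (fun y => spike X (y + t)).
Proof. by move=> X0; apply: L1_shift; have [] := L1_spike X0. Qed.

Lemma posl_spike_shift (X t : R) : 0 < X -> posl (fun y => spike X (y + t)) <= X.
Proof.
move=> X0; have [i1 l1] := L1_spike X0.
apply: le_trans (posl_le_lint (L1_spike_shift t X0) _) _.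
  by move=> y; exact: spike_ge0.
by rewrite (lint_shift t i1).
Qed.

Lemma indic_in (a d y : R) : a <= y -> y <= d -> \1_(`[a, d] : set R) y = 1 :> R.
Proof. by move=> ay yd; rewrite indic_itvccE ay yd. Qed.

Lemma log_over_ge0 (a d y : R) : 0 < a -> d <= 1 -> 0 <= log_over a d y.
Proof.
move=> a0 d1; rewrite /log_over indic_itvccE.
case: (boolP (a <= y <= d)) => /= [/andP[ay yd]|_]; rewrite ?mulr0// mulr1.
have y0 := lt_le_trans a0 ay.
by rewrite divr_ge0 ?(ltW y0)// ln_invE// oppr_ge0 ln_le0// (le_trans yd).
Qed.

Lemma inv_sqr_ge0 (a d y : R) : 0 <= inv_sqr a d y.
Proof. by rewrite mulr_ge0 ?invr_ge0 ?sqr_ge0// indicE. Qed.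

(** The mean value point of [K_B_mixed_difference] is within x + h of y, that is, within a
    small fraction of y when y >= N (x + h); there the curvature is close to 1 / (pi y^2). *)
Lemma mixedK_mid (eta : R) : 0 < eta <= 1 -> exists2 N : R, 1 <= N &
  exists2 rho : R, 0 < rho & forall x h y : R, 0 < x -> 0 < h ->
    N * (x + h) <= y -> y <= rho ->
    4 * x * h * (1 - eta) / (pi * y ^+ 2) <= mixedK x h y
      <= 4 * x * h * (1 + eta) / (pi * y ^+ 2).
Proof.
move=> /andP[eta0 eta1].
(* For e <= 1 / 8: (1 - 8 e) (1 + e)^2 <= 1 - e and 1 + e <= (1 + 8 e) (1 - e)^2. *)
have [e [e0 e1 ->]] : exists e, [/\ 0 < e, e <= 1 / 8 & eta = 8 * e].
  by exists (eta / 8); split; [rewrite divr_gt0|rewrite ler_pM2r|field].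
have [rho rho0 kb] := kernel_curv_near0 e0.
exists (e^-1); first by rewrite invf_ge1//; lra.
exists (rho / 2); first by rewrite divr_gt0.
move=> x h y x0 h0; rewrite mulrC ler_pdivrMr// => xhy yr.
have y0 : 0 < y by rewrite -(pmulr_lgt0 _ e0); lra.
have xhy' : x + h < y by nra.
have [c /andP[c1 c2] e'] := K_B_mixed_difference x0 h0 xhy'.
have cl : (1 - e) * y <= c by nra.
have cu : c <= (1 + e) * y by nra.
have c0 : 0 < c by nra.
have crho : 0 < c <= rho by rewrite c0/=; nra.
have /andP[k1 k2] := kb _ crho.
have P0 := pi_gt0 R; have xh0 : 0 < 4 * x * h by rewrite !mulr_gt0.
rewrite /mixedK e' -(mulrA _ (1 - 8 * e)) -(mulrA _ (1 + 8 * e)) !ler_pM2l//.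
have q0 : 0 < pi * y ^+ 2 by rewrite mulr_gt0// exprn_gt0.
have q1 : 0 < pi * c ^+ 2 by rewrite mulr_gt0// exprn_gt0.
apply/andP; split.
  apply: le_trans k1; rewrite ler_pdivrMr// mulrAC ler_pdivlMr//.
  rewrite !(mulrCA _ pi) ler_pM2l//.
  have : c ^+ 2 <= ((1 + e) * y) ^+ 2 by rewrite ler_sqr ?nnegrE; nra.
  have y2 : 0 < y ^+ 2 by rewrite exprn_gt0.
  have c20 : 0 < c ^+ 2 by rewrite exprn_gt0.
  rewrite exprMn; move: (y ^+ 2) (c ^+ 2) y2 c20 => u v u0 v0 vu.
  have [e8|e8] := leP (1 - 8 * e) 0; first by nra.
  apply: (@le_trans _ _ ((1 - 8 * e) * ((1 + e) ^+ 2 * u))); first by rewrite ler_pM2l.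
  by rewrite mulrA ler_pM2r//; nra.
apply: (le_trans k2); rewrite ler_pdivrMr// mulrAC ler_pdivlMr//.
rewrite !(mulrCA _ pi) ler_pM2l//.
have : ((1 - e) * y) ^+ 2 <= c ^+ 2 by rewrite ler_sqr ?nnegrE; nra.
have y2 : 0 < y ^+ 2 by rewrite exprn_gt0.
rewrite exprMn; move: (y ^+ 2) (c ^+ 2) y2 => u v u0 uv.
apply: (@le_trans _ _ ((1 + 8 * e) * ((1 - e) ^+ 2 * u))); last by rewrite ler_pM2l//; lra.
by rewrite mulrA ler_pM2r//; nra.
Qed.

(** Beyond d the mean value point stays above d / 2, where the curvature is exponentially
    small. *)
Lemma mixedK_tail (d : R) : 0 < d -> exists2 C : R, 0 < C &
  forall x h y : R, 0 < x -> 0 < h -> x + h <= d / 2 -> d <= y ->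
    mixedK x h y <= C * (x * h) * expR (- y).
Proof.
move=> d0; have d20 : 0 < d / 2 by rewrite divr_gt0.
have [C C0 kC] := kernel_curv_far d20.
exists (4 * C * expR (d / 2)); first by rewrite !mulr_gt0// expR_gt0.
move=> x h y x0 h0 xhd dy; have xhy : x + h < y by lra.
have [c /andP[c1 c2] e'] := K_B_mixed_difference x0 h0 xhy.
rewrite /mixedK e'.
rewrite (_ : 4 * C * _ * _ * _ = 4 * x * h * (C * (expR (d / 2) * expR (- y)))); last by ring.
rewrite ler_pM2l ?mulr_gt0// -expRD (le_trans (kC c _))//; first by lra.
by rewrite ler_pM2l// ler_expR; lra.
Qed.

(** For equal steps the four-point difference degenerates into the second difference of the
    kernel with step X. *)
Lemma mixedK_half (X y : R) :
  mixedK (X / 2) (X / 2) y = K_B (y - X) - 2 * K_B y + K_B (y + X).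
Proof.
rewrite /mixedK.
rewrite (_ : y - X / 2 - X / 2 = y - X); last by field.
rewrite (_ : y - X / 2 + X / 2 = y); last by field.
rewrite (_ : y + X / 2 - X / 2 = y); last by field.
rewrite (_ : y + X / 2 + X / 2 = y + X); last by field.
by ring.
Qed.

End ModelProfiles.

(** * The integral inequalities at the crest *)

Section Crest.
Context {R : realType}.

Definition Phi (b t : R) : R := b / 2 * t ^+ 2 + t ^+ 3 / 2.

(** What the asymptotics use of a solution v: here w = a - v with a the height of the crest,
    and b / 2 is the coefficient of the quadratic term of the equation at the crest. The
    field [crest_eq] is the equation at x - h subtracted from the one at x + h. *)
Record crest (b nu : R) (w : R -> R) : Prop := Crest {
  crest_b : 0 < b;
  crest_nu : 0 < nu;
  crest_cont : continuous w;
  crest_bound : exists M, forall y, `|w y| <= M;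
  crest_0 : w 0 = 0;
  crest_ge0 : forall y, 0 <= w y;
  crest_incr : forall x y, 0 < x -> x < y -> y < nu -> w x < w y;
  crest_eq : forall x h alpha,
    Phi b (w (x + h)) - Phi b (w (x - h)) = posl (fun y => mixedK x h y * (w y - alpha))
}.

Variables (b nu : R) (w : R -> R).
Hypothesis cr : crest b nu w.

Lemma crest_le x y : 0 < x -> x <= y -> y < nu -> w x <= w y.
Proof.
move=> x0; rewrite le_eqVlt => /predU1P[->//|xy] yn.
exact/ltW/(crest_incr cr).
Qed.

Lemma crest_gt0 x : 0 < x -> x < nu -> 0 < w x.
Proof.
move=> x0 xn; apply: le_lt_trans (crest_ge0 cr (x / 2)) _.
by apply: (crest_incr cr) => //; lra.
Qed.

Lemma L1_mixedK_crest x h alpha : L1 (fun y => mixedK x h y * (w y - alpha)).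
Proof.
have [M wM] := crest_bound cr.
apply: (@L1M_bounded _ _ _ (M + `|alpha|)); first exact: L1_mixedK.
  apply: measurable_funB => //; apply: continuous_measurable_fun; exact: crest_cont cr.
by move=> y; rewrite (le_trans (ler_normB _ _))// lerD2r.
Qed.

(** For equal steps x - h = 0, where w vanishes. *)
Lemma Phi_crest X : Phi b (w X) = posl (fun y => mixedK (X / 2) (X / 2) y * (w y - 0)).
Proof.
have X2X : X / 2 + X / 2 = X by field.
rewrite -(crest_eq cr) subrr (crest_0 cr) X2X.
by rewrite /Phi !expr0n/= !mulr0 mul0r addr0 subr0.
Qed.

(** Up to N X the mixed difference is at most a spike of mass N X and w is at most
    w (N X), which gives the term in X^2 ln (1 / X). Between N X and d the model
    (1 + eta) X^2 / (pi y^2) integrates against y ln (1 / y) to half of ln (1 / X) ^ 2: this is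
    the main term. The tail is O(X^2) because w is bounded. *)
Lemma Phi_upper (eta : R) : 0 < eta <= 1 -> exists2 rho : R, 0 < rho &
  forall d, 0 < d -> d <= rho -> d < 1 -> d < nu ->
  exists2 x0 : R, 0 < x0 <= d & exists2 C : R, 0 < C & forall X B : R, 0 < X -> X < x0 -> 0 <= B ->
    (forall y, X <= y <= d -> w y <= B * (y * ln (1 / y))) ->
    Phi b (w X) <= B * ((1 + eta) / (2 * pi)) * (X * ln (1 / X)) ^+ 2
      + C * B * (X ^+ 2 * ln (1 / X)) + C * X ^+ 2.
Proof.
move=> eta01; have [N N1 [rho rho0 Tmid]] := mixedK_mid eta01.
have /andP[eta0 eta1] := eta01.
exists rho => // d d0 drho d1 dnu.
have [C0 C00 Ttail] := mixedK_tail d0.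
have [M wM] := crest_bound cr.
have M0 : 0 <= M by apply: le_trans (wM 0); rewrite normr_ge0.
have P0 := pi_gt0 R.
have N0 : 0 < N by exact: lt_le_trans N1.
exists (d / (2 * N)).
  rewrite divr_gt0 ?mulr_gt0//= ler_pdivrMr ?mulr_gt0//; nra.
exists (N ^+ 2 + C0 * M).
  by rewrite ltr_wpDr ?exprn_gt0// mulr_ge0// ltW.
move=> X B X0; rewrite ltr_pdivlMr ?mulr_gt0// => Xd B0 wB.
have NXd : N * X <= d by nra.
have XNX : X <= N * X by nra.
have Xd2 : X <= d / 2 by nra.
have NX0 : 0 < N * X by rewrite mulr_gt0.
have lnX : ln (1 / (N * X)) <= ln (1 / X).
  by rewrite !ln_invE// lerN2 ler_ln.
have lnd : 0 <= ln (1 / d) by rewrite ln_invE// oppr_ge0 ln_le0// ltW.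
have lnNX : 0 <= ln (1 / (N * X)).
  by rewrite ln_invE// oppr_ge0 ln_le0// (le_trans NXd)// ltW.
have X20 : 0 < X / 2 by rewrite divr_gt0.
have X2X : X / 2 + X / 2 = X by field.
rewrite Phi_crest.
pose c1 := B * (N * X * ln (1 / X)).
pose c2 := X ^+ 2 * (1 + eta) * B / pi.
pose c3 := C0 * (X / 2 * (X / 2)) * M.
have c10 : 0 <= c1.
  by rewrite mulr_ge0// mulr_ge0 ?(ltW NX0)// (le_trans lnNX).
have c20 : 0 <= c2 by rewrite divr_ge0 ?(ltW P0)// mulr_ge0// mulr_ge0 ?sqr_ge0//; lra.
have c30 : 0 <= c3 by rewrite mulr_ge0// mulr_ge0 ?(ltW C00)// -expr2 sqr_ge0.
have wle y : 0 < y -> y <= N * X -> w y <= B * (N * X * ln (1 / X)).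
  move=> y0 yN; apply: (le_trans (crest_le y0 yN (le_lt_trans NXd dnu))).
  apply: (le_trans (wB _ _)); first by rewrite XNX NXd.
  by rewrite ler_wpM2l// ler_pM2l.
have iT := L1_mixedK_crest (X / 2) (X / 2) 0.
have g1 := L1_spike_shift (- X) NX0.
have g2 := L1_log_over d NX0.
have [g3 _] := @L1_expo_tail R.
apply: (le_trans (@posl_le_comb _ [::] _ _ _ _ _ c1 c2 c3 0 iT g1 g2 g3 g3 _)).
  move=> y y0 _; rewrite mul0r addr0 subr0.
  have t1 : 0 <= c1 * spike (N * X) (y - X) by rewrite mulr_ge0 ?spike_ge0.
  have t2 : 0 <= c2 * log_over (N * X) d y by rewrite mulr_ge0 ?log_over_ge0// ltW.
  have t3 : 0 <= c3 * expo_tail y by rewrite mulr_ge0 ?expo_tail_ge0.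
  have [yN|Ny] := leP y (N * X).
    apply: (@le_trans _ _ (c1 * spike (N * X) (y - X))); last by lra.
    rewrite mixedK_half mulrC.
    apply: (@le_trans _ _ (w y * spike (N * X) (y - X))).
      apply: ler_wpM2l; first exact: crest_ge0 cr y.
      apply: le_trans (le_spike _ _).
      have k1 : K_B (y + X) <= K_B y by apply: K_B_nonincr => //; lra.
      have k2 : K_B (N * X) <= K_B y by exact: K_B_nonincr.
      by lra.
    by apply: ler_wpM2r; [exact: spike_ge0|exact: wle].
  have [yd|dy] := leP y d.
    apply: (@le_trans _ _ (c2 * log_over (N * X) d y)); last by lra.
    have NXy : N * (X / 2 + X / 2) <= y by rewrite X2X ltW.
    have /andP[_ T2] := Tmid (X / 2) (X / 2) y X20 X20 NXy (le_trans yd drho).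
    rewrite /log_over indic_in ?(ltW Ny)// mulr1.
    apply: le_trans (ler_wpM2r (crest_ge0 cr y) T2) _.
    have y1 : X <= y <= d by rewrite (le_trans XNX (ltW Ny)).
    have TT : 0 <= 4 * (X / 2) * (X / 2) * (1 + eta) / (pi * y ^+ 2).
      by rewrite divr_ge0 ?mulr_ge0 ?sqr_ge0 ?ltW//; lra.
    apply: le_trans (ler_wpM2l TT (wB y y1)) _.
    rewrite /c2 le_eqVlt; apply/orP; left; apply/eqP.
    move: (pi : R) P0 => P P0; field; rewrite !gt_eqF//.
  apply: (@le_trans _ _ (c3 * expo_tail y)); last by lra.
  rewrite expo_tailE// /c3.
  have T3 := Ttail _ _ y X20 X20 _ (ltW dy).
  apply: (@le_trans _ _ (C0 * (X / 2 * (X / 2)) * expR (- y) * w y)).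
    by rewrite ler_wpM2r ?(crest_ge0 cr)// T3// X2X.
  rewrite [leRHS]mulrAC ler_wpM2l//.
    by rewrite !mulr_ge0 ?expR_ge0 ?ltW.
  by apply: le_trans (wM y); rewrite ler_norm.
rewrite mul0r addr0 posl_log_over//.
have b1 : c1 * posl (fun y => spike (N * X) (y + - X)) <= c1 * (N * X).
  by rewrite ler_wpM2l// posl_spike_shift.
have b3 : c3 * posl expo_tail <= c3 by rewrite ler_piMr// posl_expo_tail.
have b2 : c2 * ((ln (1 / (N * X)) ^+ 2 - ln (1 / d) ^+ 2) / 2) <= c2 * (ln (1 / X) ^+ 2 / 2).
  rewrite ler_wpM2l// ler_pM2r// lerBlDr.
  have : ln (1 / (N * X)) ^+ 2 <= ln (1 / X) ^+ 2.
    by rewrite ler_sqr// nnegrE (le_trans lnNX).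
  by have := sqr_ge0 (ln (1 / d)); lra.
apply: (le_trans (lerD (lerD b1 b2) b3)).
have LX0 : 0 <= ln (1 / X) by exact: le_trans lnX.
have CM0 : 0 <= C0 * M by rewrite mulr_ge0// ltW.
have -> : c2 * (ln (1 / X) ^+ 2 / 2) = B * ((1 + eta) / (2 * pi)) * (X * ln (1 / X)) ^+ 2.
  by rewrite /c2; move: (pi : R) P0 => P P0; field; rewrite gt_eqF.
have -> : c1 * (N * X) = N ^+ 2 * B * (X ^+ 2 * ln (1 / X)) by rewrite /c1; ring.
have -> : c3 = C0 * M * X ^+ 2 / 4 by rewrite /c3; field.
have u1 : 0 <= C0 * M * B * (X ^+ 2 * ln (1 / X)) by rewrite !mulr_ge0 ?sqr_ge0// ltW.
have u2 : 0 <= N ^+ 2 * X ^+ 2 by rewrite mulr_ge0 ?sqr_ge0.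
have u3 : 0 <= C0 * M * X ^+ 2 by rewrite mulr_ge0 ?sqr_ge0.
by rewrite !mulrDl; lra.
Qed.

(** The mixed difference is nonnegative beyond X, so only the range up to X can contribute
    negatively. There it is at least - 2 times a spike of mass 2 X, while w <= w X; the loss is
    4 X w X. *)
Lemma Phi_lower (eta : R) : 0 < eta <= 1 -> exists2 rho : R, 0 < rho &
  exists2 N : R, 1 <= N &
  forall d, 0 < d -> d <= rho -> d < 1 -> d < nu -> forall X B : R, 0 < X -> 2 * N * X < d -> 0 <= B ->
    (forall y, X <= y <= d -> B * (y * ln (1 / y)) <= w y) ->
    B * ((1 - eta) / (2 * pi)) * X ^+ 2 * (ln (1 / (N * X)) ^+ 2 - ln (1 / d) ^+ 2)
    <= Phi b (w X) + 4 * X * w X.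
Proof.
move=> eta01; have [N N1 [rho rho0 Tmid]] := mixedK_mid eta01.
have /andP[eta0 eta1] := eta01.
exists rho => //; exists N => // d d0 drho d1 dnu.
have P0 := pi_gt0 R.
have N0 : 0 < N by exact: lt_le_trans N1.
move=> X B X0 Xd B0 wB.
have NXd : N * X <= d by nra.
have XNX : X <= N * X by nra.
have NX0 : 0 < N * X by rewrite mulr_gt0.
have X20 : 0 < X / 2 by rewrite divr_gt0.
have X2X : X / 2 + X / 2 = X by field.
have DX0 : 0 < 2 * X by rewrite mulr_gt0.
have Xnu : X < nu by lra.
rewrite Phi_crest.
pose c1 := - (2 * w X).
pose c2 := X ^+ 2 * (1 - eta) * B / pi.
have c10 : c1 <= 0 by rewrite oppr_le0 mulr_ge0// (crest_ge0 cr).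
have c20 : 0 <= c2 by rewrite divr_ge0 ?(ltW P0)// mulr_ge0// mulr_ge0 ?sqr_ge0//; lra.
have iT := L1_mixedK_crest (X / 2) (X / 2) 0.
have [g1 g1X] := L1_spike DX0.
have g2 := L1_log_over d NX0.
have := @posl_ge_comb _ [:: X] _ _ _ _ _ c1 c2 0 0 iT g1 g2 g2 g2 _.
have pg1 : c1 * (2 * X) <= c1 * posl (spike (2 * X)).
  apply: ler_wnM2l => //; apply: le_trans g1X.
  by apply: posl_le_lint => // y; exact: spike_ge0.
rewrite mul0r !addr0 posl_log_over// => H.
rewrite -lerBlDr; apply: le_trans (H _); last first.
  move=> y y0; rewrite inE => yX; rewrite mul0r !addr0 subr0.
  have t1 : c1 * spike (2 * X) y <= 0 by rewrite mulr_le0_ge0 ?spike_ge0.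
  have [yN|Ny] := ltP y (N * X).
    have -> : log_over (N * X) d y = 0.
      by rewrite /log_over indic_itvccE [N * X <= y]leNgt yN mulr0.
    rewrite mulr0 addr0.
    have [Xy|yX'|/eqP] := ltgtP X y; last by rewrite eq_sym (negbTE yX).
      apply: (le_trans t1); apply: mulr_ge0; last exact: crest_ge0 cr y.
      by apply: mixedK_ge0 => //; rewrite X2X.
    rewrite mixedK_half.
    have k1 : K_B (2 * X) <= K_B (y - X).
      rewrite -(K_B_even (y - X)); apply: K_B_nonincr; lra.
    have k2 : K_B (2 * X) <= K_B (y + X) by apply: K_B_nonincr; lra.
    have k3 : - (2 * spike (2 * X) y) <= K_B (y - X) - 2 * K_B y + K_B (y + X).
      by have := le_spike (2 * X) y; lra.
    apply: le_trans (ler_wpM2r (crest_ge0 cr y) k3).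
    have wy := crest_le y0 (ltW yX') Xnu.
    by rewrite /c1 !mulNr lerN2 -!mulrA ler_pM2l// mulrC ler_wpM2r// spike_ge0.
  have XNy : X < y by rewrite lt_neqAle eq_sym yX (le_trans XNX).
  have T0 : 0 <= mixedK (X / 2) (X / 2) y by apply: mixedK_ge0 => //; rewrite X2X.
  have [yd|dy] := leP y d; last first.
    have -> : log_over (N * X) d y = 0.
      by rewrite /log_over indic_itvccE [y <= d]leNgt dy andbF mulr0.
    rewrite mulr0 addr0 (le_trans t1)// mulr_ge0//; exact: crest_ge0 cr y.
  have NXy : N * (X / 2 + X / 2) <= y by rewrite X2X.
  have /andP[T2 _] := Tmid (X / 2) (X / 2) y X20 X20 NXy (le_trans yd drho).
  apply: (@le_trans _ _ (c2 * log_over (N * X) d y)); first by rewrite gerDr.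
  rewrite /log_over indic_in// mulr1.
  have y1 : X <= y <= d by rewrite ltW.
  apply: le_trans (ler_wpM2l T0 (wB y y1)).
  have L0 : 0 <= B * (y * ln (1 / y)).
    by rewrite mulr_ge0// mulr_ge0 ?(ltW y0)// ln_invE// oppr_ge0 ln_le0//; lra.
  apply: le_trans (ler_wpM2r L0 T2).
  rewrite /c2 le_eqVlt; apply/orP; left; apply/eqP.
  move: (pi : R) P0 => P P0; field; rewrite !gt_eqF//.
apply: le_trans (lerD pg1 (lexx _)).
rewrite /c1 /c2 le_eqVlt; apply/orP; left; apply/eqP.
by move: (pi : R) P0 => P P0; field; rewrite !gt_eqF.
Qed.

End Crest.

(** * Asymptotics of the profile *)

Section CrestAsymptotics.
Context {R : realType}.
Variables (b nu : R) (w : R -> R).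
Hypothesis cr : crest b nu w.

Let P0 : 0 < pi :> R := pi_gt0 R.
Let b0 : 0 < b := crest_b cr.
Let nu0 : 0 < nu := crest_nu cr.

Lemma ln_inv_large (M : R) : exists2 d : R, 0 < d & forall x, 0 < x -> x <= d -> M <= ln (1 / x).
Proof.
exists (expR (- M)); first exact: expR_gt0.
move=> x x0 xd; rewrite ln_invE// lerNr -ler_expR lnK//.
Qed.

Lemma ln_inv_gt0 (x : R) : 0 < x -> x < 1 -> 0 < ln (1 / x).
Proof. by move=> x0 x1; rewrite ln_invE// oppr_gt0 ln_lt0// x0. Qed.

Lemma ln_invM (N X : R) : 0 < N -> 0 < X -> ln (1 / (N * X)) = ln (1 / X) - ln N.
Proof. by move=> N0 X0; rewrite !ln_invE ?mulr_gt0// lnM ?posrE// opprD addrC. Qed.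

Let ratio (y : R) := w y / (y * ln (1 / y)).

Let ratio_continuous (a d : R) : 0 < a -> d < 1 -> {within `[a, d], continuous ratio}.
Proof.
move=> a0 d1; apply: continuous_in_subspaceT => y; rewrite inE/= in_itv/= => /andP[ay yd].
have y0 : 0 < y by exact: lt_le_trans ay.
have yl : y * ln (1 / y) != 0.
  by rewrite mulf_neq0// gt_eqF// ln_inv_gt0// (le_lt_trans yd).
apply: (@continuousM _ _ w (fun y => (y * ln (1 / y))^-1) y); first exact: crest_cont cr y.
exact: der_continuous (@derV _ (fun y => y * ln (1 / y)) _ _ yl
  (derM (is_derive_id y (1 : R)) (der_ln_inv y0))).
Qed.

Let Phi_ge (t : R) : 0 <= t -> b / 2 * t ^+ 2 <= Phi b t.
Proof. by move=> t0; rewrite /Phi lerDl divr_ge0// exprn_ge0. Qed.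

Let A : R := (b * pi)^-1.
Let Ai : R := b * pi.

Let A0 : 0 < A.
Proof. by rewrite invr_gt0 mulr_gt0. Qed.

Local Tactic Notation "lra_from" hyp_list(l) := clear - l P0 b0 nu0 ratio_continuous Phi_ge A0 A Ai; lra.

Definition below_log (B : R) :=
  exists2 d : R, 0 < d & forall x, 0 < x -> x < d -> w x <= B * (x * ln (1 / x)).

(** The lower bound carries the reciprocal constant t: in this form its improvement is again
    an average, now with b pi. *)
Definition above_log (t : R) :=
  exists2 d : R, 0 < d & forall x, 0 < x -> x < d -> x * ln (1 / x) <= t * w x.

(** Let Q be the largest value of w y / (y ln (1 / y)) on [X, d], attained at y. If y is not
    small, Q is bounded by a maximum that is independent of X. If y is small, [Phi_upper] at y
    with B = Q yields (b / 2) Q^2 <= Q / pi + C Q + C, which bounds Q. *)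
Lemma crest_below_log : exists2 B : R, 0 < B & below_log B.
Proof.
have one01 : 0 < (1 : R) <= 1 by rewrite ltr01 lexx.
have [rho rho0 H] := Phi_upper cr one01.
have [d1 d10 L1big] := ln_inv_large 1.
pose d := Num.min (Num.min rho d1) (Num.min (1 / 2) (nu / 2)).
have d0 : 0 < d by rewrite !lt_min rho0 d10 !divr_gt0.
have drho : d <= rho by rewrite !ge_min lexx.
have dd1 : d <= d1 by rewrite !ge_min lexx orbT.
have dh : d <= 1 / 2 by rewrite !ge_min lexx !orbT.
have dn : d <= nu / 2 by rewrite !ge_min lexx !orbT.
have dl1 : d < 1 by lra.
have dnu : d < nu by lra.
have [x0 /andP[x00 x0d] [C C0 HC]] := H d d0 drho dl1 dnu.
have [y1 _ y1max] := EVT_max x0d (ratio_continuous x00 dl1).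
pose C1 := 1 / pi + C + C.
have C10 : 0 < C1 by rewrite !addr_gt0// divr_gt0.
pose B := Num.max (1 + 2 * C1 / b) (ratio y1).
have B0 : 0 < B by rewrite lt_max addr_gt0// divr_gt0// mulr_gt0.
exists B => //; exists d => // X X0 Xd.
have [y yX ymax] := EVT_max (ltW Xd) (ratio_continuous X0 dl1).
move: yX; rewrite in_itv/= => /andP[Xy yd].
have y0 : 0 < y by exact: lt_le_trans Xy.
have lpos t : 0 < t -> t <= d -> 0 < t * ln (1 / t).
  by move=> t0 td; rewrite mulr_gt0// ln_inv_gt0// (le_lt_trans td).
have Q0 : 0 <= ratio y.
  by apply: divr_ge0; [exact: crest_ge0 cr y|rewrite ltW// lpos].
suff QB : ratio y <= B.
  have lX := lpos X X0 (ltW Xd); rewrite -ler_pdivrMr//; apply: le_trans QB.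
  by apply: ymax; rewrite in_itv/= lexx ltW.
have [x0y|yx0] := leP x0 y.
  by rewrite le_max; apply/orP; right; apply: y1max; rewrite in_itv/= x0y.
rewrite le_max; apply/orP; left.
have wy t : y <= t <= d -> w t <= ratio y * (t * ln (1 / t)).
  move=> /andP[yt td]; have t0 : 0 < t by exact: lt_le_trans yt.
  rewrite -ler_pdivrMr ?lpos//; apply: ymax.
  by rewrite in_itv/= td (le_trans Xy).
have := HC y (ratio y) y0 yx0 Q0 wy.
have L1y : 1 <= ln (1 / y) by apply: L1big => //; exact: le_trans dd1.
have wE : w y = ratio y * (y * ln (1 / y)).
  by rewrite /ratio divfK// gt_eqF// lpos.
move=> /(le_trans (Phi_ge (crest_ge0 cr y))).
rewrite {1}wE exprMn.
set Q := ratio y in Q0 *; set L := ln (1 / y) in L1y *.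
have -> : Q * ((1 + 1) / (2 * pi)) = Q / pi.
  by move: (pi : R) P0 => p p0; field; rewrite gt_eqF.
move=> h.
have yL0 : 0 < (y * L) ^+ 2 by rewrite exprn_gt0// mulr_gt0//; lra.
have h1 : b / 2 * Q ^+ 2 <= Q / pi + C * Q + C.
  rewrite -(ler_pM2r yL0) -(mulrA (b / 2)); apply: (le_trans h); rewrite 2!mulrDl.
  have y20 : 0 < y ^+ 2 by rewrite exprn_gt0.
  have e1 : y ^+ 2 * L <= (y * L) ^+ 2.
    by rewrite exprMn ler_pM2l// expr2 ler_peMl//; lra.
  have e2 : y ^+ 2 <= (y * L) ^+ 2.
    by rewrite exprMn ler_peMr ?(ltW y20)// expr_ge1//; lra.
  rewrite -!addrA lerD2l; apply: lerD; apply: ler_wpM2l => //.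
    by rewrite mulr_ge0// ltW.
  exact: ltW.
have [Q1|Q1] := leP Q 1.
  by rewrite (le_trans Q1)// lerDl divr_ge0 ?mulr_ge0// ltW.
rewrite (@le_trans _ _ (2 * C1 / b))//; last by rewrite lerDr.
rewrite ler_pdivlMr// mulrC.
have Qp : 0 < Q by lra.
rewrite -(ler_pM2r Qp); have : C <= C * Q by rewrite ler_peMr ?ltW.
rewrite /C1; move: h1; rewrite div1r expr2; move: (pi^-1 : R) => ip; lra.
Qed.

(** For B' = (A + B) / 2 the gap g = (b / 2) B'^2 - B / (2 pi) is the positive number
    (b / 2) ((B - A) / 2)^2; the error terms of [Phi_upper] fit into it near the origin. *)
Lemma below_log_step (B : R) : A < B -> below_log B -> below_log ((A + B) / 2).
Proof.
move=> AB [dB dB0 wB]; set B' := (A + B) / 2.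
have B0 : 0 < B by apply: lt_trans AB.
have B'0 : 0 < B' by rewrite divr_gt0// addr_gt0.
have [g gE] : exists g, g = b / 2 * B' ^+ 2 - B / (2 * pi) by eexists.
have g0 : 0 < g.
  have -> : g = b / 2 * ((B - A) / 2) ^+ 2.
    by rewrite gE /B' /A; move: (pi : R) P0 => p p0; field; rewrite !gt_eqF.
  by rewrite mulr_gt0 ?divr_gt0// exprn_gt0// divr_gt0// subr_gt0.
(* This eta keeps the error B eta / (2 pi) of the main term below half of the gap. *)
pose eta := Num.min 1 (g * pi / B).
have eta01 : 0 < eta <= 1 by rewrite lt_min ltr01 divr_gt0 ?mulr_gt0//= ge_min lexx.
have eg : B * eta / (2 * pi) <= g / 2.
  have : eta <= g * pi / B by rewrite ge_min lexx orbT.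
  rewrite ler_pdivlMr// => h.
  by rewrite ler_pdivrMr ?mulr_gt0// (_ : g / 2 * (2 * pi) = g * pi); [lra|field].
have [rho rho0 H] := Phi_upper cr eta01.
pose d := Num.min (Num.min rho (dB / 2)) (Num.min (1 / 2) (nu / 2)).
have d0 : 0 < d by rewrite !lt_min rho0 !divr_gt0.
have drho : d <= rho by rewrite !ge_min lexx.
have dd1 : d <= dB / 2 by rewrite !ge_min lexx orbT.
have dh : d <= 1 / 2 by rewrite !ge_min lexx !orbT.
have dn : d <= nu / 2 by rewrite !ge_min lexx !orbT.
have dl1 : d < 1 by lra.
have dnu : d < nu by lra.
have [x0 /andP[x00 x0d] [C C0 HC]] := H d d0 drho dl1 dnu.
have [d2 d20 L2big] := ln_inv_large (1 + 2 * (C * (B + 1)) / g).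
exists (Num.min x0 d2); first by rewrite lt_min x00.
move=> x x_gt0; rewrite lt_min => /andP[xx0 xd2].
have := HC x B x_gt0 xx0 (ltW B0) _.
have wB' y : x <= y <= d -> w y <= B * (y * ln (1 / y)).
  by move=> /andP[xy yd]; apply: wB; lra.
move=> /(_ wB') /(le_trans (Phi_ge (crest_ge0 cr x))).
have := L2big x x_gt0 (ltW xd2); set L := ln (1 / x) => hL.
have CB0 : 0 < C * (B + 1) by rewrite mulr_gt0// addr_gt0.
have L1 : 1 <= L.
  apply: le_trans hL; rewrite lerDl; apply: divr_ge0; last exact: ltW.
  by rewrite mulr_ge0// ltW.
have hL2 : C * (B + 1) <= g / 2 * L.
  have : 2 * (C * (B + 1)) / g <= L by lra.
  by rewrite ler_pdivrMr//; lra.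
move=> h; have xL0 : 0 < x * L by rewrite mulr_gt0//; lra.
have BxL : 0 <= B' * (x * L) by rewrite mulr_ge0// ltW.
rewrite -(@ler_sqr _ (w x)) ?nnegrE ?(crest_ge0 cr)//.
have b20 : 0 < b / 2 by rewrite divr_gt0.
rewrite -(ler_pM2l b20); apply: (le_trans h).
have -> : b / 2 * (B' * (x * L)) ^+ 2 = (g + B / (2 * pi)) * (x * L) ^+ 2.
  by rewrite gE subrK exprMn mulrA.
have -> : B * ((1 + eta) / (2 * pi)) = B / (2 * pi) + B * eta / (2 * pi).
  by move: (pi : R) P0 => p p0; field; rewrite gt_eqF.
have s0 : 0 <= (x * L) ^+ 2 by exact: sqr_ge0.
have e1 : B * eta / (2 * pi) * (x * L) ^+ 2 <= g / 2 * (x * L) ^+ 2 by rewrite ler_wpM2r.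
have x20 : 0 < x ^+ 2 by rewrite exprn_gt0.
have e2 : C * B * (x ^+ 2 * L) + C * x ^+ 2 <= g / 2 * (x * L) ^+ 2.
  apply: (@le_trans _ _ (C * (B + 1) * L * x ^+ 2)).
    have : x ^+ 2 * 1 <= x ^+ 2 * L by rewrite ler_pM2l.
    by move=> /(ler_wpM2l (ltW C0)); rewrite mulr1; lra.
  have -> : g / 2 * (x * L) ^+ 2 = g / 2 * L * L * x ^+ 2 by ring.
  by rewrite ler_pM2r// ler_pM2r//; lra.
move: (B / (2 * pi)) (B * eta / (2 * pi)) e1 e2 => u v e1 e2; rewrite !mulrDl; lra.
Qed.

Lemma below_log_mono (B B' : R) : B <= B' -> below_log B -> below_log B'.
Proof.
move=> BB [d d0 wd]; exists (Num.min d 1); first by rewrite lt_min d0 ltr01.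
move=> x x0; rewrite lt_min => /andP[xd x1]; apply: (le_trans (wd x x0 xd)).
by rewrite ler_wpM2r// ltW// mulr_gt0// ln_inv_gt0.
Qed.

Lemma halving_small (D e : R) : 0 < e -> exists n : nat, D / 2 ^+ n < e.
Proof.
move=> e0; have [D0|D0] := leP D 0.
  by exists 0%N; rewrite expr0 divr1 (le_lt_trans D0).
exists (Num.truncn (D / e)).+1.
rewrite ltr_pdivrMr ?exprn_gt0// -ltr_pdivrMl// mulrC.
apply: (lt_le_trans (truncnS_gt _)).
by rewrite -natrX ler_nat ltnW// ltn_expl.
Qed.

(** Each step halves the distance of the constant to A. *)
Lemma crest_upper_asymptotics (e : R) : 0 < e -> below_log (A + e).
Proof.
move=> e0; have [B B0 wB] := crest_below_log.
have [BA|AB] := leP B A; first by apply: below_log_mono wB; lra.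
have it n : below_log (A + (B - A) / 2 ^+ n).
  elim: n => [|n IH]; first by rewrite expr0 divr1 addrC subrK.
  rewrite (_ : A + _ = (A + (A + (B - A) / 2 ^+ n)) / 2); last first.
    by rewrite exprS; field; rewrite expf_neq0.
  apply: below_log_step => //.
  by rewrite ltrDl divr_gt0 ?exprn_gt0// subr_gt0.
have [n hn] := halving_small (B - A) e0.
by apply: below_log_mono (it n); rewrite lerD2l ltW.
Qed.

(** The argument of [crest_below_log] at a minimum Q of the same ratio: when the minimum
    point is small, [Phi_lower] gives ln (1 / y) ^ 2 / (16 pi) at most a multiple of
    Q ln (1 / y) ^ 2, which bounds Q from below. *)
Lemma crest_above_log : exists2 t : R, 0 < t & above_log t.
Proof.
have half01 : 0 < (1 / 2 : R) <= 1 by lra.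
have [rho rho0 [N N1 H]] := Phi_lower cr half01.
have N0 : 0 < N by lra.
have [M wM] := crest_bound cr.
have M0 : 0 <= M by apply: le_trans (wM 0); rewrite normr_ge0.
pose d := Num.min rho (Num.min (1 / 2) (nu / 2)).
have d0 : 0 < d by rewrite !lt_min rho0 !divr_gt0.
have drho : d <= rho by rewrite !ge_min lexx.
have dh : d <= 1 / 2 by rewrite !ge_min lexx !orbT.
have dn : d <= nu / 2 by rewrite !ge_min lexx !orbT.
have dl1 : d < 1 by lra.
have dnu : d < nu by lra.
have {}H := H d d0 drho dl1 dnu.
set l := ln (1 / d) in H.
have [d2 d20 L2big] := ln_inv_large (1 + 4 * ln N + 4 * l ^+ 2 + 64 * pi).
pose x0 := Num.min (d / (4 * N)) d2.
have x00 : 0 < x0 by rewrite lt_min d20 divr_gt0// mulr_gt0.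
have x0d : x0 <= d.
  rewrite ge_min ler_pdivrMr ?mulr_gt0//; apply/orP; left; nra.
have [y1 y1I y1min] := EVT_min x0d (ratio_continuous x00 dl1).
have lpos t : 0 < t -> t <= d -> 0 < t * ln (1 / t).
  by move=> t0 td; rewrite mulr_gt0// ln_inv_gt0// (le_lt_trans td).
have qpos t : 0 < t -> t <= d -> 0 < ratio t.
  move=> t0 td; rewrite /ratio divr_gt0 ?lpos//.
  by apply: (crest_gt0 cr) => //; exact: le_lt_trans td _.
have q1 : 0 < ratio y1.
  by move: y1I; rewrite in_itv/= => /andP[h1 h2]; apply: qpos => //; lra.
pose q0 := Num.min (ratio y1) (1 / (8 * pi * (b + M))).
have bM0 : 0 < b + M by rewrite ltr_pwDl.
have q00 : 0 < q0 by rewrite lt_min q1 divr_gt0// !mulr_gt0.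
exists q0^-1; first by rewrite invr_gt0.
exists d => // X X0 Xd.
have [y yX ymin] := EVT_min (ltW Xd) (ratio_continuous X0 dl1).
move: yX; rewrite in_itv/= => /andP[Xy yd].
have y0 : 0 < y by exact: lt_le_trans Xy.
have Q0 : 0 < ratio y by exact: qpos.
suff QB : q0 <= ratio y.
  have lX := lpos X X0 (ltW Xd); rewrite ler_pdivlMl// -ler_pdivlMr//; apply: (le_trans QB).
  by apply: ymin; rewrite in_itv/= lexx ltW.
have [x0y|yx0] := leP x0 y.
  by rewrite ge_min; apply/orP; left; apply: y1min; rewrite in_itv/= x0y.
rewrite ge_min; apply/orP; right.
have wy t : y <= t <= d -> ratio y * (t * ln (1 / t)) <= w t.
  move=> /andP[yt td]; have t0 : 0 < t by exact: lt_le_trans yt.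
  rewrite -ler_pdivlMr ?lpos//; apply: ymin.
  by rewrite in_itv/= td (le_trans Xy).
have yN : 2 * N * y < d.
  have : y < d / (4 * N) by apply: lt_le_trans yx0 _; rewrite ge_min lexx.
  rewrite ltr_pdivlMr ?mulr_gt0//; nra.
have := H y (ratio y) y0 yN (ltW Q0) wy.
have wE : w y = ratio y * (y * ln (1 / y)).
  by rewrite /ratio divfK// gt_eqF// lpos.
have hL : 1 + 4 * ln N + 4 * l ^+ 2 + 64 * pi <= ln (1 / y).
  apply: L2big => //; apply: (le_trans (ltW yx0)); by rewrite ge_min lexx orbT.
rewrite ln_invM// /Phi.
have wyM : w y <= M by apply: le_trans (wM y); rewrite ler_norm.
have -> : b / 2 * w y ^+ 2 + w y ^+ 3 / 2 + 4 * y * w y = (b / 2 + w y / 2) * w y ^+ 2 + 4 * y * w y by ring.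
have : (b / 2 + w y / 2) * w y ^+ 2 <= (b + M) / 2 * w y ^+ 2.
  by rewrite ler_wpM2r ?sqr_ge0//; lra.
move=> h1 h2; have {h1 h2} := le_trans h2 (lerD h1 (lexx (4 * y * w y))).
rewrite wE; set Q := ratio y in Q0 *; set L := ln (1 / y) in hL *.
have lN0 : 0 <= ln N by rewrite ln_ge0.
have l0 : 0 <= l ^+ 2 by exact: sqr_ge0.
have yQ0 : 0 < y ^+ 2 * Q by rewrite mulr_gt0// exprn_gt0.
have -> : Q * ((1 - 1 / 2) / (2 * pi)) * y ^+ 2 * ((L - ln N) ^+ 2 - l ^+ 2)
  = (y ^+ 2 * Q) * (((L - ln N) ^+ 2 - l ^+ 2) / (4 * pi)).
  by move: (pi : R) P0 => p p0; field; rewrite gt_eqF.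
have -> : (b + M) / 2 * (Q * (y * L)) ^+ 2 + 4 * y * (Q * (y * L))
  = (y ^+ 2 * Q) * ((b + M) / 2 * Q * L ^+ 2 + 4 * L) by ring.
rewrite ler_pM2l// ler_pdivrMr ?mulr_gt0// => h.
rewrite ler_pdivrMr ?mulr_gt0//.
move: h hL; move: (pi : R) P0 => p p0 h hL.
have L0 : 0 < L by lra_from hL lN0 l0 p0.
have k1 : L ^+ 2 / 2 <= (L - ln N) ^+ 2 - l ^+ 2.
  have : 0 <= L * (L - 4 * ln N - 4 * l ^+ 2).
    by rewrite mulr_ge0 ?(ltW L0)//; lra_from hL p0.
  have L1 : 1 <= L by lra_from hL lN0 l0 p0.
  have := ler_wpM2l l0 L1; have := sqr_ge0 (ln N); rewrite mulr1; lra_from l0.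
have k2 : 16 * p * L <= L ^+ 2 / 4.
  rewrite expr2; have : 64 * p <= L by lra_from hL lN0 l0.
  move=> /(ler_wpM2r (ltW L0)); lra_from.
have L20 : 0 < L ^+ 2 by rewrite exprn_gt0.
rewrite -(ler_pM2r L20).
have k3 : L ^+ 2 / 2 <= (b + M) / 2 * Q * L ^+ 2 * (4 * p) + 16 * p * L.
  apply: (le_trans k1); apply: (le_trans h); rewrite mulrDl lerD2l; lra_from.
have -> : Q * (8 * p * (b + M)) * L ^+ 2 = 4 * ((b + M) / 2 * Q * L ^+ 2 * (4 * p)) by field.
lra_from k2 k3.
Qed.

Lemma crest_small (e : R) : 0 < e ->
  exists2 d : R, 0 < d & forall x, 0 < x -> x < d -> w x <= e.
Proof.
move=> e0; have h : w x @[x --> (0 : R)] --> w 0 := @crest_cont _ _ _ _ cr 0.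
have /nbhs_ballP[d /= d0 hd] : \forall x \near 0, `|w 0 - w x| < e.
  by move/cvgrPdist_lt : h; exact.
exists d => // x x0 xd.
have := hd x; rewrite (crest_0 cr) sub0r normrN => hx.
apply: le_trans (ler_norm _) (ltW (hx _)).
by rewrite /ball/= sub0r normrN gtr0_norm.
Qed.

(** For t' = (b pi + t) / 2 the gap g = 1 / (pi t) - b / t'^2 is positive, being
    ((t - b pi) / 2)^2 / (pi t t'^2); it absorbs the cubic term and the lower powers of the
    logarithm in [Phi_lower]. *)
Lemma above_log_step (t : R) : Ai < t -> above_log t -> above_log ((Ai + t) / 2).
Proof.
have Ai0 : 0 < Ai by rewrite mulr_gt0.
move=> At [dt dt0 wt].
have [t' t'E] : exists t', t' = (Ai + t) / 2 by eexists.
rewrite -t'E.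
have t0 : 0 < t by apply: lt_trans At.
have t'0 : 0 < t' by rewrite t'E divr_gt0// addr_gt0.
have [B B0 [dB dB0 wB]] := crest_below_log.
have [g gE] : exists g, g = 1 / (pi * t) - b / t' ^+ 2 by eexists.
have g0 : 0 < g.
  have -> : g = ((t - Ai) / 2) ^+ 2 / (pi * t * t' ^+ 2).
    rewrite gE t'E /Ai; move: At; rewrite /Ai; move: (pi : R) P0 => p p0 At.
    by field; rewrite !gt_eqF ?addr_gt0 ?mulr_gt0.
  have tA : 0 < (t - Ai) / 2 by rewrite divr_gt0// subr_gt0.
  have pt : 0 < pi * t by rewrite mulr_gt0.
  by rewrite divr_gt0 ?exprn_gt0// mulr_gt0 ?exprn_gt0.
pose eta := Num.min 1 (g * (pi * t) / 4).
have eta01 : 0 < eta <= 1 by rewrite lt_min ltr01 divr_gt0 ?mulr_gt0//= ge_min lexx.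
have eg : eta / (pi * t) <= g / 4.
  rewrite ler_pdivrMr ?mulr_gt0// mulrAC.
  by rewrite ge_min lexx orbT.
have [rho rho0 [N N1 H]] := Phi_lower cr eta01.
have N0 : 0 < N by lra.
have lN0 : 0 <= ln N by rewrite ln_ge0.
pose d := Num.min (Num.min rho (dt / 2)) (Num.min (1 / 2) (nu / 2)).
have d0 : 0 < d by rewrite !lt_min rho0 !divr_gt0.
have drho : d <= rho by rewrite !ge_min lexx.
have dd1 : d <= dt / 2 by rewrite !ge_min lexx orbT.
have dh : d <= 1 / 2 by rewrite !ge_min lexx !orbT.
have dn : d <= nu / 2 by rewrite !ge_min lexx !orbT.
have dl1 : d < 1 by lra.
have dnu : d < nu by lra.
have {}H := H d d0 drho dl1 dnu.
set l := ln (1 / d) in H.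
have [D DE] : exists D, D = (2 * ln N + l ^+ 2) / (pi * t) + 8 * B by eexists.
have D0 : 0 < D.
  rewrite DE ltr_wpDl ?mulr_gt0//; apply: divr_ge0.
    by apply: addr_ge0; [exact: mulr_ge0|exact: sqr_ge0].
  by rewrite ltW// mulr_gt0.
have [d2 d20 L2big] := ln_inv_large (1 + 4 * D / g).
have [e e0 we] : exists2 e : R, 0 < e & forall x, 0 < x -> x < e -> w x <= g / 4 * t' ^+ 2.
  by apply: crest_small; rewrite mulr_gt0 ?divr_gt0// exprn_gt0.
exists (Num.min (Num.min (d / (4 * N)) d2) (Num.min e dB)).
  by rewrite !lt_min d20 e0 dB0 divr_gt0// mulr_gt0.
move=> x x0; rewrite !lt_min => /andP[/andP[xdN xd2] /andP[xe xdB]].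
have xN : 2 * N * x < d by move: xdN; rewrite ltr_pdivlMr ?mulr_gt0//; nra.
have wt' y : x <= y <= d -> t^-1 * (y * ln (1 / y)) <= w y.
  by move=> /andP[xy yd]; rewrite ler_pdivrMl//; apply: wt; [exact: lt_le_trans xy|lra_from yd dd1 dt0].
have tV0 : 0 <= t^-1 by rewrite invr_ge0 ltW.
have := H x t^-1 x0 xN tV0 wt'.
have hw := we x x0 xe; have hB := wB x x0 xdB.
have w0 := crest_ge0 cr x.
have := L2big x x0 (ltW xd2); rewrite ln_invM// /Phi; set L := ln (1 / x) in hB * => hL.
have L1 : 1 <= L.
  apply: le_trans hL; rewrite lerDl; apply: divr_ge0; last exact: ltW.
  by rewrite mulr_ge0// ltW.
have hL2 : D <= g / 4 * L.
  have : 4 * D / g <= L by lra_from hL.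
  by rewrite ler_pdivrMr//; lra_from.
have x20 : 0 < x ^+ 2 by rewrite exprn_gt0.
have t20 : 0 < t' ^+ 2 by rewrite exprn_gt0.
move: gE DE eg; move: (pi : R) P0 => p p0 gE DE eg h.
have xL0 : 0 <= x * L by apply: mulr_ge0; [exact: ltW|lra_from L1].
have tw0 : 0 <= t' * w x by rewrite mulr_ge0// ltW.
rewrite -(@ler_sqr _ (x * L) (t' * w x)) ?nnegrE//.
rewrite !exprMn -ler_pdivrMl//.
(* The cubic term is absorbed since w x is small. *)
have h1 : w x ^+ 3 <= g / 4 * t' ^+ 2 * w x ^+ 2 by rewrite exprS ler_wpM2r// sqr_ge0.
have h2 : 8 * x * w x <= 8 * B * (x ^+ 2 * L).
  have -> : 8 * B * (x ^+ 2 * L) = 8 * x * (B * (x * L)) by ring.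
  by rewrite ler_wpM2l// mulr_ge0// ltW.
have h3 : x ^+ 2 * (((L - ln N) ^+ 2 - l ^+ 2) * ((1 - eta) / (p * t))) <=
    (b + g / 4 * t' ^+ 2) * w x ^+ 2 + 8 * B * (x ^+ 2 * L).
  have -> : x ^+ 2 * (((L - ln N) ^+ 2 - l ^+ 2) * ((1 - eta) / (p * t))) =
    2 * (t^-1 * ((1 - eta) / (2 * p)) * x ^+ 2 * ((L - ln N) ^+ 2 - l ^+ 2)).
    by field; rewrite !gt_eqF.
  lra_from h h1 h2.
have ptV : 0 < (p * t)^-1 by rewrite invr_gt0 mulr_gt0.
have h4 : L ^+ 2 * ((1 - eta) / (p * t)) - (2 * ln N + l ^+ 2) / (p * t) * L
    <= ((L - ln N) ^+ 2 - l ^+ 2) * ((1 - eta) / (p * t)).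
  have [eta0 eta1] := andP eta01.
  have u : 0 <= (1 - eta) / (p * t) <= (p * t)^-1.
    by rewrite divr_ge0 ?subr_ge0 ?(ltW (mulr_gt0 _ _))//= ler_piMl ?(ltW ptV)//; lra_from eta0.
  move: ((1 - eta) / (p * t)) ((p * t)^-1) u ptV => u v /andP[u0 uv] v0.
  have z1 : L ^+ 2 - (2 * ln N + l ^+ 2) * L <= (L - ln N) ^+ 2 - l ^+ 2.
    have := sqr_ge0 (ln N); have := ler_wpM2l (sqr_ge0 l) L1; rewrite mulr1; lra_from.
  apply: le_trans (ler_wpM2r u0 z1).
  have z2 : 0 <= (2 * ln N + l ^+ 2) * L by rewrite mulr_ge0 ?addr_ge0 ?sqr_ge0 ?mulr_ge0//; lra_from L1.
  by have := ler_wpM2l z2 uv; lra_from.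
have h5 : L ^+ 2 * (b / t' ^+ 2 + g / 4) <= L ^+ 2 * ((1 - eta) / (p * t)) - D * L - g / 4 * L ^+ 2.
  have -> : L ^+ 2 * ((1 - eta) / (p * t)) = L ^+ 2 * (g + b / t' ^+ 2) - L ^+ 2 * (eta / (p * t)).
    by rewrite gE subrK -mulrBr -mulrBl.
  have := ler_wpM2l (sqr_ge0 L) eg.
  have L0 : 0 <= L by lra_from L1.
  have := ler_wpM2r L0 hL2; rewrite -(mulrA _ L L) -expr2.
  have : 0 <= g / 4 * L ^+ 2 by rewrite mulr_ge0 ?sqr_ge0// divr_ge0// ltW.
  lra_from.
have h6 : x ^+ 2 * (L ^+ 2 * (b / t' ^+ 2 + g / 4)) <= (b + g / 4 * t' ^+ 2) * w x ^+ 2.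
  have gL : 0 <= g / 4 * L ^+ 2 by rewrite mulr_ge0 ?sqr_ge0// divr_ge0// ltW.
  have : L ^+ 2 * (b / t' ^+ 2 + g / 4) <= ((L - ln N) ^+ 2 - l ^+ 2) * ((1 - eta) / (p * t)) - 8 * B * L.
    move: h4 h5; rewrite DE mulrDl; lra_from gL.
  move=> /(ler_wpM2l (ltW x20)); rewrite mulrBr; lra_from h3 gL.
have bt0 : 0 < b + g / 4 * t' ^+ 2 by rewrite addr_gt0// mulr_gt0// divr_gt0.
rewrite -(ler_pM2l bt0); apply: le_trans h6.
rewrite le_eqVlt; apply/orP; left; apply/eqP; field; rewrite gt_eqF//.
Qed.

Lemma above_log_mono (t t' : R) : t <= t' -> above_log t -> above_log t'.
Proof.
move=> tt [d d0 wd]; exists d => // x x0 xd; apply: (le_trans (wd x x0 xd)).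
by rewrite ler_wpM2r// (crest_ge0 cr).
Qed.

Lemma crest_lower_asymptotics (e : R) : 0 < e -> above_log (Ai + e).
Proof.
move=> e0; have [t t0 wt] := crest_above_log.
have [tA|At] := leP t Ai; first by apply: above_log_mono wt; lra.
have it n : above_log (Ai + (t - Ai) / 2 ^+ n).
  elim: n => [|n IH]; first by rewrite expr0 divr1 addrC subrK.
  rewrite (_ : Ai + _ = (Ai + (Ai + (t - Ai) / 2 ^+ n)) / 2); last first.
    by rewrite exprS; field; rewrite expf_neq0.
  apply: above_log_step => //.
  by rewrite ltrDl divr_gt0 ?exprn_gt0// subr_gt0.
have [n hn] := halving_small (t - Ai) e0.
by apply: above_log_mono (it n); rewrite lerD2l ltW.
Qed.

End CrestAsymptotics.

(** * Symmetric difference quotients *)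

Section SymmetricDifference.
Context {R : realType}.

(** The symmetric quotient (f (x + h) - f (x - h)) / (2 h) converges to the derivative. *)
Lemma sym_diff_le (f : R -> R) (x D C h0 : R) : 0 < h0 -> is_derive x 1 f D ->
  (forall h, 0 < h -> h < h0 -> f (x + h) - f (x - h) <= 2 * h * C) -> D <= C.
Proof.
move=> h00 df fC; rewrite leNgt; apply/negP => CD.
pose g (h : R) := f (h + x) - f (-1 * h + x).
have d1 : is_derive (0 : R) 1 (fun h : R => f (h + x)) D.
  by apply: der_shift; rewrite add0r.
have d2 : is_derive (0 : R) 1 (fun h : R => f (-1 * h + x)) (D * (-1 * 1)).
  have dm : is_derive (0 : R) 1 (fun h : R => -1 * h) (-1 * 1).
    by have := @derZ R (-1) id 0 1 (is_derive_id (0 : R) (1 : R)).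
  have df' : is_derive (-1 * 0 : R) 1 (fun t => f (t + x)) D.
    by apply: der_shift; rewrite mulr0 add0r.
  exact: (@der_comp _ (fun t => f (t + x)) (fun h : R => -1 * h) 0 _ _ df' dm).
have dg : is_derive (0 : R) 1 g (D - D * (-1 * 1)) := derB d1 d2.
have gc : (fun h => h^-1 *: (g (h *: 1 + 0) - g 0)) @ (0 : R)^' --> D - D * (-1 * 1).
  by have [dv <-] := dg; exact: dv.
have CD2 : 2 * C < D - D * (-1 * 1) by lra.
have [e /= e0 he] : \forall h \near (0 : R)^', 2 * C < h^-1 *: (g (h *: 1 + 0) - g 0).
  exact: cvgr_gt gc _ CD2.
pose h := Num.min (e / 2) (h0 / 2).
have h_gt0 : 0 < h by rewrite lt_min !divr_gt0.
have hh0 : h < h0.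
  have he2 : h <= h0 / 2 by rewrite ge_min lexx orbT.
  lra.
have hle : h < e.
  have he2 : h <= e / 2 by rewrite ge_min lexx.
  lra.
have := he h; rewrite /ball_/= sub0r normrN gtr0_norm// => /(_ hle).
rewrite gt_eqF// => /(_ isT).
rewrite /g /GRing.scale/= mulr1 !addr0 mulr0 !add0r subrr subr0 mulN1r.
rewrite ltr_pdivlMl// ltNge => /negP; apply.
by rewrite (addrC h) (addrC (- h)) mulrA (mulrC h); exact: fC.
Qed.

Lemma sym_diff_ge (f : R -> R) (x D C h0 : R) : 0 < h0 -> is_derive x 1 f D ->
  (forall h, 0 < h -> h < h0 -> 2 * h * C <= f (x + h) - f (x - h)) -> C <= D.
Proof.
move=> h00 df fC; rewrite -lerN2.
have dN : is_derive x 1 (fun t => -1 * f t) (-1 * D) by exact: derZ.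
rewrite -[- D]mulN1r; apply: (sym_diff_le h00 dN) => h h_gt0 hh0.
by have := fC h h_gt0 hh0; lra.
Qed.

End SymmetricDifference.

(** * First differences of the kernel *)

Section KernelDifference.
Context {R : realType}.
Notation K := (@K_B R).
Let P0 : 0 < pi :> R := pi_gt0 R.

Definition kdiff (h z : R) : R := K (z - h) - K (z + h).

Lemma mixedK_kdiff (x h y : R) : mixedK x h y = kdiff h (y - x) - kdiff h (y + x).
Proof. by rewrite /mixedK /kdiff opprB addrA; ring. Qed.

Lemma kdiffN (h z : R) : kdiff h (- z) = - kdiff h z.
Proof.
rewrite /kdiff (_ : - z - h = - (z + h)); last by ring.
by rewrite (_ : - z + h = - (z - h)) ?K_B_even ?opprB//; ring.
Qed.

Lemma kdiff_ge0 (h z : R) : 0 < h -> 0 < z -> z != h -> 0 <= kdiff h z.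
Proof.
move=> h0 z0 zh; rewrite subr_ge0; have [zl|hz|/eqP] := ltgtP z h.
- by rewrite -(K_B_even (z - h)); apply: K_B_nonincr; lra.
- by apply: K_B_nonincr; lra.
- by rewrite (negbTE zh).
Qed.

Lemma kdiff_le (h z : R) : 0 < h -> h < z -> kdiff h z <= 2 * h / (pi * (z - h)).
Proof.
move=> h0 hz; have zh0 : 0 < z - h by rewrite subr_gt0.
apply: (le_trans (K_B_sub_le zh0 _)); first by lra.
by rewrite (_ : z + h - (z - h) = 2 * h)//; ring.
Qed.

Lemma normr_kdiff (h z : R) : 0 < h -> z != h -> z != - h ->
  `|kdiff h z| = kdiff h `|z|.
Proof.
move=> h0 zh zNh; have [z0|z0|->] := ltgtP z 0.
- have := kdiff_ge0 h0 (_ : 0 < - z) _; rewrite oppr_gt0 eqr_oppLR => /(_ z0 zNh).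
  by rewrite (ltr0_norm z0) kdiffN oppr_ge0 => k; rewrite ler0_norm.
- by rewrite (gtr0_norm z0) ger0_norm// kdiff_ge0.
- by rewrite normr0 /kdiff sub0r add0r K_B_even subrr normr0.
Qed.

Lemma kdiff_far (h r z : R) : 0 < h -> 2 * h <= r -> r <= `|z| ->
  `|kdiff h z| <= 4 * h / (pi * r).
Proof.
move=> h0 hr rz; have r0 : 0 < r by lra.
have zh : z != h by apply: contraTneq rz => ->; rewrite gtr0_norm// -ltNge; lra.
have zNh : z != - h by apply: contraTneq rz => ->; rewrite normrN gtr0_norm// -ltNge; lra.
rewrite normr_kdiff//; apply: (le_trans (kdiff_le h0 _)); first by lra.
have zh0 : 0 < `|z| - h by lra.
rewrite ler_pdivrMr ?mulr_gt0// mulrAC ler_pdivlMr ?mulr_gt0//.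
rewrite !(mulrCA _ pi) ler_pM2l//; nra.
Qed.

(** The factor z tames the first difference: for |z| >= 2 h it behaves as h / z, and next to
    its two singularities, at distance h, it is below a spike. Hence its product
    with a Lipschitz increment is of order h up to spikes of mass 3 h. *)
Lemma kdiff_near (h z : R) : 0 < h -> z != h -> z != - h ->
  `|kdiff h z| * `|z| <= 4 / pi * h + 2 * h * (spike (3 * h) (z - h) + spike (3 * h) (z + h)).
Proof.
move=> h0 zh zNh.
have s0 : 0 <= 2 * h * (spike (3 * h) (z - h) + spike (3 * h) (z + h)).
  by rewrite mulr_ge0 ?addr_ge0 ?spike_ge0// mulr_ge0// ltW.
have t0 : 0 <= 4 / pi * h by rewrite mulr_ge0 ?divr_ge0// ltW.
have [hz|zh2] := leP (2 * h) `|z|.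
  have z0 : 0 < `|z| by lra.
  apply: (@le_trans _ _ (4 / pi * h)); last by rewrite lerDl.
  apply: (le_trans (ler_wpM2r (normr_ge0 z) (kdiff_far h0 hz (lexx _)))).
  rewrite le_eqVlt; apply/orP; left; apply/eqP.
  by move: `|z| (pi : R) P0 z0 => u p p0 u0; field; rewrite !gt_eqF.
apply: (@le_trans _ _ (2 * h * (spike (3 * h) (z - h) + spike (3 * h) (z + h)))).
  rewrite mulrC; apply: ler_pM => //; first exact: ltW.
  rewrite normr_kdiff//.
  have [z0|z0] := leP 0 z.
    rewrite ger0_norm//; apply: (@le_trans _ _ (spike (3 * h) (z - h))); last by rewrite lerDl spike_ge0.
    apply: le_trans (le_spike _ _); rewrite lerD2l lerN2; apply: K_B_nonincr; first by lra.
    by move: zh2; rewrite ger0_norm//; lra.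
  move: zh2; rewrite ltr0_norm// => zh2.
  apply: (@le_trans _ _ (spike (3 * h) (z + h))); last by rewrite lerDr spike_ge0.
  apply: le_trans (le_spike _ _).
  rewrite /kdiff -(K_B_even (z + h)) opprD lerD2l lerN2.
  by apply: K_B_nonincr; lra.
by rewrite lerDr.
Qed.

(** The part of the mixed difference that is reflected in the origin stays away from the
    singularities. *)
Lemma kdiff_sum_le (x h y : R) : 0 < h -> h < x / 2 -> 0 < y ->
  0 <= kdiff h (y + x) <= 4 * h / (pi * x).
Proof.
move=> h0 hx y0; rewrite kdiff_ge0//=; [|lra|rewrite gt_eqF//; lra].
apply: (le_trans (kdiff_le h0 _)); first by lra.
have [x0 yxh] : 0 < x /\ 0 < y + x - h by split; lra.
rewrite ler_pdivrMr ?mulr_gt0// mulrAC ler_pdivlMr ?mulr_gt0//.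
rewrite !(mulrCA _ pi) ler_pM2l//; clear - P0 h0 hx y0; nra.
Qed.

End KernelDifference.

(** * Integral estimates of the slope *)

Section DerivativeEstimates.
Context {R : realType}.
Variables (b nu : R) (w dw : R -> R).
Hypothesis cr : crest b nu w.
Hypothesis wdw : forall x, 0 < x -> x < nu -> is_derive x 1 w (dw x).

Let P0 : 0 < pi :> R := pi_gt0 R.
Let b0 : 0 < b := crest_b cr.

Local Tactic Notation "lra_from" hyp_list(l) := clear - l wdw P0 b0; lra.

Definition dPhi (t : R) : R := b * t + 3 / 2 * t ^+ 2.

Lemma der_Phi_crest (x : R) : 0 < x -> x < nu ->
  is_derive x 1 (fun t => Phi b (w t)) (dPhi (w x) * dw x).
Proof.
move=> x0 xn; have d := wdw x0 xn.
have d2 := derM d d; have d3 := derM d d2.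
have dP := derD (derZ (b / 2) d2) (derZ (1 / 2) d3).
rewrite (_ : (fun t => Phi b (w t)) =
  (fun t => b / 2 * (w t * w t) + 1 / 2 * (w t * (w t * w t)))); last first.
  by apply/funext => t; rewrite /Phi; field.
by apply: (is_derive_eq dP); rewrite /dPhi; field.
Qed.

Lemma L1_indic_seg (s t : R) : L1 (fun y : R => 1 * \1_(`[s, t] : set R) y).
Proof. by apply: (@L1_itv _ (fun=> 1)); apply: continuous_subspaceT => y; exact: cvg_cst. Qed.

Lemma posl_indic_seg (s t : R) : s <= t ->
  posl (fun y : R => 1 * \1_(`[s, t] : set R) y) <= t - s.
Proof.
move=> st; apply: (@le_trans _ _ (lint (fun y : R => 1 * \1_(`[s, t] : set R) y))).
  apply: posl_le_lint; first exact: L1_indic_seg.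
  by move=> y; rewrite mul1r indicE.
by rewrite (@lint_itv _ (fun=> 1) id)//; apply: continuous_subspaceT => y; exact: cvg_cst.
Qed.

(** The factors kdiff h (y - x) and w y - w x have the same sign; the whole loss
    comes from the reflected part of the mixed difference. *)
Lemma mixedK_crest_near_ge (x h y : R) : 0 < x -> 2 * x < nu -> 0 < h -> h < x / 2 ->
  0 < y -> y < 2 * x -> y != x - h -> y != x + h ->
  - (4 * h / (pi * x) * w (2 * x)) <= mixedK x h y * (w y - w x).
Proof.
move=> x0 x2nu h0 hx y0 y2x yxl yxr.
have k1 : 0 <= kdiff h (y - x) * (w y - w x).
  have [yx|xy|->] := ltgtP y x; last by rewrite !subrr mulr0.
    rewrite -(opprB x y) kdiffN mulNr -mulrN opprB; apply: mulr_ge0.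
      apply: kdiff_ge0; rewrite ?subr_gt0//.
      by apply: contra yxl => /eqP e; apply/eqP; rewrite -e; ring.
    by rewrite subr_ge0; apply: (crest_le cr) => //; [exact: ltW|lra].
  apply: mulr_ge0.
    apply: kdiff_ge0; rewrite ?subr_gt0//.
    by apply: contra yxr => /eqP e; apply/eqP; rewrite -e; ring.
  by rewrite subr_ge0; apply: (crest_le cr) => //; [exact: ltW|lra].
have /andP[k20 k2] := kdiff_sum_le h0 hx y0.
have wy2 : w y - w x <= w (2 * x).
  have : w y <= w (2 * x) by apply: (crest_le cr) => //; exact: ltW.
  have := crest_ge0 cr x; lra.
have k3 : kdiff h (y + x) * (w y - w x) <= 4 * h / (pi * x) * w (2 * x).
  apply: (le_trans (ler_wpM2l k20 wy2)).
  by apply: ler_wpM2r => //; exact: crest_ge0 cr _.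
by rewrite mixedK_kdiff mulrBl; lra_from k1 k3.
Qed.

(** Within r of x the Lipschitz bound and [kdiff_near] give the terms in M; farther away the
    first difference is at most 4 h / (pi r) and w is at most w a. *)
Lemma mixedK_crest_near_le (x h r a M y : R) : 0 < x -> x <= a -> a < nu ->
  0 < h -> 2 * h < r -> r <= x / 2 -> 0 <= M ->
  (forall y, `|y - x| <= r -> `|w y - w x| <= M * `|y - x|) ->
  0 < y -> y <= a -> y != x - h -> y != x + h ->
  mixedK x h y * (w y - w x) <= 4 * h / (pi * x) * w x + 4 * h / (pi * r) * w a
    + 4 / pi * h * M * (1 * \1_(`[x - r, x + r] : set R) y)
    + 2 * h * M * (spike (3 * h) (y + (- x - h)) + spike (3 * h) (y + (- x + h))).
Proof.
move=> x0 xa anu h0 hr rx M0 wM y0 ya yxl yxr.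
have wx0 := crest_ge0 cr x; have wy0 := crest_ge0 cr y.
have [r0 hx] : 0 < r /\ h < x / 2 by split; lra.
have a0 : 0 < a by lra.
have /andP[k20 k2] := kdiff_sum_le h0 hx y0.
have k3 : - (kdiff h (y + x) * (w y - w x)) <= 4 * h / (pi * x) * w x.
  rewrite -mulrN opprB; apply: (@le_trans _ _ (kdiff h (y + x) * w x)).
    by rewrite ler_wpM2l// gerBl.
  by rewrite ler_wpM2r.
have yx1 : y - x != h by apply: contra yxr => /eqP e; apply/eqP; rewrite -e; ring.
have yx2 : y - x != - h by apply: contra yxl => /eqP e; apply/eqP; rewrite -[h]opprK -e; ring.
have k4 : kdiff h (y - x) * (w y - w x) <= `|kdiff h (y - x)| * `|w y - w x|.
  by rewrite -normrM ler_norm.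
set s1 := spike _ _; set s2 := spike _ _.
have s0 : 0 <= 2 * h * M * (s1 + s2).
  by rewrite mulr_ge0 ?addr_ge0 ?spike_ge0// mulr_ge0// mulr_ge0// ltW.
have wa0 : 0 <= 4 * h / (pi * r) * w a.
  by rewrite mulr_ge0 ?(crest_ge0 cr)// divr_ge0 ?mulr_ge0// ltW.
rewrite mixedK_kdiff mulrBl.
have [yr|ry] := leP `|y - x| r.
  have yI : \1_(`[x - r, x + r] : set R) y = 1 :> R.
    by rewrite indic_in//; move: yr; rewrite ler_norml => /andP[u1 u2];
      lra_from u1 u2.
  have k5 : `|kdiff h (y - x)| * `|w y - w x| <= 4 / pi * h * M + 2 * h * M * (s1 + s2).
    apply: (le_trans (ler_wpM2l (normr_ge0 _) (wM y yr))).
    rewrite mulrCA; apply: (le_trans (ler_wpM2l M0 (kdiff_near h0 yx1 yx2))).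
    rewrite -(addrA y (- x) (- h)) -(addrA y (- x) h) -/s1 -/s2.
    by rewrite le_eqVlt; apply/orP; left; apply/eqP; ring.
  rewrite yI !mulr1; move: (4 / pi * h * M) k5 => u k5; lra_from k3 k4 k5 wa0.
have k5 : `|kdiff h (y - x)| * `|w y - w x| <= 4 * h / (pi * r) * w a.
  apply: ler_pM => //; first by apply: kdiff_far => //; exact: ltW.
  have wya : w y <= w a by apply: (crest_le cr).
  have wxa : w x <= w a by apply: (crest_le cr).
  by rewrite ler_norml; apply/andP; split; lra_from wya wxa wx0 wy0.
have i0 : 0 <= 4 / pi * h * M * (1 * \1_(`[x - r, x + r] : set R) y).
  rewrite mul1r mulr_ge0 ?indicE// mulr_ge0// mulr_ge0 ?(ltW h0)//.
  by rewrite divr_ge0// ltW.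
lra_from k3 k4 k5 i0 s0.
Qed.

(** This is [crest_eq] with alpha = w x divided by 2 h. Up to 2 x the integrand is bounded
    below by [mixedK_crest_near_ge], from there to 2 N x it is nonnegative, and up to d the
    model 4 x h (1 - eta) / (pi y^2) produces the squared logarithm. The subtracted
    constant w x costs O(w x), because 1 / y^2 integrates to O(1 / x). *)
Lemma slope_lower (eta : R) : 0 < eta <= 1 -> exists2 rho : R, 0 < rho &
  exists2 N : R, 1 <= N &
  forall d, 0 < d -> d <= rho -> d < 1 -> d < nu ->
  exists2 C : R, 0 < C & forall x B : R, 0 < x -> 4 * N * x <= d -> 0 <= B ->
    (forall y, x <= y <= d -> B * (y * ln (1 / y)) <= w y) ->
    x * B * (1 - eta) / pi * (ln (1 / (2 * N * x)) ^+ 2 - ln (1 / d) ^+ 2) - C * w (2 * x)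
      <= dPhi (w x) * dw x.
Proof.
move=> eta01; have [N N1 [rho rho0 Tmid]] := mixedK_mid eta01.
have /andP[eta0 eta1] := eta01.
exists rho => //; exists N => // d d0 drho d1 dnu.
have [C0 C00 Ttail] := mixedK_tail d0.
have N0 : 0 < N by lra.
exists (4 / pi + 2 / pi + C0).
  by rewrite !addr_gt0// divr_gt0.
move=> x B x0 xd B0 wB.
have xnu : x < nu by nra.
have hx0 : 0 < x / 2 by rewrite divr_gt0.
have a0 : 0 < 2 * N * x by rewrite !mulr_gt0.
have ad : 2 * N * x <= d by nra.
have x2a : 2 * x <= 2 * N * x by nra.
have x2nu : 2 * x < nu by lra.
have wx0 := crest_ge0 cr x.
have wx2 : w x <= w (2 * x) by apply: (crest_le cr) => //; lra.
apply: (sym_diff_ge hx0 (der_Phi_crest x0 xnu)) => h h0 hx.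
rewrite (crest_eq cr x h (w x)).
have Nxh0 : N * (x + h) <= 2 * N * x by nra.
have xhd : x + h <= d / 2 by nra.
pose c1 := - (4 * h / (pi * x) * w (2 * x)).
pose c2 := 4 * x * h * (1 - eta) * B / pi.
pose c3 := - (8 * x * h / pi * w x).
pose c4 := - (C0 * (x * h) * w x).
have c10 : c1 <= 0 by rewrite oppr_le0 mulr_ge0 ?(crest_ge0 cr)// divr_ge0 ?mulr_ge0// ltW.
have c20 : 0 <= c2 by rewrite divr_ge0 ?(ltW P0)// !mulr_ge0 ?(ltW x0) ?(ltW h0)//; lra.
have c30 : c3 <= 0 by rewrite oppr_le0 mulr_ge0// divr_ge0 ?mulr_ge0// ltW.
have c40 : c4 <= 0 by rewrite oppr_le0 !mulr_ge0 ?(ltW x0) ?(ltW h0) ?(ltW C00).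
have iT := L1_mixedK_crest cr x h (w x).
have g1 := L1_indic_seg 0 (2 * x).
have g2 := L1_log_over d a0.
have g3 := L1_inv_sqr d a0.
have [g4 _] := @L1_expo_tail R.
have H := @posl_ge_comb _ [:: x - h; x + h] _ _ _ _ _ c1 c2 c3 c4 iT g1 g2 g3 g4.
apply: (le_trans _ (H _)); last first.
  move=> y y0; rewrite !inE negb_or => /andP[yxl yxr].
  have wy0 := crest_ge0 cr y.
  have e1 : 0 <= 1 * \1_(`[0, 2 * x] : set R) y :> R by rewrite mul1r indicE.
  have e2 : 0 <= log_over (2 * N * x) d y by rewrite log_over_ge0// ltW.
  have e3 : 0 <= inv_sqr (2 * N * x) d y := inv_sqr_ge0 _ _ _.
  have e4 : 0 <= expo_tail y := expo_tail_ge0 _.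
  have f1 : c1 * (1 * \1_(`[0, 2 * x] : set R) y) <= 0 by rewrite mulr_le0_ge0.
  have f3 : c3 * inv_sqr (2 * N * x) d y <= 0 by rewrite mulr_le0_ge0.
  have f4 : c4 * expo_tail y <= 0 by rewrite mulr_le0_ge0.
  have [y2x|x2y] := ltP y (2 * x).
    have yN : y < 2 * N * x by exact: lt_le_trans x2a.
    have -> : log_over (2 * N * x) d y = 0.
      by rewrite /log_over indic_itvccE [2 * N * x <= y]leNgt yN mulr0.
    have -> : inv_sqr (2 * N * x) d y = 0.
      by rewrite /inv_sqr indic_itvccE [2 * N * x <= y]leNgt yN mulr0.
    rewrite !mulr0 !addr0 indic_in ?(ltW y0) ?(ltW y2x)// !mulr1.
    apply: (@le_trans _ _ c1); first by rewrite gerDl.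
    exact: mixedK_crest_near_ge.
  have [xhy xy] : x + h < y /\ x <= y by split; lra_from x2y hx h0.
  have T0 : 0 <= mixedK x h y by exact: mixedK_ge0.
  have [yd|dy] := leP y d; last first.
    have -> : log_over (2 * N * x) d y = 0.
      by rewrite /log_over indic_itvccE [y <= d]leNgt dy andbF mulr0.
    have -> : inv_sqr (2 * N * x) d y = 0.
      by rewrite /inv_sqr indic_itvccE [y <= d]leNgt dy andbF mulr0.
    rewrite !mulr0 !addr0; apply: (@le_trans _ _ (c4 * expo_tail y)); first by rewrite gerDr.
    have T3 := Ttail x h y x0 h0 xhd (ltW dy).
    rewrite expo_tailE// /c4 mulrBr mulNr.
    have := ler_wpM2r wx0 T3; have := mulr_ge0 T0 wy0; lra_from.
  have ynu : y < nu by exact: le_lt_trans dnu.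
  have wxy : w x <= w y by apply: (crest_le cr).
  have [yN|Ny] := ltP y (2 * N * x).
    have -> : log_over (2 * N * x) d y = 0.
      by rewrite /log_over indic_itvccE [2 * N * x <= y]leNgt yN mulr0.
    rewrite mulr0 addr0; apply: (@le_trans _ _ 0); first by lra_from f1 f3 f4.
    by rewrite mulr_ge0// subr_ge0.
  rewrite /log_over /inv_sqr (indic_in Ny yd) 2!mulr1.
  have Nxh : N * (x + h) <= y by exact: le_trans Nxh0 Ny.
  have /andP[T1 T2] := Tmid x h y x0 h0 Nxh (le_trans yd drho).
  have y1 : x <= y <= d by rewrite xy yd.
  have L0 : 0 <= B * (y * ln (1 / y)).
    by rewrite mulr_ge0// mulr_ge0 ?(ltW y0)// ln_invE// oppr_ge0 ln_le0// (le_trans yd)// ltW.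
  have m1 : c2 * (ln (1 / y) / y) <= mixedK x h y * w y.
    apply: le_trans (ler_wpM2l T0 (wB y y1)).
    apply: le_trans (ler_wpM2r L0 T1).
    rewrite /c2 le_eqVlt; apply/orP; left; apply/eqP.
    by move: (pi : R) P0 => p p0; field; rewrite !gt_eqF.
  have m2 : mixedK x h y * w x <= - (c3 * (y ^+ 2)^-1).
    have y20 : 0 < y ^+ 2 by rewrite exprn_gt0.
    have T3 : mixedK x h y <= 8 * x * h / (pi * y ^+ 2).
      apply: (le_trans T2); rewrite ler_pM2r ?invr_gt0 ?mulr_gt0//.
      have xh0 : 0 < x * h by rewrite mulr_gt0.
      clear - wdw P0 b0 xh0 eta1; nra.
    apply: (le_trans (ler_wpM2r wx0 T3)).
    rewrite /c3 le_eqVlt; apply/orP; left; apply/eqP.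
    by move: (pi : R) P0 => p p0; field; rewrite !gt_eqF.
  by rewrite mulrBr; lra_from m1 m2 f1 f4.
have q1 : c1 * (2 * x) <= c1 * posl (fun y : R => 1 * \1_(`[0, 2 * x] : set R) y).
  apply: ler_wnM2l => //; apply: (le_trans (posl_indic_seg _)); last by rewrite subr0.
  by rewrite mulr_ge0// ltW.
have q3 : c3 * (2 * x)^-1 <= c3 * posl (inv_sqr (2 * N * x) d).
  apply: ler_wnM2l => //; apply: (le_trans (posl_inv_sqr a0 ad)).
  by rewrite lef_pV2 ?posrE// mulr_gt0.
have q4 : c4 <= c4 * posl expo_tail.
  by rewrite -[leLHS]mulr1; apply: ler_wnM2l => //; exact: posl_expo_tail.
rewrite posl_log_over//.
apply: (@le_trans _ _ (c1 * (2 * x) + c2 * ((ln (1 / (2 * N * x)) ^+ 2 - ln (1 / d) ^+ 2) / 2)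
   + c3 * (2 * x)^-1 + c4)); last by lra_from q1 q3 q4.
have -> : c1 * (2 * x) = - (2 * h) * (4 / pi * w (2 * x)).
  by rewrite /c1; move: (pi : R) P0 => p p0; field; rewrite !gt_eqF.
have -> : c3 * (2 * x)^-1 = - (2 * h) * (2 / pi * w x).
  by rewrite /c3; move: (pi : R) P0 => p p0; field; rewrite !gt_eqF.
have -> : c2 * ((ln (1 / (2 * N * x)) ^+ 2 - ln (1 / d) ^+ 2) / 2) =
  2 * h * (x * B * (1 - eta) / pi * (ln (1 / (2 * N * x)) ^+ 2 - ln (1 / d) ^+ 2)).
  by rewrite /c2; move: (pi : R) P0 => p p0; field; rewrite gt_eqF.
have -> : c4 = - (2 * h) * (C0 * (x / 2) * w x) by rewrite /c4; field.
have z1 : 2 / pi * w x <= 2 / pi * w (2 * x) by rewrite ler_wpM2l// divr_ge0// ltW.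
have z2 : C0 * (x / 2) * w x <= C0 * w (2 * x).
  rewrite -mulrA ler_wpM2l ?(ltW C00)//; apply: le_trans wx2.
  by rewrite ler_piMl//; lra_from xd d1 x2a x0 ad.
have h20 : 0 <= 2 * h by rewrite mulr_ge0// ltW.
have := ler_wpM2l h20 z1; have := ler_wpM2l h20 z2.
move: (x * B * (1 - eta) / pi * _) (4 / pi) (2 / pi) => E p4 p2.
lra_from.
Qed.

(** The counterpart of [slope_lower]: now the neighbourhood of x has to be estimated by
    [mixedK_crest_near_le], where the radius r and the Lipschitz constant M are left free. *)
Lemma slope_upper (eta : R) : 0 < eta <= 1 -> exists2 rho : R, 0 < rho &
  exists2 N : R, 1 <= N &
  forall d, 0 < d -> d <= rho -> d < 1 -> d < nu ->
  exists2 C : R, 0 < C & forall x r M B : R, 0 < x -> 4 * N * x <= d ->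
    0 < r -> r <= x / 2 -> 0 <= M -> 0 <= B ->
    (forall y, `|y - x| <= r -> `|w y - w x| <= M * `|y - x|) ->
    (forall y, x <= y <= d -> w y <= B * (y * ln (1 / y))) ->
    dPhi (w x) * dw x <= x * B * (1 + eta) / pi * ln (1 / x) ^+ 2
      + 5 * M * r + C * (x / r) * w (2 * N * x) + C * x.
Proof.
move=> eta01; have [N N1 [rho rho0 Tmid]] := mixedK_mid eta01.
have /andP[eta0 eta1] := eta01.
exists rho => //; exists N => // d d0 drho d1 dnu.
have [C0 C00 Ttail] := mixedK_tail d0.
have [W wW] := crest_bound cr.
have W0 : 0 <= W by apply: le_trans (wW 0); rewrite normr_ge0.
have N0 : 0 < N by lra.
exists (8 * N / pi + C0 * W).
  by rewrite ltr_wpDr ?divr_gt0 ?mulr_gt0// mulr_ge0// ltW.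
move=> x r M B x0 xd r0 rx M0 B0 wM wB.
have xnu : x < nu by nra.
have hr0 : 0 < r / 2 by rewrite divr_gt0.
have a0 : 0 < 2 * N * x by rewrite !mulr_gt0.
have ad : 2 * N * x <= d by nra.
have x2a : 2 * x <= 2 * N * x by nra.
have anu : 2 * N * x < nu by lra.
have wx0 := crest_ge0 cr x.
have wa0 := crest_ge0 cr (2 * N * x).
have wxa : w x <= w (2 * N * x) by apply: (crest_le cr) => //; lra.
apply: (sym_diff_le hr0 (der_Phi_crest x0 xnu)) => h h0 hr.
rewrite (crest_eq cr x h (w x)).
have Nxh0 : N * (x + h) <= 2 * N * x by nra.
have xhd : x + h <= d / 2 by nra.
have hr2 : 2 * h < r by lra.
pose c1 := 4 * h / (pi * x) * w x + 4 * h / (pi * r) * w (2 * N * x).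
pose c2 := 4 / pi * h * M.
pose c3 := 2 * h * M.
pose c4 := 4 * x * h * (1 + eta) * B / pi.
pose c5 := C0 * (x * h) * W.
have c10 : 0 <= c1.
  by rewrite addr_ge0// mulr_ge0// divr_ge0 ?mulr_ge0// ltW.
have c20 : 0 <= c2 by rewrite !mulr_ge0 ?invr_ge0 ?(ltW P0) ?(ltW h0).
have c30 : 0 <= c3 by rewrite !mulr_ge0// ltW.
have c40 : 0 <= c4 by rewrite divr_ge0 ?(ltW P0)// !mulr_ge0 ?(ltW x0) ?(ltW h0)//; lra.
have c50 : 0 <= c5 by rewrite !mulr_ge0 ?(ltW x0) ?(ltW h0) ?(ltW C00).
have h30 : 0 < 3 * h by rewrite mulr_gt0.
have iT := L1_mixedK_crest cr x h (w x).
pose i1 (y : R) : R := 1 * \1_(`[0, 2 * N * x] : set R) y.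
pose i2 (y : R) : R := 1 * \1_(`[x - r, x + r] : set R) y.
pose s1 (y : R) := spike (3 * h) (y + (- x - h)).
pose s2 (y : R) := spike (3 * h) (y + (- x + h)).
have g1 : L1 i1 := L1_indic_seg 0 (2 * N * x).
have g2 : L1 i2 := L1_indic_seg (x - r) (x + r).
have g3 := L1D (L1_spike_shift (- x - h) h30) (L1_spike_shift (- x + h) h30).
have g4 := L1_log_over d a0.
have [g5 _] := @L1_expo_tail R.
have g12 := L1D (L1Z c1 g1) (L1Z c2 g2).
have i10 y : 0 <= i1 y by rewrite /i1 mul1r indicE.
have i20 y : 0 <= i2 y by rewrite /i2 mul1r indicE.
apply: (le_trans (@posl_le_comb _ [:: x - h; x + h] _ _ _ _ _ 1 c3 c4 c5 iT g12 g3 g4 g5 _)).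
  move=> y y0; rewrite !inE negb_or => /andP[yxl yxr]; rewrite mul1r.
  have wy0 := crest_ge0 cr y.
  have f1 : 0 <= c1 * i1 y by rewrite mulr_ge0.
  have f2 : 0 <= c2 * i2 y by rewrite mulr_ge0.
  have f3 : 0 <= c3 * (s1 y + s2 y) by rewrite mulr_ge0 ?addr_ge0 ?spike_ge0.
  have f4 : 0 <= c4 * log_over (2 * N * x) d y by rewrite mulr_ge0 ?log_over_ge0// ltW.
  have f5 : 0 <= c5 * expo_tail y by rewrite mulr_ge0 ?expo_tail_ge0.
  rewrite -/(s1 y) -/(s2 y).
  have [ya|ay] := leP y (2 * N * x).
    apply: (@le_trans _ _ (c1 * i1 y + c2 * i2 y + c3 * (s1 y + s2 y))); last by lra_from f4 f5.
    have -> : i1 y = 1 by rewrite /i1 indic_in ?mul1r// ltW.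
    rewrite mulr1; apply: mixedK_crest_near_le => //.
    by rewrite (le_trans _ x2a)// ler_peMl ?(ltW x0)// ler1n.
  have xhy : x + h < y by lra_from ay x2a hr2 rx x0.
  have T0 : 0 <= mixedK x h y by apply: mixedK_ge0.
  have Tw : mixedK x h y * (w y - w x) <= mixedK x h y * w y.
    by rewrite ler_wpM2l// gerBl.
  have [yd|dy] := leP y d.
    apply: (@le_trans _ _ (c4 * log_over (2 * N * x) d y)); last by lra_from f1 f2 f3 f5.
    apply: (le_trans Tw).
    have Nxh : N * (x + h) <= y by exact: le_trans Nxh0 (ltW ay).
    have /andP[_ T2] := Tmid x h y x0 h0 Nxh (le_trans yd drho).
    have y1 : x <= y <= d by rewrite yd andbT; lra_from ay x2a x0.
    rewrite /log_over indic_in ?(ltW ay)// mulr1.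
    apply: (le_trans (ler_wpM2l T0 (wB y y1))).
    have L0 : 0 <= B * (y * ln (1 / y)).
      by rewrite mulr_ge0// mulr_ge0 ?(ltW y0)// ln_invE// oppr_ge0 ln_le0// (le_trans yd)// ltW.
    apply: (le_trans (ler_wpM2r L0 T2)).
    rewrite /c4 le_eqVlt; apply/orP; left; apply/eqP.
    by move: (pi : R) P0 => p p0; field; rewrite !gt_eqF.
  apply: (@le_trans _ _ (c5 * expo_tail y)); last by lra_from f1 f2 f3 f4.
  apply: (le_trans Tw).
  have T3 := Ttail x h y x0 h0 xhd (ltW dy).
  rewrite expo_tailE// /c5 [leRHS]mulrAC; apply: ler_pM => //.
  by apply: le_trans (wW y); rewrite ler_norm.
have q1 : posl i1 <= 2 * N * x.
  by have := @posl_indic_seg 0 (2 * N * x) (ltW a0); rewrite subr0.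
have q2 : posl i2 <= 2 * r.
  have := @posl_indic_seg (x - r) (x + r) _; rewrite (_ : x + r - (x - r) = 2 * r); last by ring.
  by apply; lra_from r0.
have q3 : posl (fun y : R => s1 y + s2 y) <= 6 * h.
  rewrite poslD; [|exact: L1_spike_shift..].
  rewrite (_ : 6 * h = 3 * h + 3 * h); last by ring.
  by apply: lerD; exact: posl_spike_shift.
have q5 := @posl_expo_tail R.
rewrite mul1r poslD; [|exact: L1Z..].
rewrite (poslZ c1 g1) (poslZ c2 g2) (posl_log_over a0 ad).
have lnX : ln (1 / (2 * N * x)) <= ln (1 / x).
  rewrite !ln_invE// lerN2 ler_ln ?posrE//; lra_from x2a x0.
have lnNX : 0 <= ln (1 / (2 * N * x)).
  by rewrite ln_invE// oppr_ge0 ln_le0// (le_trans ad)// ltW.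
have q4 : c4 * ((ln (1 / (2 * N * x)) ^+ 2 - ln (1 / d) ^+ 2) / 2) <= c4 * (ln (1 / x) ^+ 2 / 2).
  rewrite ler_wpM2l// ler_pM2r// lerBlDr.
  have : ln (1 / (2 * N * x)) ^+ 2 <= ln (1 / x) ^+ 2.
    by rewrite ler_sqr// nnegrE (le_trans lnNX).
  by have := sqr_ge0 (ln (1 / d)); lra_from.
have r1 := ler_wpM2l c10 q1; have r2 := ler_wpM2l c20 q2.
have r3 := ler_wpM2l c30 q3; have r5 := ler_wpM2l c50 q5.
apply: (@le_trans _ _ (c1 * (2 * N * x) + c2 * (2 * r) + c3 * (6 * h) + c4 * (ln (1 / x) ^+ 2 / 2) + c5 * 1)).
  have r45 := lerD q4 r5; have r12 := lerD r1 r2.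
  have r123 := lerD r12 r3; have := lerD r123 r45.
  by rewrite !addrA.
have -> : c4 * (ln (1 / x) ^+ 2 / 2) = 2 * h * (x * B * (1 + eta) / pi * ln (1 / x) ^+ 2).
  by rewrite /c4; move: (pi : R) P0 => p p0; field; rewrite gt_eqF.
have -> : c5 * 1 = 2 * h * (C0 * W * x / 2) by rewrite /c5; field.
have -> : c3 * (6 * h) = 2 * h * (6 * h * M) by rewrite /c3; ring.
have -> : c2 * (2 * r) = 2 * h * (4 / pi * (M * r)) by rewrite /c2; ring.
have -> : c1 * (2 * N * x) = 2 * h * (4 * N / pi * w x + 4 * N / pi * (x / r) * w (2 * N * x)).
  by rewrite /c1; move: (pi : R) P0 => p p0; field; rewrite !gt_eqF.
rewrite -!mulrDr ler_pM2l ?mulr_gt0//.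
have Mr : 0 <= M * r by rewrite mulr_ge0// ltW.
have v1 : 4 / pi * (M * r) <= 2 * (M * r).
  by rewrite ler_wpM2r// ler_pdivrMr//; have := pi_ge2 R; move: (pi : R) => p; lra_from.
have v2 : 6 * h * M <= 3 * (M * r).
  by have := ler_wpM2l M0 (ltW hr2); lra_from.
have xr : 1 <= x / r by rewrite ler_pdivlMr//; lra_from r0 rx x0.
have Npi : 0 < 4 * N / pi by rewrite divr_gt0// mulr_gt0.
have v3 : 4 * N / pi * w x <= 4 * N / pi * (x / r) * w (2 * N * x).
  rewrite -[leRHS]mulrA ler_pM2l//; apply: (le_trans wxa).
  by rewrite ler_peMl.
have CW : 0 <= C0 * W by rewrite mulr_ge0// ltW.
have v4 : 0 <= C0 * W * (x / r) * w (2 * N * x).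
  by rewrite !mulr_ge0 ?invr_ge0 ?(ltW x0) ?(ltW r0) ?(ltW C00).
have v5 : 0 <= 8 * N / pi * x by rewrite mulr_ge0 ?divr_ge0 ?mulr_ge0 ?(ltW N0) ?(ltW P0) ?(ltW x0).
have v6 : 0 <= C0 * W * x by rewrite mulr_ge0// ltW.
have -> : 5 * M * r = 5 * (M * r) by ring.
have e8 : 8 * N / pi = 2 * (4 * N / pi) by rewrite mulrA; congr (_ / _); ring.
move: v1 v3 v5; rewrite e8; move: (4 / pi) (4 * N / pi) (x * B * (1 + eta) / pi) => p4 p5 E.
move=> v1 v3 v5; lra_from v1 v2 v3 v4 v5 v6.
Qed.

End DerivativeEstimates.

(** * Asymptotics of the slope *)

Section DerivativeAsymptotics.
Context {R : realType}.
Variables (b nu : R) (w dw : R -> R).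
Hypothesis cr : crest b nu w.
Hypothesis wdw : forall x, 0 < x -> x < nu -> is_derive x 1 w (dw x).
Hypothesis dw_cont : forall x, 0 < x -> x < nu -> {for x, continuous dw}.

Let P0 : 0 < pi :> R := pi_gt0 R.
Let b0 : 0 < b := crest_b cr.
Let nu0 : 0 < nu := crest_nu cr.
Let A : R := (b * pi)^-1.
Let Ai : R := b * pi.

Lemma dw_ge0 (x : R) : 0 < x -> x < nu -> 0 <= dw x.
Proof.
move=> x0 xn.
have h0 : 0 < Num.min x (nu - x) by rewrite lt_min x0 subr_gt0.
apply: (sym_diff_ge h0 (wdw x0 xn)) => h hp; rewrite lt_min => /andP[hx hn].
rewrite mulr0 subr_ge0; apply: (crest_le cr); lra.
Qed.

Lemma crest_lipschitz (s r M : R) :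
  (forall xi, `|xi - s| <= r -> [/\ 0 < xi, xi < nu & dw xi <= M]) ->
  forall y, `|y - s| <= r -> `|w y - w s| <= M * `|y - s|.
Proof.
move=> H y yr.
have mv u v : u < v -> (forall xi, u <= xi <= v -> `|xi - s| <= r) -> w v - w u <= M * (v - u).
  move=> uv Huv.
  have d (xi : R) : u <= xi <= v -> is_derive xi 1 w (dw xi).
    by move=> /Huv /H[x0 xn _]; exact: wdw.
  have [c /andP[uc cv] ->] := mean_value uv d.
  have ucv : u <= c <= v by rewrite !ltW.
  by have [_ _ cM] := H c (Huv c ucv); rewrite ler_pM2r// subr_gt0.
have [y0 yn _] := H y yr.
have [s0 sn _] : [/\ 0 < s, s < nu & dw s <= M].
  by apply: H; rewrite subrr normr0; apply: le_trans yr.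
have [ys|sy|->] := ltgtP y s; last by rewrite !subrr !normr0 mulr0.
  rewrite (ltr0_norm (_ : y - s < 0)) ?subr_lt0// opprB distrC ger0_norm.
    apply: mv => // xi /andP[h1 h2]; rewrite ler_norml.
    by move: yr; rewrite ler_norml => /andP[h3 h4]; apply/andP; split; lra.
  by rewrite subr_ge0; apply: (crest_le cr) => //; exact: ltW.
rewrite (gtr0_norm (_ : 0 < y - s)) ?subr_gt0// ger0_norm.
  apply: mv => // xi /andP[h1 h2]; rewrite ler_norml.
  by move: yr; rewrite ler_norml => /andP[h3 h4]; apply/andP; split; lra.
by rewrite subr_ge0; apply: (crest_le cr) => //; exact: ltW.
Qed.

Lemma ln_inv_mono (x y : R) : 0 < x -> x <= y -> ln (1 / y) <= ln (1 / x).
Proof.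
move=> x0 xy; have y0 := lt_le_trans x0 xy.
by rewrite !ln_invE// lerN2 ler_ln.
Qed.

Lemma ln_inv_half (x : R) : 0 < x -> 1 <= ln (1 / x) -> ln (1 / (x / 2)) <= 2 * ln (1 / x).
Proof.
move=> x0 L1; rewrite (mulrC x) ln_invM ?invr_gt0// lnV ?posrE// opprK.
have : ln (1 + 1 : R) <= 1 by apply: le_ln1Dx; lra.
lra.
Qed.

(** The weight vanishes at the ends of [x / 2, 3 x / 2] and equals x / 2 at x; at a maximum s of
    the product, with weight D, the slope is at most twice dw s within D / 2 of s. *)
Let bump (x y : R) := (x / 2 - `|y - x|) * dw y.

Let bump_continuous (x : R) : 0 < x -> 3 / 2 * x < nu ->
  {within `[x / 2, 3 / 2 * x], continuous (bump x)}.
Proof.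
move=> x0 xn; apply: continuous_in_subspaceT => y; rewrite inE/= in_itv/= => /andP[xy yx].
apply: (@continuousM _ _ (fun y => x / 2 - `|y - x|) dw y).
  apply: continuousB; first exact: cvg_cst.
  apply: (@continuous_comp _ _ _ (fun y => y - x) Num.norm).
    by apply: continuousB; [exact: cvg_id|exact: cvg_cst].
  exact: norm_continuous.
by apply: dw_cont; lra.
Qed.

Local Tactic Notation "lra_from" hyp_list(l) := clear - l wdw dw_cont P0 b0 nu0 A Ai bump_continuous; lra.

(** Apply [slope_upper] at the maximum s of the bump with r = D / 2 and M = 2 dw s. The error
    term 5 M r = 5 D dw s is small against the left-hand side, of order s ln (1 / s) dw s, so
    D dw s = O(s ln (1 / s)), and this bounds (x / 2) dw x. *)
Lemma dw_bounded : exists2 C : R, 0 < C &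
  exists2 d : R, 0 < d & forall x, 0 < x -> x < d -> dw x <= C * ln (1 / x).
Proof.
have one01 : 0 < (1 : R) <= 1 by rewrite ltr01 lexx.
have [rho rho0 [N N1 H]] := slope_upper cr wdw one01.
have [B B0 [dB dB0 wB]] := crest_below_log cr.
have [t t0 [dt dt0 wt]] := crest_above_log cr.
have N0 : 0 < N by lra.
pose d := Num.min (Num.min rho (dB / 2)) (Num.min (1 / 2) (nu / 2)).
have d0 : 0 < d by rewrite !lt_min rho0 !divr_gt0.
have drho : d <= rho by rewrite !ge_min lexx.
have dd1 : d <= dB / 2 by rewrite !ge_min lexx orbT.
have dh : d <= 1 / 2 by rewrite !ge_min lexx !orbT.
have dn : d <= nu / 2 by rewrite !ge_min lexx !orbT.
have dl1 : d < 1 by lra.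
have dnu : d < nu by lra.
have {H} [C C0 H] := H d d0 drho dl1 dnu.
have [d2 d20 L2big] := ln_inv_large (1 + 10 * t / b).
pose C1 := 2 * t / b * (2 * B / pi + 4 * N * B * C + C).
have C10 : 0 < C1.
  by rewrite mulr_gt0 ?divr_gt0 ?mulr_gt0// !addr_gt0 ?divr_gt0 ?mulr_gt0.
exists (8 * C1); first by rewrite mulr_gt0.
exists (Num.min (Num.min (d / (6 * N)) (dt / 2)) (d2 / 2)).
  by rewrite !lt_min !divr_gt0// mulr_gt0.
move=> x x0; rewrite !lt_min => /andP[/andP[xd xt] xd2].
have xN : 6 * N * x < d by move: xd; rewrite ltr_pdivlMr ?mulr_gt0// mulrC.
have xd6 : 6 * x <= 6 * N * x by rewrite ler_pM2r//; lra.
have L1 y : 0 < y -> y <= 2 * x -> 1 + 10 * t / b <= ln (1 / y).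
  by move=> y0 yx; apply: L2big => //; lra.
have tb0 : 0 < 10 * t / b by rewrite divr_gt0// mulr_gt0.
have Lx1 : 1 <= ln (1 / x) by have := L1 x x0; lra.
have xI : x / 2 <= 3 / 2 * x by lra.
have xn : 3 / 2 * x < nu by lra.
have [s sI smax] := EVT_max xI (bump_continuous x0 xn).
move: sI; rewrite in_itv/= => /andP[xs sx].
have s0 : 0 < s by lra.
have sn : s < nu by lra.
have := smax x; rewrite in_itv/= /bump => /(_ _).
rewrite subrr normr0 subr0; set D := x / 2 - `|s - x| => bx.
have {}bx : x / 2 * dw x <= D * dw s by apply: bx; apply/andP; split; lra_from x0.
have q0 : 0 <= dw s by exact: dw_ge0.
have sxD : `|s - x| = x / 2 - D by rewrite /D; lra.
have D0 : 0 <= D.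
  by rewrite /D subr_ge0 ler_norml; apply/andP; split; lra_from xs sx.
have Dx : D <= x / 2 by rewrite /D gerBl.
have x20 : 0 < x / 2 by rewrite divr_gt0.
have [D0'|{}D0] : D = 0 \/ 0 < D by move: D0; rewrite le_eqVlt => /predU1P[<-|]; [left|right].
  have : dw x <= 0 by move: bx; rewrite D0' mul0r pmulr_rle0.
  move=> /le_trans; apply; apply: mulr_ge0; last exact: le_trans Lx1.
  by rewrite mulr_ge0// ltW.
have r0 : 0 < D / 2 by rewrite divr_gt0.
have rs : D / 2 <= s / 2 by lra_from xs Dx.
have M0 : 0 <= 2 * dw s by rewrite mulr_ge0.
have wM : forall y, `|y - s| <= D / 2 -> `|w y - w s| <= 2 * dw s * `|y - s|.
  apply: crest_lipschitz => xi xir.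
  have xix : `|xi - x| <= x / 2 - D / 2.
    rewrite (_ : xi - x = (xi - s) + (s - x)); last by ring.
    by apply: (le_trans (ler_normD _ _)); rewrite sxD; lra_from xir.
  have [xi1 xi2] : x / 2 <= xi /\ xi <= 3 / 2 * x.
    move: xix; rewrite ler_norml => /andP[h1 h2].
    by split; lra_from h1 h2 r0.
  have xi0 : 0 < xi by exact: lt_le_trans xi1.
  have xin : xi < nu by exact: le_lt_trans xn.
  split=> //; have := smax xi; rewrite in_itv/= xi1 xi2 /bump => /(_ isT).
  have k : D / 2 * dw xi <= (x / 2 - `|xi - x|) * dw xi.
    by apply: ler_wpM2r; [exact: dw_ge0|lra_from xix].
  move=> /(le_trans k); rewrite -/D => {}k.
  have : D / 2 * dw xi <= D / 2 * (2 * dw s) by lra_from k.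
  by rewrite ler_pM2l.
have sN : 4 * N * s <= d.
  have : 4 * N * s <= 4 * N * (3 / 2 * x) by rewrite ler_pM2l// mulr_gt0.
  by lra_from xN.
have sN2 : 2 * N * s < dB.
  have Ns0 : 0 < N * s by rewrite mulr_gt0.
  by lra_from sN dd1 dB0 Ns0 d0.
have s2x : s <= 2 * x by lra_from sx x0.
have wB' y : s <= y <= d -> w y <= B * (y * ln (1 / y)).
  move=> /andP[sy yd]; apply: wB; first exact: lt_le_trans sy.
  by lra_from yd dd1 dB0.
have := H s (D / 2) (2 * dw s) B s0 sN r0 rs M0 (ltW B0) wM wB'.
have hs : b * w s * dw s <= dPhi b (w s) * dw s.
  by rewrite ler_wpM2r// /dPhi lerDl mulr_ge0 ?sqr_ge0.
move=> /(le_trans hs) {hs}.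
have wsL : s * ln (1 / s) / t <= w s.
  rewrite ler_pdivrMr// [w s * t]mulrC; apply: wt => //.
  by lra_from xt sx x0.
have Ls := L1 s s0 s2x.
have lnNs : ln (1 / (2 * N * s)) <= ln (1 / s).
  apply: ln_inv_mono => //; rewrite ler_peMl ?(ltW s0)//.
  by lra_from N1.
have wNs : w (2 * N * s) <= B * (2 * N * s * ln (1 / s)).
  apply: (le_trans (wB _ _ sN2)); first by rewrite !mulr_gt0.
  by rewrite ler_pM2l// ler_pM2l// !mulr_gt0.
have Lsx : ln (1 / s) <= 2 * ln (1 / x).
  by apply: le_trans (ln_inv_half x0 Lx1); exact: ln_inv_mono.
have Lxp : 0 < ln (1 / x) by exact: lt_le_trans Lx1.
set L := ln (1 / s) in Ls wsL wNs Lsx *; set q := dw s in q0 bx *; move=> HH.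
have Lp : 1 <= L by lra_from Ls tb0.
have L0 : 0 < L by exact: lt_le_trans Lp.
have Ds : D <= s by lra_from Dx xs.
have sL0 : 0 < s * L by rewrite mulr_gt0.
have K1 : b / t * (s * L) * q <= s * B * 2 / pi * L ^+ 2 + 5 * D * q + C * (s / (D / 2)) * (B * (2 * N * s * L)) + C * s.
  have e1 : b / t * (s * L) * q <= b * w s * q.
    have -> : b / t * (s * L) * q = b * (s * L / t) * q by ring.
    by rewrite ler_wpM2r// ler_pM2l.
  apply: (le_trans e1); apply: (le_trans HH).
  have e2 : C * (s / (D / 2)) * w (2 * N * s) <= C * (s / (D / 2)) * (B * (2 * N * s * L)).
    by rewrite ler_wpM2l// mulr_ge0 ?(ltW C0)// divr_ge0 ?ltW.
  move: e2; move: (C * (s / (D / 2)) * w (2 * N * s)) (C * (s / (D / 2)) * (B * (2 * N * s * L))) => u v e2.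
  by move: (s * B) (pi^-1 : R) => sB ip; lra_from e2.
(* Multiplying by D removes the division by D and gives a closed inequality for D * q. *)
have K2 : b / t * (s * L) * (D * q) <= s * B * 2 / pi * L ^+ 2 * D + 5 * D * (D * q) + C * s * 2 * (B * (2 * N * s * L)) + C * s * D.
  have := ler_wpM2l (ltW D0) K1.
  have -> : D * (b / t * (s * L) * q) = b / t * (s * L) * (D * q) by ring.
  move=> /le_trans; apply; rewrite le_eqVlt; apply/orP; left; apply/eqP.
  by move: (pi : R) P0 => p p0; field; rewrite !gt_eqF.
set Q := D * q in K2 bx.
have Q0 : 0 <= Q by rewrite mulr_ge0// ltW.
(* As L >= 10 t / b, half of the left-hand side absorbs the error term. *)
have K3 : 5 * D * Q <= b / (2 * t) * (s * L) * Q.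
  apply: ler_wpM2r => //; apply: (@le_trans _ _ (5 * s)); first by rewrite ler_pM2l.
  have : 10 * t / b <= L by lra_from Ls.
  rewrite ler_pdivrMr// => K.
  have -> : b / (2 * t) * (s * L) = s * (L * b / (2 * t)) by field; rewrite gt_eqF.
  rewrite [leLHS]mulrC ler_pM2l// ler_pdivlMr ?mulr_gt0//.
  by lra_from K.
have K4 : b / (2 * t) * (s * L) * Q <= (2 * B / pi + 4 * N * B * C + C) * (s * L) * (s * L).
  have e0 : b / t * (s * L) * Q = b / (2 * t) * (s * L) * Q + b / (2 * t) * (s * L) * Q.
    by field; rewrite gt_eqF.
  have c1 : s * B * 2 / pi * L ^+ 2 * D <= 2 * B / pi * (s * L) * (s * L).
    have -> : 2 * B / pi * (s * L) * (s * L) = s * B * 2 / pi * L ^+ 2 * s by ring.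
    by rewrite ler_wpM2l// mulr_ge0 ?sqr_ge0// divr_ge0 ?(ltW P0)// !mulr_ge0 ?(ltW s0)// ltW.
  have s20 : 0 <= s * s by rewrite mulr_ge0 ?ltW.
  have LL : 1 <= L * L by rewrite -[leLHS]mulr1 ler_pM.
  have L2 : L <= L * L by rewrite -[leLHS]mul1r ler_pM2r.
  have c2 : C * s * 2 * (B * (2 * N * s * L)) <= 4 * N * B * C * (s * L) * (s * L).
    have -> : C * s * 2 * (B * (2 * N * s * L)) = 4 * N * B * C * (s * s) * L by ring.
    have -> : 4 * N * B * C * (s * L) * (s * L) = 4 * N * B * C * (s * s) * (L * L) by ring.
    by rewrite ler_wpM2l// !mulr_ge0 ?(ltW N0) ?(ltW B0) ?(ltW C0) ?(ltW s0).
  have c3 : C * s * D <= C * (s * L) * (s * L).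
    have -> : C * (s * L) * (s * L) = C * s * (s * (L * L)) by ring.
    rewrite ler_wpM2l ?mulr_ge0 ?(ltW C0) ?(ltW s0)// (le_trans Ds)// ler_peMr// ltW//.
  move: c1 K2; rewrite e0.
  move: (2 * B / pi) (s * B * 2 / pi * L ^+ 2 * D) => u1 u2 c1 K2.
  by lra_from c1 c2 c3 K2 K3.
have K5 : Q <= C1 * (s * L).
  rewrite -(ler_pM2l sL0); rewrite [s * L * Q]mulrC.
  have b2t : 0 < b / (2 * t) by rewrite divr_gt0// mulr_gt0.
  rewrite -(ler_pM2l b2t); apply: le_trans (le_trans _ K4) _.
    by rewrite le_eqVlt; apply/orP; left; apply/eqP; ring.
  rewrite /C1 le_eqVlt; apply/orP; left; apply/eqP.
  by move: (pi : R) P0 => p p0; field; rewrite !gt_eqF.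
have K6 : C1 * (s * L) <= C1 * (2 * x * (2 * ln (1 / x))).
  by rewrite ler_pM2l//; apply: ler_pM => //; exact: ltW.
have := le_trans bx (le_trans K5 K6).
have -> : C1 * (2 * x * (2 * ln (1 / x))) = x / 2 * (8 * C1 * ln (1 / x)) by field.
by rewrite ler_pM2l.
Qed.

(** With r = x / 2 and M = O(ln (1 / x)) from [dw_bounded], all error terms of [slope_upper]
    are O(x ln (1 / x)), against a main term of order x ln (1 / x) ^ 2; dividing by the lower
    bound of w x leaves A ln (1 / x) up to a factor (1 + sg)^3. *)
Lemma dw_upper (e : R) : 0 < e ->
  exists2 d : R, 0 < d & forall x, 0 < x -> x < d -> dw x <= (A + e) * ln (1 / x).
Proof.
move=> e0.
have A0 : 0 < A by rewrite invr_gt0 mulr_gt0.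
pose sg := Num.min 1 (e / (14 * A)).
have sg0 : 0 < sg by rewrite lt_min ltr01 divr_gt0// mulr_gt0.
have sg1 : sg <= 1 by rewrite ge_min lexx.
have sge : 7 * A * sg <= e / 2.
  have : sg <= e / (14 * A) by rewrite ge_min lexx orbT.
  by rewrite ler_pdivlMr ?mulr_gt0//; lra_from.
have sg01 : 0 < sg <= 1 by rewrite sg0.
have [B [B0 BE [dB dB0 wB]]] : exists B, [/\ 0 < B, B = A * (1 + sg) & below_log w B].
  exists (A + A * sg); split; [by rewrite addr_gt0// mulr_gt0|by ring|].
  by apply: crest_upper_asymptotics cr _ _; rewrite mulr_gt0.
have [t [t0 tE [dt dt0 wt]]] : exists t, [/\ 0 < t, t = b * pi * (1 + sg) & above_log w t].
  exists (b * pi + b * pi * sg); split; [by rewrite addr_gt0 ?mulr_gt0|by ring|].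
  by apply: crest_lower_asymptotics cr _ _; rewrite !mulr_gt0.
have [Cd Cd0 [dd dd0 dwC]] := dw_bounded.
have [rho rho0 [N N1 H]] := slope_upper cr wdw sg01.
have N0 : 0 < N by exact: lt_le_trans N1.
pose d := Num.min (Num.min rho (dB / 2)) (Num.min (1 / 2) (nu / 2)).
have d0 : 0 < d by rewrite !lt_min rho0 !divr_gt0.
have drho : d <= rho by rewrite !ge_min lexx.
have dd1 : d <= dB / 2 by rewrite !ge_min lexx orbT.
have dh : d <= 1 / 2 by rewrite !ge_min lexx !orbT.
have dn : d <= nu / 2 by rewrite !ge_min lexx !orbT.
have dl1 : d < 1 by lra_from dh.
have dnu : d < nu by lra_from dn d0.
have {H} [C C0 H] := H d d0 drho dl1 dnu.
pose C2 := 5 * Cd + 4 * N * B * C + C.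
have C20 : 0 < C2 by rewrite !addr_gt0 ?mulr_gt0.
have [d2 d20 L2big] := ln_inv_large (1 + 2 * (t / b * C2) / e).
exists (Num.min (Num.min (d / (4 * N)) dt) (Num.min d2 (dd / 2))).
  by rewrite !lt_min d20 dt0 !divr_gt0// mulr_gt0.
move=> x x0; rewrite !lt_min => /andP[/andP[xdN xt] /andP[xd2 xdd]].
have xN : 4 * N * x <= d.
  by move: xdN; rewrite ltr_pdivlMr ?mulr_gt0// mulrC => /ltW.
have Nx0 : 0 < N * x by rewrite mulr_gt0.
have Nx1 : x <= N * x by rewrite ler_peMl// ltW.
have := L2big x x0 (ltW xd2) => hL.
have tbC : 0 <= 2 * (t / b * C2) / e.
  by rewrite divr_ge0 ?(ltW e0)// mulr_ge0// mulr_ge0 ?(ltW C20)// divr_ge0// ltW.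
have L1 : 1 <= ln (1 / x) by lra_from hL tbC.
have r0 : 0 < x / 2 by rewrite divr_gt0.
have Lhalf := ln_inv_half x0 L1.
have wM : forall y, `|y - x| <= x / 2 -> `|w y - w x| <= 2 * Cd * ln (1 / x) * `|y - x|.
  apply: crest_lipschitz => xi; rewrite ler_norml => /andP[h1 h2].
  have [xi1 xi2] : x / 2 <= xi /\ xi <= 3 / 2 * x.
    by split; lra_from h1 h2.
  have xi0 : 0 < xi by exact: lt_le_trans xi1.
  split=> //; first by lra_from xi2 xN dnu Nx1 x0.
  have xidd : xi < dd by lra_from xi2 xdd x0.
  apply: (le_trans (dwC xi xi0 xidd)); rewrite (mulrC 2) -mulrA ler_pM2l//.
  by apply: le_trans Lhalf; exact: ln_inv_mono.
have wB' y : x <= y <= d -> w y <= B * (y * ln (1 / y)).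
  move=> /andP[xy yd]; apply: wB; first exact: lt_le_trans xy.
  by lra_from yd dd1 dB0.
have Lp : 0 < ln (1 / x) by exact: lt_le_trans L1.
have M0 : 0 <= 2 * Cd * ln (1 / x) by rewrite !mulr_ge0// ltW.
have xnu : x < nu by lra_from Nx1 xN dnu Nx0.
have q0 : 0 <= dw x by exact: dw_ge0.
have := H x (x / 2) (2 * Cd * ln (1 / x)) B x0 xN r0 (lexx _) M0 (ltW B0) wM wB'.
have hs : b * w x * dw x <= dPhi b (w x) * dw x.
  by rewrite ler_wpM2r// /dPhi lerDl mulr_ge0 ?sqr_ge0.
move=> /(le_trans hs) {hs}.
have wsL : x * ln (1 / x) / t <= w x.
  by rewrite ler_pdivrMr// [w x * t]mulrC; exact: wt.
have lnNs : ln (1 / (2 * N * x)) <= ln (1 / x).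
  by apply: ln_inv_mono => //; lra_from Nx1 x0.
have sN2 : 2 * N * x < dB by lra_from xN dd1 dB0 Nx0.
have wNs : w (2 * N * x) <= B * (2 * N * x * ln (1 / x)).
  apply: (le_trans (wB _ _ sN2)); first by rewrite !mulr_gt0.
  by rewrite ler_pM2l// ler_pM2l// !mulr_gt0.
set L := ln (1 / x) in hL L1 Lhalf Lp M0 wsL lnNs wNs wM *; set q := dw x in q0 *; move=> HH.
have xL0 : 0 < x * L by rewrite mulr_gt0.
have K1 : b / t * q <= B * (1 + sg) / pi * L + C2.
  rewrite -(ler_pM2l xL0).
  have e1 : x * L * (b / t * q) <= b * w x * q.
    have -> : x * L * (b / t * q) = b * (x * L / t) * q by ring.
    by rewrite ler_wpM2r// ler_pM2l.
  apply: (le_trans e1); apply: (le_trans HH).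
  have -> : x / (x / 2) = 2 by field; rewrite gt_eqF.
  have e2 : C * 2 * w (2 * N * x) <= C * 2 * (B * (2 * N * x * L)).
    by rewrite ler_wpM2l// mulr_ge0 ?(ltW C0).
  have e3 : C * x <= C * (x * L) by rewrite ler_pM2l// ler_peMr// ltW.
  rewrite /C2; move: e2; move: (w (2 * N * x)) (pi^-1 : R) => u v e2.
  by lra_from e2 e3.
have K2 : q <= t / b * (B * (1 + sg) / pi * L + C2).
  rewrite mulrAC ler_pdivlMr// mulrC -ler_pdivrMl// mulrA [t^-1 * b]mulrC.
  exact: K1.
have tbB : t / b * (B * (1 + sg) / pi) = A * (1 + sg) ^+ 3.
  by rewrite tE BE; move: (pi : R) P0 => p p0; field; rewrite !gt_eqF.
have cube : A * (1 + sg) ^+ 3 <= A + e / 2.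
  have s2 : sg ^+ 2 <= sg by rewrite expr2 ler_piMr// ltW.
  have s3 : sg ^+ 3 <= sg by rewrite exprS (le_trans _ s2)// expr2 ler_pM2l.
  apply: (@le_trans _ _ (A * (1 + 7 * sg))).
    by rewrite ler_pM2l//; lra_from s2 s3.
  by lra_from sge.
apply: (le_trans K2); rewrite mulrDr mulrA tbB.
have K3 : t / b * C2 <= e / 2 * L.
  have : 2 * (t / b * C2) / e <= L by lra_from hL.
  by rewrite ler_pdivrMr//; lra_from.
have K4 := ler_wpM2r (ltW Lp) cube.
by lra_from K3 K4.
Qed.

(** In [slope_lower] the error term is O(w (2 x)), of lower order than x ln (1 / x) ^ 2;
    dividing by the upper bound of dPhi b (w x) leaves A ln (1 / x) up to the factor
    (1 - sg) / (1 + sg)^3. *)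
Lemma dw_lower (e : R) : 0 < e ->
  exists2 d : R, 0 < d & forall x, 0 < x -> x < d -> (A - e) * ln (1 / x) <= dw x.
Proof.
move=> e0.
have A0 : 0 < A by rewrite invr_gt0 mulr_gt0.
pose sg := Num.min 1 (e / (8 * A)).
have sg0 : 0 < sg by rewrite lt_min ltr01 divr_gt0// mulr_gt0.
have sg1 : sg <= 1 by rewrite ge_min lexx.
have sge : 4 * A * sg <= e / 2.
  have : sg <= e / (8 * A) by rewrite ge_min lexx orbT.
  by rewrite ler_pdivlMr ?mulr_gt0//; lra_from.
have sg01 : 0 < sg <= 1 by rewrite sg0.
have [B [B0 BE [dB dB0 wB]]] : exists B, [/\ 0 < B, B = A * (1 + sg) & below_log w B].
  exists (A + A * sg); split; [by rewrite addr_gt0// mulr_gt0|by ring|].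
  by apply: crest_upper_asymptotics cr _ _; rewrite mulr_gt0.
have [t [t0 tE [dt dt0 wt]]] : exists t, [/\ 0 < t, t = b * pi * (1 + sg) & above_log w t].
  exists (b * pi + b * pi * sg); split; [by rewrite addr_gt0 ?mulr_gt0|by ring|].
  by apply: crest_lower_asymptotics cr _ _; rewrite !mulr_gt0.
have [rho rho0 [N N1 H]] := slope_lower cr wdw sg01.
have N0 : 0 < N by exact: lt_le_trans N1.
pose d := Num.min (Num.min rho (dt / 2)) (Num.min (1 / 2) (nu / 2)).
have d0 : 0 < d by rewrite !lt_min rho0 !divr_gt0.
have drho : d <= rho by rewrite !ge_min lexx.
have dd1 : d <= dt / 2 by rewrite !ge_min lexx orbT.
have dh : d <= 1 / 2 by rewrite !ge_min lexx !orbT.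
have dn : d <= nu / 2 by rewrite !ge_min lexx !orbT.
have dl1 : d < 1 by lra_from dh.
have dnu : d < nu by lra_from dn d0.
have {H} [C C0 H] := H d d0 drho dl1 dnu.
set l := ln (1 / d) in H.
pose kap := (1 - sg) / (t * pi).
have kap0 : 0 <= kap by rewrite divr_ge0 ?subr_ge0// ltW// mulr_gt0.
pose C3 := 2 * ln (2 * N) + l ^+ 2.
have l2N : 0 <= ln (2 * N) by rewrite ln_ge0//; lra_from N1.
have C30 : 0 <= C3 by apply: addr_ge0; [exact: mulr_ge0|exact: sqr_ge0].
pose g := (1 + sg) ^+ 2 / pi.
have g0 : 0 < g by rewrite divr_gt0// exprn_gt0// addr_gt0.
pose C5 := (kap * C3 + 2 * C * B) / g.
have C50 : 0 <= C5.
  apply: divr_ge0; last exact: ltW.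
  apply: addr_ge0; first exact: mulr_ge0.
  by rewrite -mulrA; apply: mulr_ge0 => //; exact/ltW/mulr_gt0.
have [d2 d20 L2big] := ln_inv_large (1 + 2 * C5 / e).
have bs0 : 0 < 2 / 3 * (b * sg) by rewrite !mulr_gt0.
have [ds ds0 wsmall] := crest_small cr bs0.
exists (Num.min (Num.min (d / (4 * N)) (dB / 2)) (Num.min d2 ds)).
  by rewrite !lt_min d20 ds0 !divr_gt0// mulr_gt0.
move=> x x0; rewrite !lt_min => /andP[/andP[xdN xB] /andP[xd2 xds]].
have xN : 4 * N * x <= d.
  by move: xdN; rewrite ltr_pdivlMr ?mulr_gt0// mulrC => /ltW.
have Nx0 : 0 < N * x by rewrite mulr_gt0.
have Nx1 : x <= N * x by rewrite ler_peMl// ltW.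
have xnu : x < nu by lra_from Nx1 xN dnu Nx0.
have := L2big x x0 (ltW xd2) => hL.
have Ce0 : 0 <= 2 * C5 / e.
  by apply: divr_ge0; [exact: mulr_ge0|exact: ltW].
have L1 : 1 <= ln (1 / x) by lra_from hL Ce0.
have Lp : 0 < ln (1 / x) by exact: lt_le_trans L1.
have tV0 : 0 <= t^-1 by rewrite invr_ge0 ltW.
have wt' y : x <= y <= d -> t^-1 * (y * ln (1 / y)) <= w y.
  move=> /andP[xy yd]; rewrite ler_pdivrMl//; apply: wt; first exact: lt_le_trans xy.
  by lra_from yd dd1 dt0.
have := H x t^-1 x0 xN tV0 wt'.
have q0 : 0 <= dw x by exact: dw_ge0.
have wx0 := crest_ge0 cr x.
have wxB : w x <= B * (x * ln (1 / x)).
  by apply: wB => //; lra_from xB dB0.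
have w2x : w (2 * x) <= B * (2 * x * ln (1 / x)).
  have x2 : 2 * x < dB by lra_from xB.
  have x20 : 0 < 2 * x by rewrite mulr_gt0.
  apply: (le_trans (wB _ x20 x2)); rewrite ler_pM2l// ler_pM2l//.
  by apply: ln_inv_mono => //; lra_from x0.
have hd : dPhi b (w x) * dw x <= B * (x * ln (1 / x)) * (b * (1 + sg)) * dw x.
  rewrite ler_wpM2r//.
  have -> : dPhi b (w x) = w x * (b + 3 / 2 * w x) by rewrite /dPhi; ring.
  apply: ler_pM => //.
    by rewrite addr_ge0 ?(ltW b0)// mulr_ge0.
  by have := wsmall x x0 xds; lra_from.
move=> h; have {h hd} := le_trans h hd.
rewrite ln_invM ?mulr_gt0//.
set L := ln (1 / x) in hL L1 Lp wxB w2x *; set q := dw x in q0 *.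
have BbE : B * (b * (1 + sg)) = g.
  by rewrite /g BE /A; move: (pi : R) P0 => p p0; field; rewrite !gt_eqF.
have -> : B * (x * L) * (b * (1 + sg)) * q = x * L * (g * q) by rewrite -BbE; ring.
have -> : x * t^-1 * (1 - sg) / pi = x * kap by rewrite /kap invfM; ring.
move=> HH; have xL0 : 0 < x * L by rewrite mulr_gt0.
have K1 : kap * (L - C3) - 2 * C * B <= g * q.
  rewrite -(ler_pM2l xL0); apply: le_trans HH.
  have z1 : L ^+ 2 - C3 * L <= (L - ln (2 * N)) ^+ 2 - l ^+ 2.
    have u1 := sqr_ge0 (ln (2 * N)); have u2 := ler_wpM2l (sqr_ge0 l) L1.
    by rewrite /C3; lra_from u1 u2.
  have z2 := ler_wpM2l (mulr_ge0 (ltW x0) kap0) z1.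
  have z3 := ler_wpM2l (ltW C0) w2x.
  by lra_from z2 z3.
have K2 : kap / g * L - C5 <= q.
  rewrite -(ler_pM2l g0); apply: le_trans K1.
  rewrite /C5 le_eqVlt; apply/orP; left; apply/eqP.
  by field; rewrite gt_eqF.
have kg : kap / g = A * ((1 - sg) / (1 + sg) ^+ 3).
  have s1 : 0 < 1 + sg by rewrite addr_gt0.
  by rewrite /kap /g tE /A; move: (pi : R) P0 => p p0; field; rewrite !gt_eqF.
have cube : A - e / 2 <= kap / g.
  rewrite kg; apply: (@le_trans _ _ (A * (1 - 4 * sg))).
    by lra_from sge.
  rewrite ler_pM2l// ler_pdivlMr ?exprn_gt0 ?addr_gt0//.
  have s2 : 0 <= sg ^+ 2 by exact: sqr_ge0.
  have s3 : 0 <= sg ^+ 3 by rewrite exprn_ge0// ltW.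
  have s4 : 0 <= sg ^+ 4 by rewrite exprn_ge0// ltW.
  by lra_from s2 s3 s4 sg0.
apply: le_trans K2.
have K3 : C5 <= e / 2 * L.
  have : 2 * C5 / e <= L by lra_from hL.
  by rewrite ler_pdivrMr//; lra_from.
have K4 := ler_wpM2r (ltW Lp) cube.
by move: (kap / g) K4 => u K4; lra_from K3 K4.
Qed.

End DerivativeAsymptotics.

(** * From crest profiles to the solution *)

Section CrestLimits.
Context {R : realType}.
Variables (b nu : R) (w dw : R -> R).
Hypothesis cr : crest b nu w.
Hypothesis wdw : forall x, 0 < x -> x < nu -> is_derive x 1 w (dw x).
Hypothesis dw_cont : forall x, 0 < x -> x < nu -> {for x, continuous dw}.

Lemma cvg_at_right0 (f : R -> R) (l : R) :
  (forall e : R, 0 < e -> exists2 d : R, 0 < d &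
    forall x, 0 < x -> x < d -> l - e <= f x <= l + e) ->
  f x @[x --> 0^'+] --> l.
Proof.
move=> H; apply/cvgrPdist_le => e e0; have [d d0 fd] := H e e0.
near=> x; rewrite distrC ler_distl; apply: fd; first by near: x; exact: nbhs_right_gt.
by near: x; exact: nbhs_right_lt.
Unshelve. all: by end_near. Qed.

Lemma crest_ratio_cvg : w x / (x * ln (1 / x)) @[x --> 0^'+] --> (b * pi)^-1.
Proof.
have b0 := crest_b cr; have P0 := pi_gt0 R.
have Ai0 : 0 < b * pi by rewrite mulr_gt0.
apply: cvg_at_right0 => e e0.
have [d1 d10 wu] := crest_upper_asymptotics cr e0.
have t0 : 0 < e * (b * pi) ^+ 2 by rewrite mulr_gt0// exprn_gt0.
have [d2 d20 wl] := crest_lower_asymptotics cr t0.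
exists (Num.min 1 (Num.min d1 d2)); first by rewrite !lt_min ltr01 d10.
move=> x x0; rewrite !lt_min => /and3P[x1 xd1 xd2].
have xl : 0 < x * ln (1 / x) by rewrite mulr_gt0// ln_inv_gt0.
rewrite ler_pdivrMr// wu// andbT ler_pdivlMr//.
set i := b * pi in Ai0 t0 wl *.
have k := wl x x0 xd2.
have [ie|ie] := leP (i^-1 - e) 0.
  by apply: le_trans (crest_ge0 cr x); rewrite mulr_le0_ge0// ltW.
apply: (@le_trans _ _ ((i^-1 - e) * ((i + e * i ^+ 2) * w x))).
  by rewrite ler_wpM2l// ltW.
rewrite mulrA ler_piMl ?(crest_ge0 cr)// -subr_ge0.
rewrite (_ : _ - _ = (e * i) ^+ 2) ?sqr_ge0//.
by field; rewrite gt_eqF.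
Qed.

Lemma crest_slope_cvg : dw x / ln (1 / x) @[x --> 0^'+] --> (b * pi)^-1.
Proof.
apply: cvg_at_right0 => e e0.
have [d1 d10 wu] := dw_upper cr wdw dw_cont e0.
have [d2 d20 wl] := dw_lower cr wdw e0.
exists (Num.min 1 (Num.min d1 d2)); first by rewrite !lt_min ltr01 d10.
move=> x x0; rewrite !lt_min => /and3P[x1 xd1 xd2].
have l0 := ln_inv_gt0 x0 x1.
by rewrite ler_pdivrMr// wu// andbT ler_pdivlMr// wl.
Qed.

Lemma crest_cvg0 : w x @[x --> 0^'+] --> (0 : R).
Proof.
have h : w x @[x --> (0 : R)] --> w 0 := @crest_cont _ _ _ _ cr 0.
by rewrite (crest_0 cr) in h; exact: cvg_at_right_filter.
Qed.

End CrestLimits.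

(** The value (1 - r) c with r^2 = 1 / 3 is a critical point of u (c - u) (c - u / 2), so the
    linear term is absent. *)
Lemma Phi_complement (R : realType) (c u r : R) : r ^+ 2 = 1 / 3 ->
  Phi (3 * r * c) ((1 - r) * c - u) =
    (1 - r) * c * (c - (1 - r) * c) * (c - (1 - r) * c / 2) - u * (c - u) * (c - u / 2).
Proof.
move=> r2; apply/eqP; rewrite -subr_eq0.
rewrite (_ : _ - _ = - (3 / 2) * c ^+ 2 * (r ^+ 2 - 1 / 3) * ((1 - r) * c - u)).
  by rewrite r2 subrr mulr0 mul0r.
by rewrite /Phi; field.
Qed.

Lemma crest_of_solution (R : realType) (c r nu : R) (v : R -> R) :
  0 < c -> 0 < r -> r ^+ 2 = 1 / 3 -> bounded_fun v -> continuous v ->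
  (forall x : R, convolution K_B v x = v x * (c - v x) * (c - v x / 2)) ->
  (forall x : R, v x <= (1 - r) * c) -> (forall x : R, v (- x) = v x) ->
  v 0 = (1 - r) * c -> 0 < nu ->
  {in `]0, nu[ &, {homo v : x y /~ x < y}} ->
  crest (3 * r * c) nu (fun y => (1 - r) * c - v y).
Proof.
move=> c0 r0 r2 vb vc vs vl ve v0 nu0 vd; set a := (1 - r) * c.
have [M vM] : exists M, forall y, `|v y| <= M.
  have [M [_ hM]] := vb; exists (M + 1) => y; apply: hM => //.
  by rewrite ltrDl.
have mv : measurable_fun setT v by exact: continuous_measurable_fun.
split.
- by rewrite !mulr_gt0.
- by [].
- by move=> y; apply: (@continuousB _ _ _ (cst a) v y); [exact: cvg_cst|exact: vc].
- exists (`|a| + M) => y; by rewrite (le_trans (ler_normB _ _))// lerD2l.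
- by rewrite v0 subrr.
- by move=> y; rewrite subr_ge0.
- move=> x y x0 xy yn; rewrite ltrD2l ltrN2; apply: vd => //.
    by rewrite in_itv/= (lt_trans x0).
  by rewrite in_itv/= x0 (lt_trans xy).
- move=> x h alpha.
  have e1 := @convolution_mixed_difference R v M x h mv vM ve.
  rewrite !Phi_complement// -!vs -/a.
  have iT := @L1_mixedK R x h; have iTv := L1M_bounded iT mv vM.
  rewrite (_ : (fun y => mixedK x h y * (a - v y - alpha)) =
      (fun y => (a - alpha) * mixedK x h y + (-1) * (mixedK x h y * v y))); last first.
    by apply/funext => y; ring.
  rewrite poslD; [|exact: L1Z..].
  rewrite (poslZ (a - alpha) iT) (poslZ (-1) iTv) posl_mixedK mulr0 add0r -e1.
  by move: (convolution _ _ (x + h)) (convolution _ _ (x - h)) => p q; ring.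
Qed.

Theorem corollary4p5 (R : realType) (c : R) (v phi : R -> R) (nu : R)
  (c_gt0 : 0 < c)
  (v_bounded : bounded_fun v)
  (v_continuous : continuous v)
  (v_solution : forall x : R,
     convolution K_B v x = v x * (c - v x) * (c - v x / 2))
  (v_le : forall x : R, v x <= (1 - 1 / Num.sqrt 3) * c)
  (v_even : forall x : R, v (- x) = v x)
  (v_crest : v 0 = (1 - 1 / Num.sqrt 3) * c)
  (nu_gt0 : 0 < nu)
  (v_smooth : smooth_on `]0, nu[ v)
  (v_decreasing : {in `]0, nu[ &, {homo v : x y /~ x < y}})
  (phi_def : phi = fun x : R => c * v x - v x ^+ 2 / 2) :
  [/\ exists2 o : R -> R, o x @[x --> 0^'+] --> 0 &
        \forall x \near 0^'+, v x = (1 - 1 / Num.sqrt 3) * c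
          - (1 / (Num.sqrt 3 * pi * c) + o x) * (x * ln (1 / x)),
      exists2 o : R -> R, o x @[x --> 0^'+] --> 0 &
        \forall x \near 0^'+, phi x = c ^+ 2 / 3
          - (1 / (3 * pi) + o x) * (x * ln (1 / x)),
      exists2 o : R -> R, o x @[x --> 0^'+] --> 0 &
        \forall x \near 0^'+, derive1 v x =
          - (1 / (Num.sqrt 3 * pi * c) + o x) * ln (1 / x) &
      exists2 o : R -> R, o x @[x --> 0^'+] --> 0 &
        \forall x \near 0^'+, derive1 phi x =
          - (1 / (3 * pi) + o x) * ln (1 / x)].
Proof.
have P0 := pi_gt0 R.
have s30 : 0 < Num.sqrt (3 : R) by rewrite sqrtr_gt0.
have [r rE] : exists r : R, r = 1 / Num.sqrt 3 by eexists.
have r0 : 0 < r by rewrite rE divr_gt0.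
have r2 : r ^+ 2 = 1 / 3 by rewrite rE expr_div_n expr1n sqr_sqrtr.
have s3E : Num.sqrt 3 = r^-1 by rewrite rE div1r invrK.
rewrite -rE in v_le v_crest *; rewrite s3E.
have cr := crest_of_solution c_gt0 r0 r2 v_bounded v_continuous v_solution v_le
  v_even v_crest nu_gt0 v_decreasing.
pose w y := (1 - r) * c - v y; pose dw y := - derive1 v y.
have dv (x : R) : 0 < x -> x < nu -> is_derive x 1 v (derive1 v x).
  move=> x0 xn; rewrite derive1E; apply: DeriveDef => //.
  by apply: (v_smooth 0%N); rewrite /= in_itv/= x0.
have wdw (x : R) : 0 < x -> x < nu -> is_derive x 1 w (dw x).
  move=> x0 xn; have d := derB (is_derive_cst ((1 - r) * c) x (1 : R)) (dv x x0 xn).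
  by apply: (is_derive_eq d); rewrite sub0r.
have dw_cont (x : R) : 0 < x -> x < nu -> {for x, continuous dw}.
  move=> x0 xn; apply: continuousN.
  apply/differentiable_continuous/derivable1_diffP.
  by apply: (v_smooth 1%N); rewrite /= in_itv/= x0.
have ratio := crest_ratio_cvg cr; have slope := crest_slope_cvg cr wdw dw_cont.
have w0 := crest_cvg0 cr; rewrite -/w in ratio w0.
set A : R := (3 * r * c * pi)^-1 in ratio slope.
have AE : 1 / (r^-1 * pi * c) = A.
  have r3 : r^-1 = 3 * r.
    by apply: (@mulfI _ r); rewrite ?gt_eqF// divff ?gt_eqF// mulrCA -expr2 r2; field.
  by rewrite /A r3 div1r; congr (_^-1); ring.
have ArE : r * c * A = 1 / (3 * pi).
  by rewrite /A; move: (pi : R) P0 => p p0; field; rewrite !gt_eqF.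
have near01 : \forall x \near (0 : R)^'+, [/\ 0 < x, x < nu & 0 < ln (1 / x)].
  have m0 : 0 < Num.min nu 1 by rewrite lt_min nu_gt0 ltr01.
  apply: filterS2 (nbhs_right_gt 0) (nbhs_right_lt m0) => x x0.
  by rewrite lt_min => /andP[xn x1]; split=> //; exact: ln_inv_gt0.
(* As phi = c^2 / 3 - r c w - w^2 / 2, this is (c^2 / 3 - phi) / (x ln (1 / x)) - 1 / (3 pi). *)
have limr : r * c * (w x / (x * ln (1 / x))) + w x / (x * ln (1 / x)) * w x / 2 - 1 / (3 * pi)
    @[x --> 0^'+] --> (0 : R).
  rewrite [X in _ --> X](_ : _ = r * c * A + A * 0 / 2 - 1 / (3 * pi)); last first.
    by rewrite ArE mulr0 mul0r addr0 subrr.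
  apply: cvgB; last exact: cvg_cst.
  apply: cvgD; first by apply: cvgM => //; exact: cvg_cst.
  by apply: cvgM; [exact: cvgM|exact: cvg_cst].
(* Here phi' = - (c - v) w' and c - v = r c + w. *)
have lims : (r * c + w x) * (dw x / ln (1 / x)) - 1 / (3 * pi) @[x --> 0^'+] --> (0 : R).
  rewrite [X in _ --> X](_ : _ = (r * c + 0) * A - 1 / (3 * pi)); last first.
    by rewrite addr0 ArE subrr.
  apply: cvgB; last exact: cvg_cst.
  by apply: cvgM => //; apply: cvgD => //; exact: cvg_cst.
rewrite AE; split.
- exists (fun x => w x / (x * ln (1 / x)) - A).
    rewrite [X in _ --> X](_ : _ = A - A); last by rewrite subrr.
    by apply: cvgB => //; exact: cvg_cst.
  apply: filterS near01 => x [x0 _ l0].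
  by rewrite [A + _]addrC subrK divfK ?gt_eqF ?mulr_gt0// /w subKr.
- exists (fun x => r * c * (w x / (x * ln (1 / x))) + w x / (x * ln (1 / x)) * w x / 2 - 1 / (3 * pi)) => //.
  apply: filterS near01 => x [x0 _ l0].
  rewrite [1 / (3 * pi) + _]addrC subrK phi_def.
  have -> : (r * c * (w x / (x * ln (1 / x))) + w x / (x * ln (1 / x)) * w x / 2) * (x * ln (1 / x))
      = r * c * w x + w x ^+ 2 / 2.
    by field; rewrite !gt_eqF.
  have vE : v x = (1 - r) * c - w x by rewrite /w subKr.
  rewrite vE (_ : c ^+ 2 / 3 = c ^+ 2 * (1 - r ^+ 2) / 2); last by rewrite r2; field.
  by field.
- exists (fun x => dw x / ln (1 / x) - A).
    rewrite [X in _ --> X](_ : _ = A - A); last by rewrite subrr.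
    by apply: cvgB => //; exact: cvg_cst.
  apply: filterS near01 => x [x0 _ l0].
  by rewrite [A + _]addrC subrK mulNr divfK ?gt_eqF// /dw opprK.
- exists (fun x => (r * c + w x) * (dw x / ln (1 / x)) - 1 / (3 * pi)) => //.
  apply: filterS near01 => x [x0 xn l0].
  have d := dv x x0 xn.
  have dphi : is_derive x 1 phi ((c - v x) * derive1 v x).
    rewrite phi_def (_ : (fun y => _) = (fun y => c * v y - 1 / 2 * (v y * v y))); last first.
      by apply/funext => y; field.
    by apply: (is_derive_eq (derB (derZ c d) (derZ (1 / 2) (derM d d)))); field.
  rewrite [1 / (3 * pi) + _]addrC subrK derive1E derive_val mulNr -mulrA divfK ?gt_eqF//.
  by rewrite /dw /w mulrN opprK; congr (_ * _); ring.
Qed.
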